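(* For any $r\in(0,1)$, let $$v_m=\max\Big\{\Big\lfloor\frac m2+\frac{\sqrt m}{2}Q^{-1}(1-r)\Big\rfloor,0\Big\}.$$ Then the rate $r_m$ of $\mathrm{RM}(v_m,m)$ satisfies $r_m\to r$, and the sequence $\{\mathrm{RM}(v_m,m)\}_m$ is capacity achieving on the BEC under block-MAP decoding.
   Context: $Q(t)=\frac1{\sqrt{2\pi}}\int_t^\infty e^{-\tau^2/2}d\tau$. $\mathrm{RM}(v,m)$ is the binary code of length $N=2^m$ consisting of the evaluation vectors $(f(\underline{x}))_{\underline{x}\in\{0,1\}^m}$ of all polynomials over $\mathbb{F}_2$ in the span of multilinear monomials in $x_1,\dots,x_m$ of degree at most $v$; its rate is $2^{-m}\sum_{k=0}^v\binom mk$. A uniform codeword $\underline{X}$ is sent over $\mathrm{BEC}(p)$ (each bit erased independently with probability $p$), giving $\underline{Y}$; $P_B(p)$ is the probability that $\underline{X}$ is not uniquely determined by $\underline{Y}$. A code sequence with rates $r_n\to r\in(0,1)$ is capacity achieving under block-MAP decoding if $P_B^{(n)}(p)\to0$ for every $p\in[0,1-r)$. *)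

(* Defs.v *)
From HB Require Import structures.
From Stdlib Require Import Reals ClassicalEpsilon.
From mathcomp Require Import all_boot.
Set Implicit Arguments. Unset Strict Implicit. Unset Printing Implicit Defensive.

Open Scope R_scope.

Definition gauss_density (tau : R) : R := exp (- (tau * tau) / 2) / sqrt (2 * PI).

Definition gauss_int_is (a b v : R) : Prop :=
  exists pr : Riemann_integrable gauss_density a b, RiemannInt pr = v.

Definition gauss_int (a b : R) : R := epsilon (inhabits 0) (gauss_int_is a b).

Definition Q (t : R) : R :=
  epsilon (inhabits 0) (fun q => Un_cv (fun n => gauss_int t (t + INR n)) q).

(* Q is a strictly decreasing bijection R -> (0,1); Qinv y is the t with Q t = y *)
Definition Qinv (y : R) : R := epsilon (inhabits 0) (fun t => Q t = y).

Definition point (m : nat) := {ffun 'I_m -> bool}.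
Definition word (m : nat) := {ffun point m -> bool}.

(* evaluation of the multilinear monomial prod_{i in A} x_i at x *)
Definition monomial_eval (m : nat) (A : {set 'I_m}) (x : point m) : bool :=
  [forall i in A, x i].

(* RM(v,m): the F_2-span of evaluation vectors of monomials of degree <= v,
   i.e. sums (xor) of sub-collections S of such monomials *)
Definition RM (v m : nat) : {set word m} :=
  [set w : word m | [exists S : {set {set 'I_m}},
      (S \subset [set A : {set 'I_m} | (#|A| <= v)%N]) &&
      [forall x : point m, w x == \big[addb/false]_(A in S) monomial_eval A x]]].

Definition RM_rate (v m : nat) : R :=
  INR (\sum_(0 <= k < v.+1) 'C(m, k))%N / (2 ^ m).

(* x is not uniquely determined when the positions in E are erased *)
Definition ambiguous (m : nat) (C : {set word m}) (x : word m) (E : {set point m}) : bool :=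
  [exists x' in C, (x' != x) && [forall i in ~: E, x' i == x i]].

(* P_B(p): X uniform on C, each of the N positions erased independently w.p. p *)
Definition PB (m : nat) (C : {set word m}) (p : R) : R :=
  \big[Rplus/0]_(x in C)
    (/ INR #|C| *
     \big[Rplus/0]_(E : {set point m})
        (p ^ #|E| * (1 - p) ^ (#|point m| - #|E|)%N *
         (if ambiguous C x E then 1 else 0))).

Definition v_seq (r : R) (m : nat) : nat :=
  Z.to_nat (Z.max (Int_part (INR m / 2 + sqrt (INR m) / 2 * Qinv (1 - r))) 0).

(* Main.v *)
(** For RM(v, m) of length [N] let [H(p)] be the probability that the bit at
    the origin is not determined by the other received bits, and let [D] be the dimension
    of the subcode supported on the erasures, so that [(E D)' = N H].

    Restricting RM(v, n+a) to two n-dimensional subspaces that meet in the kernel of a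
    random n x a matrix, and expanding the loss event in the p-biased Fourier basis, gives
    [H_(n+a) <= sum_T fhat(T)^2 (|T|+1)^(-a)].  In particular [H_(n+a) <= H_n^2 + 2^(-a)];
    as the rates of RM(v, n) and RM(v, n+a) differ by [O(a / sqrt n)], the integral of
    [H (1 - H)] tends to [0] and the monotone function [H] jumps at one minus the rate.
    Below the jump, hypercontractivity bounds the low-degree part of the same sum by a
    power of [H] larger than one, and [o(sqrt m)] additional dimensions bring [H] down to
    [exp (- X)] with [X] much larger than [sqrt (m log m)].

    When [p] decreases, [D] is a pure death process whose rate at [D = j] is at least the
    smallest support of a j-dimensional subcode.  Such a support of size [u] satisfies
    [j <= (2^s - 1)^(v-m) u^s] for every [s >= 1], which makes the total death time
    negligible as soon as the support is below [2^m exp (- X)].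

    The rate itself is a central limit theorem: [Phi (y / sqrt t)] solves the heat equation,
    and one step of the simple random walk follows it up to a third order error. *)

(* The size of [X] is squeezed from two sides. Write [X = L sqrt m] up to a constant. The death
   process leaves an error of order [m exp (- L^2 / 4)], so [L] must exceed [sqrt (log m)] by an
   unbounded factor. Reaching [exp (- X)] costs about [X / log l] dimensions when the Fourier sum is
   cut at sets of size [l], and [l] cannot exceed a power of [m]; a cost of [o(sqrt m)] dimensions,
   which the rate tolerates, therefore asks for [L = o(log m)]. The choice is [L = (log m)^(3/4)].
   All asymptotics are written in the variable [y] with [y^4 = ln m], so that [L = y^3], the cost is
   [O(sqrt m / y)] and the final error is [O(1 / y)].

   Two looks help because a Fourier mode is common to both subspaces only if its set of points lies
   in their intersection, and a random intersection is unlikely to contain many prescribed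
   points. *)
Require Import Defs.
From HB Require Import structures.
From Stdlib Require Import Reals Lra Psatz ZArith ClassicalEpsilon.
From Coquelicot Require Import Coquelicot.
From mathcomp Require Import all_boot.
From mathcomp Require all_order all_algebra ring lra zify.
From mathcomp Require Import Rstruct.
Set Implicit Arguments. Unset Strict Implicit. Unset Printing Implicit Defensive.
Open Scope R_scope.
Delimit Scope R_scope with coqR.

(** * Gaussian integral *)

Section GaussianIntegral.

Definition bell (x : R) : R := exp (- (x * x) / 2).
Definition bell_int (t : R) : R := RInt bell 0 t.

Lemma bell_continuous x : continuous bell x.
Proof. by apply: (ex_derive_continuous bell); rewrite /bell; auto_derive. Qed.

Lemma bell_ex_RInt a b : ex_RInt bell a b.
Proof. by apply: (ex_RInt_continuous (V := R_CompleteNormedModule)) => z _; exact: bell_continuous. Qed.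

Lemma is_derive_bell_int t : is_derive bell_int t (bell t).
Proof.
apply: (is_derive_RInt bell _ 0); last exact: bell_continuous.
by apply: filter_forall => b; apply: RInt_correct; exact: bell_ex_RInt.
Qed.

(** [bell_int ^ 2 + 2 * bell_aux] has derivative 0, and its value at 0 is an arctangent integral.
    This yields the Gaussian mass by one-variable calculus, without a double integral. *)
Let jint (t x : R) : R := exp (- (t * t) * (1 + x * x) / 2) / (1 + x * x).
Definition bell_aux (t : R) : R := RInt (jint t) 0 1.

Lemma one_sq_pos x : 0 < 1 + x * x.
Proof. nra. Qed.

Lemma jint_continuous t x : continuous (jint t) x.
Proof.
apply: (ex_derive_continuous (jint t)); rewrite /jint; auto_derive.
by have := one_sq_pos x; lra.
Qed.

Lemma jint_ex_RInt t a b : ex_RInt (jint t) a b.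
Proof. by apply: (ex_RInt_continuous (V := R_CompleteNormedModule)) => z _; exact: jint_continuous. Qed.

Lemma jint_derive t x : is_derive (fun u => jint u x) t (- t * exp (- (t * t) * (1 + x * x) / 2)).
Proof.
rewrite /jint; auto_derive; first by have := one_sq_pos x; lra.
rewrite /Rdiv; field; have := one_sq_pos x; lra.
Qed.

Lemma is_derive_bell_aux t : is_derive bell_aux t (- bell t * bell_int t).
Proof.
have := is_derive_RInt_param (fun u x => jint u x) 0 1 t.
have -> : RInt (fun x : R => Derive (fun u : R => jint u x) t) 0 1 = - bell t * bell_int t.
  rewrite (RInt_ext _ (fun x => scal (- bell t) (scal t (bell (t * x + 0))))).
    rewrite RInt_scal; last first.
      apply: (ex_RInt_continuous (V := R_CompleteNormedModule)) => z _.
      apply: (ex_derive_continuous (fun x => t * bell (t * x + 0))).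
      by rewrite /bell; auto_derive.
    rewrite RInt_comp_lin; last exact: bell_ex_RInt.
    by rewrite /bell_int /scal /= /mult /= Rmult_0_r Rmult_1_r !Rplus_0_r.
  move=> x _; rewrite (is_derive_unique _ _ _ (jint_derive t x)).
  rewrite /scal /= /mult /= /bell Rplus_0_r.
  have -> : - (t * t) * (1 + x * x) / 2 = - (t * t) / 2 + - (t * x * (t * x)) / 2 by field.
  rewrite exp_plus; ring.
apply.
- by apply: filter_forall => u x _; eexists; exact: jint_derive.
- move=> x _; apply: (continuity_2d_pt_ext (fun u v => - u * exp (- (u * u) * (1 + v * v) * / 2))).
    by move=> u v; rewrite (is_derive_unique _ _ _ (jint_derive u v)).
  apply: continuity_2d_pt_mult; first by apply: continuity_2d_pt_opp; exact: continuity_2d_pt_id1.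
  apply: (continuity_1d_2d_pt_comp exp).
    by apply: derivable_continuous_pt; exact: derivable_pt_exp.
  apply: continuity_2d_pt_mult; last exact: continuity_2d_pt_const.
  apply: continuity_2d_pt_mult.
    by apply: continuity_2d_pt_opp; apply: continuity_2d_pt_mult; exact: continuity_2d_pt_id1.
  apply: continuity_2d_pt_plus; first exact: continuity_2d_pt_const.
  by apply: continuity_2d_pt_mult; exact: continuity_2d_pt_id2.
- by apply: filter_forall => u; exact: jint_ex_RInt.
Qed.

Lemma bell_aux0 : bell_aux 0 = PI / 4.
Proof.
rewrite /bell_aux (RInt_ext _ (fun x => / (1 + x ^ 2))).
  have h : is_RInt (fun x => / (1 + x ^ 2)) 0 1 (minus (atan 1) (atan 0)).
    apply: (is_RInt_derive atan) => x _.
      by have := is_derive_atan x; rewrite Rsqr_pow2.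
    apply: (ex_derive_continuous (fun x => / (1 + x ^ 2))); auto_derive.
    by have := one_sq_pos x; lra.
  by rewrite (is_RInt_unique _ _ _ _ h) atan_1 atan_0 /minus /plus /opp /=; ring.
move=> x _; rewrite /jint Rmult_0_r Ropp_0 Rmult_0_l /Rdiv Rmult_0_l exp_0 Rmult_1_l.
by rewrite /= Rmult_1_r.
Qed.

Lemma bell_int_sqr t : 0 < t -> bell_int t ^ 2 = PI / 2 - 2 * bell_aux t.
Proof.
move=> t0; pose F u := bell_int u ^ 2 + 2 * bell_aux u.
have dF u : is_derive F u 0.
  have h1 := is_derive_bell_int u; have h2 := is_derive_bell_aux u.
  rewrite /F; auto_derive; first by split; [eexists; exact: h1 | split; [eexists; exact: h2|]].
  by rewrite (is_derive_unique _ _ _ h1) (is_derive_unique _ _ _ h2); ring.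
have e : F 0 = F t by apply: eq_is_derive => // u _; exact: dF.
have e0 : F 0 = PI / 2.
  rewrite /F bell_aux0 /bell_int RInt_point /zero /=; field.
move: e; rewrite e0 /F; lra.
Qed.

End GaussianIntegral.

Lemma bell_aux_bounds t : 0 <= bell_aux t <= bell t.
Proof.
have h x : 0 <= exp (- (t * t) * (1 + x * x) / 2) / (1 + x * x) <= bell t.
  have h1 := one_sq_pos x; split.
    by left; apply: Rdiv_lt_0_compat => //; exact: exp_pos.
  apply/Rle_div_l => //; rewrite -[X in X <= _]Rmult_1_r.
  apply: Rmult_le_compat; [left; exact: exp_pos | lra | | nra].
  rewrite /bell; case: (Rle_lt_or_eq_dec (- (t * t) * (1 + x * x) / 2) (- (t * t) / 2)).
  - nra.
  - by move=> ?; left; apply: exp_increasing.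
  - by move=> ->; lra.
split.
  have -> : 0 = RInt (fun=> 0) 0 1 by rewrite RInt_const /scal /= /mult /=; ring.
  apply: RInt_le; [lra | exact: ex_RInt_const | exact: jint_ex_RInt | ].
  by move=> x _; case: (h x).
have -> : bell t = RInt (fun=> bell t) 0 1 by rewrite RInt_const /scal /= /mult /=; ring.
apply: RInt_le; [lra | exact: jint_ex_RInt | exact: ex_RInt_const | ].
by move=> x _; case: (h x).
Qed.

Definition Phi (z : R) : R := / 2 + bell_int z / sqrt (2 * PI).

Lemma sqrt_2PI_ge1 : 1 <= sqrt (2 * PI).
Proof. by rewrite -{1}sqrt_1; apply: sqrt_le_1; have := PI2_1; lra. Qed.

Lemma gauss_densityE x : gauss_density x = bell x / sqrt (2 * PI).
Proof. by []. Qed.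

Lemma is_derive_Phi z : is_derive Phi z (gauss_density z).
Proof.
have h := is_derive_bell_int z; rewrite /Phi; auto_derive; first by eexists; exact: h.
by rewrite (is_derive_unique _ _ _ h) gauss_densityE Rmult_1_l.
Qed.

Lemma Phi_le x y : x <= y -> Phi x <= Phi y.
Proof.
case=> [xy|->]; last lra.
have [c [h hc]] : exists c, Phi y - Phi x = gauss_density c * (y - x) /\ x < c < y.
  by apply: MVT_cor2 => // c _; apply/is_derive_Reals; exact: is_derive_Phi.
have : 0 < gauss_density c.
  apply: Rdiv_lt_0_compat; first exact: exp_pos.
  by have := sqrt_2PI_ge1; lra.
nra.
Qed.

Lemma Phi_opp z : Phi (- z) = 1 - Phi z.
Proof.
have h : bell_int (- z) = - bell_int z.
  have := RInt_comp_lin bell (-1) 0 0 z (bell_ex_RInt _ _).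
  rewrite (_ : -1 * 0 + 0 = 0); last ring.
  rewrite (_ : -1 * z + 0 = - z); last ring.
  rewrite /bell_int => <-; rewrite (RInt_ext _ (fun x => opp (bell x))).
    by rewrite RInt_opp //; exact: bell_ex_RInt.
  move=> x _; rewrite /scal /= /mult /= /opp /= /bell.
  have -> : - ((-1 * x + 0) * (-1 * x + 0)) / 2 = - (x * x) / 2 by field.
  ring.
rewrite /Phi h; field; have := sqrt_2PI_ge1; lra.
Qed.

(** With [s = sqrt (2 * PI)] and [b = bell_int z], [bell_int_sqr] reads [(s / 2 - b) * (s / 2 + b) =
    2 * bell_aux z], so the bound on [bell_aux] bounds the tail. Quadratic decay is enough for every
    limit taken below. *)
Lemma Phi_tail z : 0 < z -> 0 <= 1 - Phi z <= 8 / (z * z).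
Proof.
move=> z0; have hs := bell_int_sqr z0; have [a0 a1] := bell_aux_bounds z.
have s1 := sqrt_2PI_ge1.
have ss : sqrt (2 * PI) * sqrt (2 * PI) = 2 * PI by apply: sqrt_sqrt; have := PI2_1; lra.
have b0 : 0 <= bell_int z.
  have -> : 0 = RInt (fun=> 0) 0 z by rewrite RInt_const /scal /= /mult /=; ring.
  apply: RInt_le; [lra | exact: ex_RInt_const | exact: bell_ex_RInt | ].
  by move=> x _; left; exact: exp_pos.
have e : bell z <= 2 / (z * z).
  have -> : bell z = / exp (z * z / 2) by rewrite /bell -exp_Ropp; congr exp; field.
  have := exp_ineq1_le (z * z / 2) => h.
  apply: (Rle_trans _ (/ (z * z / 2))); last by right; field; lra.
  by apply: Rinv_le_contravar; nra.
rewrite /Phi; set s := sqrt (2 * PI) in s1 ss *; set b := bell_int z in hs b0 *.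
have bs : b ^ 2 = (s / 2) ^ 2 - 2 * bell_aux z by rewrite hs; nra.
have -> : 1 - (/ 2 + b / s) = (s / 2 - b) / s by field; lra.
have h1 : b <= s / 2 by nra.
have h2 : (s / 2 - b) * s <= 4 * bell z by nra.
split; first by apply: Rmult_le_pos; [lra | left; apply: Rinv_0_lt_compat; lra].
apply: (Rle_trans _ ((s / 2 - b) * s)); last first.
  by apply: (Rle_trans _ (4 * (2 / (z * z)))); [lra | right; field; lra].
apply: Rmult_le_compat_l; first lra.
apply: (Rle_trans _ 1); last lra.
by rewrite -Rinv_1; apply: Rinv_le_contravar; lra.
Qed.

Lemma Phi_bounds z : 0 <= Phi z <= 1.
Proof.
have pos x : 0 < x -> 0 <= Phi x <= 1.
  move=> x0; have [h _] := Phi_tail x0; split; last lra.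
  have := @Phi_le (- x) x ltac:(lra); rewrite Phi_opp; lra.
have [h|h] := Rle_lt_dec z 0; last exact: pos.
have := pos (- z + 1) ltac:(lra); have := @Phi_le z (- z + 1) ltac:(lra).
have := @Phi_le (z - 1) z ltac:(lra).
have -> : z - 1 = - (- z + 1) by ring.
rewrite Phi_opp; lra.
Qed.

Lemma gauss_int_Phi a b : gauss_int a b = Phi b - Phi a.
Proof.
have h : is_RInt gauss_density a b (minus (Phi b) (Phi a)).
  apply: is_RInt_derive => x _; first exact: is_derive_Phi.
  apply: (ex_derive_continuous gauss_density); rewrite /gauss_density; auto_derive.
  by split => //; have := sqrt_2PI_ge1; lra.
have hex : ex_RInt gauss_density a b by eexists; exact: h.
pose pr := ex_RInt_Reals_0 _ _ _ hex.
have ex : exists v, gauss_int_is a b v by exists (RiemannInt pr), pr.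
rewrite /gauss_int; have [pr' <-] := epsilon_spec (inhabits 0) (gauss_int_is a b) ex.
by rewrite -RInt_Reals (is_RInt_unique _ _ _ _ h).
Qed.

Lemma Q_Phi t : Q t = 1 - Phi t.
Proof.
have h : Un_cv (fun n => gauss_int t (t + INR n)) (1 - Phi t).
  apply/is_lim_seq_Reals; apply: (is_lim_seq_ext (fun n => Phi (t + INR n) - Phi t)).
    by move=> n; rewrite gauss_int_Phi.
  apply: is_lim_seq_minus'; last exact: is_lim_seq_const.
  have hlim : is_lim_seq (fun n => t + INR n) p_infty.
    apply: (is_lim_seq_plus _ _ (Rbar.Finite t) p_infty); [exact: is_lim_seq_const | exact: is_lim_seq_INR | by []].
  apply: (is_lim_seq_le_le_loc (fun n => 1 - 8 / ((t + INR n) * (t + INR n))) _ (fun=> 1)).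
  - have [N hN] := (proj2 (is_lim_seq_spec _ _) hlim) 0; exists N => n Nn; have hp := hN n Nn.
    by have := Phi_tail hp; lra.
  - have -> : Rbar.Finite 1 = Rbar.Finite (1 - 0) by congr Rbar.Finite; ring.
    apply: is_lim_seq_minus'; first exact: is_lim_seq_const.
    apply: (is_lim_seq_div _ _ (Rbar.Finite 8) p_infty (Rbar.Finite 0)).
    + exact: is_lim_seq_const.
    + exact: (is_lim_seq_mult _ _ p_infty p_infty).
    + by [].
    + by rewrite /is_Rbar_div /= /is_Rbar_mult /= Rmult_0_r.
  - exact: is_lim_seq_const.
have ex : exists q, Un_cv (fun n => gauss_int t (t + INR n)) q by exists (1 - Phi t).
have := epsilon_spec (inhabits 0) (fun q => Un_cv (fun n => gauss_int t (t + INR n)) q) ex.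
by move=> h'; exact: (UL_sequence _ _ _ h' h).
Qed.

Lemma Qinv_Phi r : 0 < r < 1 -> Phi (Qinv (1 - r)) = r.
Proof.
move=> hr; suff ex : exists t, Q t = 1 - r.
  by have := epsilon_spec (inhabits 0) (fun t => Q t = 1 - r) ex; rewrite Q_Phi -/(Qinv _); lra.
have far d : 0 < d -> exists2 z, 0 < z & 1 - Phi z < d.
  move=> d0; pose z := 8 / d + 1.
  have z1 : 1 < z by rewrite /z; have := Rdiv_lt_0_compat 8 d ltac:(lra) d0; lra.
  exists z; first lra.
  apply: (Rle_lt_trans _ (8 / (z * z))); first by case: (@Phi_tail z ltac:(lra)).
  apply/Rlt_div_l; first nra.
  have : d * z = 8 + d by rewrite /z; field; lra.
  nra.
have [z1 z10 h1] := far (1 - r) ltac:(lra); have [z2 z20 h2] := far r ltac:(lra).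
have cont : continuity (fun x => Phi x - r).
  move=> x; apply/continuity_pt_filterlim; apply: (ex_derive_continuous (fun x => Phi x - r)).
  by have := is_derive_Phi x => h; auto_derive; eexists; exact: h.
have [x [_ hx]] := IVT (fun x => Phi x - r) (- z2) z1 cont ltac:(lra)
  ltac:(cbv beta; rewrite Phi_opp; lra) ltac:(cbv beta; lra).
by exists x; rewrite Q_Phi; lra.
Qed.

(** * Central limit theorem through the heat equation *)

Lemma is_derive_eq (f g : R -> R) (x l l' : R) :
  (forall t, f t = g t) -> l = l' -> is_derive f x l -> is_derive g x l'.
Proof. by move=> fg <- h; exact: (is_derive_ext f g x l fg h). Qed.

(** One-sided mean value inequality. It stands in for the integrals of the area theorem and of the
    death process. *)
Lemma increase_bound (F dF : R -> R) (a b c : R) : a <= b ->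
  (forall x, a <= x <= b -> is_derive F x (dF x)) ->
  (forall x, a < x < b -> c <= dF x) -> c * (b - a) <= F b - F a.
Proof.
move=> [ab|->] h1 h2; last lra.
have [x [-> hx]] : exists x, F b - F a = dF x * (b - a) /\ a < x < b.
  by apply: MVT_cor2 => // x hx; apply/is_derive_Reals; exact: h1.
apply: Rmult_le_compat_r; [lra | exact: h2].
Qed.

Lemma lipschitz_derive (F dF : R -> R) (a b C : R) : a <= b ->
  (forall x, a <= x <= b -> is_derive F x (dF x)) ->
  (forall x, a <= x <= b -> Rabs (dF x) <= C) -> Rabs (F b - F a) <= C * (b - a).
Proof.
move=> [ab|<-] h1 h2; last by rewrite Rminus_diag Rabs_R0 Rminus_diag; lra.
have [c [-> hc]] : exists c, F b - F a = dF c * (b - a) /\ a < c < b.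
  by apply: MVT_cor2 => // c hc; apply/is_derive_Reals; exact: h1.
rewrite Rabs_mult (Rabs_pos_eq (b - a)); last lra.
by apply: Rmult_le_compat_r; [lra | apply: h2; lra].
Qed.

Section Heat.

(** [kern] is the space derivative of [heat], the Gaussian density of variance [t]; [gkern] is minus
    the space derivative of [kern], and the time derivative of [heat] is [- gkern / 2]. *)
Definition kern (t z : R) : R := / sqrt (2 * PI) * exp (- (z * z) / (2 * t)) / sqrt t.
Definition gkern (t z : R) : R := z / t * kern t z.
Definition heat (t y : R) : R := Phi (y / sqrt t).

Lemma kern_pos t z : 0 < t -> 0 < kern t z.
Proof.
move=> t0; apply: Rdiv_lt_0_compat; last exact: sqrt_lt_R0.
apply: Rmult_lt_0_compat; last exact: exp_pos.
by apply: Rinv_0_lt_compat; have := sqrt_2PI_ge1; lra.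
Qed.

Lemma gauss_density_kern t z : 0 < t -> gauss_density (z / sqrt t) / sqrt t = kern t z.
Proof.
move=> t0; have st : 0 < sqrt t by exact: sqrt_lt_R0.
have ss : sqrt t * sqrt t = t by apply: sqrt_sqrt; lra.
have pi1 := sqrt_2PI_ge1.
rewrite /gauss_density /kern.
have -> : - (z / sqrt t * (z / sqrt t)) / 2 = - (z * z) / (2 * t).
  by rewrite -{3}ss; field; lra.
by field; lra.
Qed.

Lemma is_derive_heat_space t z : 0 < t -> is_derive (heat t) z (kern t z).
Proof.
move=> t0; have h := is_derive_Phi (z / sqrt t).
have st : 0 < sqrt t by exact: sqrt_lt_R0.
rewrite /heat; auto_derive; first by eexists; exact: h.
rewrite (is_derive_unique _ _ _ h) -gauss_density_kern //; field; lra.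
Qed.

Lemma is_derive_heat_time t y s : 0 < t ->
  is_derive (fun s => heat (t + s * s) y) s (- s * gkern (t + s * s) y).
Proof.
move=> t0; have T0 : 0 < t + s * s by nra.
have st : 0 < sqrt (t + s * s) by exact: sqrt_lt_R0.
have ss : sqrt (t + s * s) * sqrt (t + s * s) = t + s * s by apply: sqrt_sqrt; lra.
have h := is_derive_Phi (y / sqrt (t + s * s)).
rewrite /heat; auto_derive; first by split; [eexists; exact: h | lra].
rewrite (is_derive_unique _ _ _ h) /gkern -gauss_density_kern //.
move: (sqrt (t + s * s)) st ss (gauss_density _) => q q0 qq g.
rewrite -qq; field; lra.
Qed.

Lemma is_derive_kern t z : 0 < t -> is_derive (kern t) z (- gkern t z).
Proof.
move=> t0; have st : 0 < sqrt t by exact: sqrt_lt_R0.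
have pi1 := sqrt_2PI_ge1.
rewrite /gkern /kern /Rdiv; auto_derive => //.
field; lra.
Qed.

Lemma is_derive_gkern_space t z : 0 < t ->
  is_derive (gkern t) z ((/ t - z * z / (t * t)) * kern t z).
Proof.
move=> t0; have h := is_derive_kern z t0.
rewrite /gkern; auto_derive; first by eexists; exact: h.
rewrite (is_derive_unique _ _ _ h) /gkern; field; lra.
Qed.

Lemma is_derive_gkern_time t z : 0 < t ->
  is_derive (fun t => gkern t z) t (gkern t z * (z * z / (2 * t) - 3 / 2) / t).
Proof.
move=> t0; have st : 0 < sqrt t by exact: sqrt_lt_R0.
have ss : sqrt t * sqrt t = t by apply: sqrt_sqrt; lra.
have pi1 := sqrt_2PI_ge1.
rewrite /gkern /kern /Rdiv; auto_derive; first by repeat split => //; lra.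
move: (sqrt t) st ss (exp _) => q q0 qq g; rewrite -qq; field; lra.
Qed.

(** With [q = z^2 / (2t)], the inequality [(1 + q / 2)^2 <= exp q] absorbs the quadratic polynomials
    in [q] that the derivatives of [gkern] produce, once [|z| / sqrt t] is replaced by [1/2 + q]. *)
Lemma kern_exp_bound t z : 0 < t ->
  kern t z * (1 + z * z / (2 * t) / 2) ^ 2 <= / sqrt t.
Proof.
move=> t0; have st : 0 < sqrt t by exact: sqrt_lt_R0.
have pi1 := sqrt_2PI_ge1.
have q0 : 0 <= z * z / (2 * t) by apply: Rmult_le_pos; [nra | left; apply: Rinv_0_lt_compat; lra].
set q := z * z / (2 * t) in q0 *.
have -> : kern t z = / sqrt (2 * PI) * / exp (q / 2) ^ 2 * / sqrt t.
  rewrite /kern /Rdiv; congr (_ * _ * _); rewrite /= Rmult_1_r -exp_plus -exp_Ropp.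
  by congr exp; rewrite /q; field; lra.
have h := exp_ineq1_le (q / 2).
have h2 : (1 + q / 2) ^ 2 <= exp (q / 2) ^ 2 by apply: pow_incr; lra.
have e0 : 0 < exp (q / 2) ^ 2 by apply: pow_lt; exact: exp_pos.
have h3 : / exp (q / 2) ^ 2 * (1 + q / 2) ^ 2 <= 1.
  by apply: (Rmult_le_reg_l _ _ _ e0); rewrite -Rmult_assoc Rinv_r; lra.
have i1 : / sqrt (2 * PI) <= 1 by rewrite -Rinv_1; apply: Rinv_le_contravar; lra.
have i0 : 0 < / sqrt (2 * PI) by apply: Rinv_0_lt_compat; lra.
have it : 0 < / sqrt t by exact: Rinv_0_lt_compat.
have -> : / sqrt (2 * PI) * / exp (q / 2) ^ 2 * / sqrt t * (1 + q / 2) ^ 2 =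
  (/ sqrt (2 * PI) * (/ exp (q / 2) ^ 2 * (1 + q / 2) ^ 2)) * / sqrt t by ring.
rewrite -[X in _ <= X]Rmult_1_l; apply: Rmult_le_compat_r; first lra.
have : 0 < / exp (q / 2) ^ 2 * (1 + q / 2) ^ 2.
  by apply: Rmult_lt_0_compat; [exact: Rinv_0_lt_compat | apply: pow_lt; lra].
nra.
Qed.

Lemma gkern_space_bound t z : 0 < t ->
  Rabs ((/ t - z * z / (t * t)) * kern t z) <= 2 / (t * sqrt t).
Proof.
move=> t0; have st : 0 < sqrt t by exact: sqrt_lt_R0.
have h := kern_exp_bound z t0; have k0 := kern_pos z t0.
have q0 : 0 <= z * z / (2 * t) by apply: Rmult_le_pos; [nra | left; apply: Rinv_0_lt_compat; lra].
have e : z * z / (t * t) = 2 * (z * z / (2 * t)) * / t by field; lra.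
have it : 0 < / t by exact: Rinv_0_lt_compat.
rewrite e; set q := z * z / (2 * t) in q0 h *.
have -> : 2 / (t * sqrt t) = 2 * (/ sqrt t) * / t by field; lra.
have -> : (/ t - 2 * q * / t) * kern t z = ((1 - 2 * q) * kern t z) * / t by ring.
rewrite Rabs_mult (Rabs_pos_eq (/ t)); last lra.
apply: Rmult_le_compat_r; first lra.
rewrite Rabs_mult (Rabs_pos_eq (kern t z)); last lra.
have : Rabs (1 - 2 * q) <= 2 * (1 + q / 2) ^ 2 by apply: Rabs_le; split; nra.
nra.
Qed.

Lemma gkern_time_bound t z : 0 < t ->
  Rabs (gkern t z * (z * z / (2 * t) - 3 / 2) / t) <= 4 / (t * t).
Proof.
move=> t0; have st : 0 < sqrt t by exact: sqrt_lt_R0.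
have ss : sqrt t * sqrt t = t by apply: sqrt_sqrt; lra.
have h := kern_exp_bound z t0; have k0 := kern_pos z t0.
have q0 : 0 <= z * z / (2 * t) by apply: Rmult_le_pos; [nra | left; apply: Rinv_0_lt_compat; lra].
have it : 0 < / (t * t) by apply: Rinv_0_lt_compat; nra.
have ist : 0 < / sqrt t by exact: Rinv_0_lt_compat.
have hz : Rabs z * / sqrt t <= / 2 + z * z / (2 * t).
  have a2 : Rabs z * Rabs z = z * z by rewrite -Rabs_mult Rabs_pos_eq; nra.
  have -> : z * z / (2 * t) = (Rabs z * / sqrt t) * (Rabs z * / sqrt t) / 2.
    by rewrite -a2 -{1}ss; field; lra.
  have := Rle_0_sqr (Rabs z * / sqrt t - 1); rewrite /Rsqr; lra.
set q := z * z / (2 * t) in q0 h hz *.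
rewrite /gkern.
have -> : z / t * kern t z * (q - 3 / 2) / t =
   (z * kern t z * (q - 3 / 2)) * / (t * t) by field; lra.
rewrite Rabs_mult (Rabs_pos_eq (/ (t * t))); last lra.
rewrite /Rdiv; apply: Rmult_le_compat_r; first lra.
rewrite Rabs_mult (Rabs_mult z) (Rabs_pos_eq (kern t z)); last lra.
have h1 : Rabs (q - 3 / 2) <= q + 3 / 2 by apply: Rabs_le; lra.
have h2 : kern t z * sqrt t * (1 + q / 2) ^ 2 <= 1.
  have : kern t z * (1 + q / 2) ^ 2 * sqrt t <= / sqrt t * sqrt t.
    by apply: Rmult_le_compat_r; lra.
  rewrite Rinv_l; lra.
have -> : Rabs z = (Rabs z * / sqrt t) * sqrt t by field; lra.
set a := Rabs z * / sqrt t in hz *.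
have a0 : 0 <= a by apply: Rmult_le_pos; [exact: Rabs_pos | lra].
set K := kern t z * sqrt t in h2.
have K0 : 0 < K by apply: Rmult_lt_0_compat.
have -> : a * sqrt t * kern t z * Rabs (q - 3 / 2) = K * (a * Rabs (q - 3 / 2)).
  by rewrite /K; ring.
have h3 : a * Rabs (q - 3 / 2) <= (/ 2 + q) * (q + 3 / 2).
  by apply: Rmult_le_compat => //; exact: Rabs_pos.
have h4 : (/ 2 + q) * (q + 3 / 2) <= 4 * (1 + q / 2) ^ 2 by nra.
have : K * (a * Rabs (q - 3 / 2)) <= K * (4 * (1 + q / 2) ^ 2).
  by apply: Rmult_le_compat_l; lra.
lra.
Qed.

(** As a function of the step [s], the difference [w] vanishes at 0. By the heat equation its
    derivative is [s] times a difference of two values of [gkern] at distance at most [h] in space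
    and time, hence [O(h^2)], and [w h] is [O(h^3)]. Writing time as [t + s * s] lets one variable
    drive both the space and the time step. *)
Lemma heat_step (sg t y h : R) : 0 < sg -> sg <= t -> 0 <= h <= 1 ->
  Rabs ((heat t (y + h) + heat t (y - h)) / 2 - heat (t + h * h) y) <=
  (2 / (sg * sqrt sg) + 4 / (sg * sg)) * h ^ 3.
Proof.
move=> s0 st [h0 h1]; set C := 2 / _ + 4 / _.
have t0 : 0 < t by lra.
pose w s := (heat t (y + s) + heat t (y - s)) / 2 - heat (t + s * s) y.
pose dw s := (kern t (y + s) - kern t (y - s)) / 2 + s * gkern (t + s * s) y.
have dwP s : is_derive w s (dw s).
  have e1 := is_derive_heat_space (y + s) t0; have e2 := is_derive_heat_space (y - s) t0.
  have e3 := is_derive_heat_time y s t0.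
  have e4 : is_derive (fun s => heat t (y + s)) s (kern t (y + s)).
    have := is_derive_comp (heat t) (fun s => y + s) s _ 1 e1.
    rewrite /scal /= /mult /= Rmult_1_l; apply.
    by auto_derive => //; ring.
  have e5 : is_derive (fun s => heat t (y - s)) s (- kern t (y - s)).
    have := is_derive_comp (heat t) (fun s => y - s) s _ (-1) e2.
    rewrite /scal /= /mult /= (_ : -1 * kern t (y - s) = - kern t (y - s)); last ring.
    by apply; auto_derive => //; ring.
  rewrite /w /dw.
  have e6 := is_derive_plus _ _ _ _ _ e4 e5.
  have e7 := is_derive_minus _ _ _ _ _ (is_derive_scal _ _ (/ 2) _ e6) e3.
  apply: (is_derive_eq _ _ e7) => [u|]; rewrite /minus /plus /opp /scal /= /mult /=; field.
have hdw s : 0 <= s <= h -> Rabs (dw s) <= C * h ^ 2.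
  move=> hs.
  have [x [hx1 hx2]] : exists x, kern t (y + s) - kern t (y - s) = - gkern t x * (2 * s) /\
      y - s <= x <= y + s.
    have [hs0|hs0] := Rle_lt_dec s 0.
      by exists y; have -> : s = 0 by [lra]; rewrite Rplus_0_r Rminus_0_r; lra.
    have [x [hx1 hx2]] : exists x, kern t (y + s) - kern t (y - s) =
        - gkern t x * ((y + s) - (y - s)) /\ y - s < x < y + s.
      apply: MVT_cor2; first lra.
      by move=> x _; apply/is_derive_Reals; exact: is_derive_kern.
    by exists x; rewrite hx1; split; [ring | lra].
  have -> : dw s = s * ((gkern (t + s * s) y - gkern t y) + (gkern t y - gkern t x)).
    by rewrite /dw hx1; field.
  have it : 0 < / t by exact: Rinv_0_lt_compat.
  have sst : sqrt sg <= sqrt t by apply: sqrt_le_1; lra.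
  have ssg : 0 < sqrt sg by exact: sqrt_lt_R0.
  have b1 : Rabs (gkern (t + s * s) y - gkern t y) <= 4 / (sg * sg) * h.
    apply: (Rle_trans _ (4 / (sg * sg) * (t + s * s - t))).
      apply: (lipschitz_derive (F := fun t => gkern t y)); first nra.
        by move=> u hu; apply: is_derive_gkern_time; lra.
      move=> u hu; apply: Rle_trans (gkern_time_bound y _) _; first lra.
      by apply: Rmult_le_compat_l; [lra | apply: Rinv_le_contravar; nra].
    apply: Rmult_le_compat_l; last nra.
    by left; apply: Rdiv_lt_0_compat; nra.
  have b2 : Rabs (gkern t y - gkern t x) <= 2 / (sg * sqrt sg) * h.
    have bd u : Rabs ((/ t - u * u / (t * t)) * kern t u) <= 2 / (sg * sqrt sg).
      apply: Rle_trans (gkern_space_bound u t0) _.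
      by apply: Rmult_le_compat_l; [lra | apply: Rinv_le_contravar; nra].
    have c0 : 0 < 2 / (sg * sqrt sg) by apply: Rdiv_lt_0_compat; nra.
    have [xy|xy] := Rle_lt_dec x y.
      apply: (Rle_trans _ (2 / (sg * sqrt sg) * (y - x))).
        by apply: (lipschitz_derive (F := gkern t) (dF := fun u => (/ t - u * u / (t * t)) * kern t u)) => [//|u _|u _];
          [exact: is_derive_gkern_space | exact: bd].
      by apply: Rmult_le_compat_l; lra.
    rewrite Rabs_minus_sym.
    apply: (Rle_trans _ (2 / (sg * sqrt sg) * (x - y))).
      by apply: (lipschitz_derive (F := gkern t) (dF := fun u => (/ t - u * u / (t * t)) * kern t u)) => [|u _|u _];
          [lra | exact: is_derive_gkern_space | exact: bd].
    by apply: Rmult_le_compat_l; lra.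
  rewrite Rabs_mult (Rabs_pos_eq s); last lra.
  have := Rabs_triang (gkern (t + s * s) y - gkern t y) (gkern t y - gkern t x) => b3.
  have b4 : Rabs (gkern (t + s * s) y - gkern t y + (gkern t y - gkern t x)) <= C * h.
    apply: Rle_trans b3 _; apply: Rle_trans (Rplus_le_compat _ _ _ _ b1 b2) _.
    by right; rewrite /C; ring.
  have -> : C * h ^ 2 = h * (C * h) by rewrite /=; ring.
  by apply: Rmult_le_compat; [lra | exact: Rabs_pos | lra |].
have w0 : w 0 = 0.
  by rewrite /w Rplus_0_r Rminus_0_r Rmult_0_r Rplus_0_r; field.
have := lipschitz_derive h0 (fun s _ => dwP s) hdw.
rewrite w0 !Rminus_0_r -/(w h) => /Rle_trans; apply; right; rewrite /=; ring.
Qed.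
End Heat.

Section RandomWalk.
Variable h : R.

Fixpoint walk (j : nat) (g : R -> R) (y : R) : R :=
  if j is j'.+1 then (walk j' g (y + h) + walk j' g (y - h)) / 2 else g y.

(** The accumulated error [j * h^3] vanishes in the limit when [h = 1 / sqrt j]. The initial time
    [sg > 0] keeps away from time 0, where the constant of [heat_step] blows up. *)
Lemma walk_heat sg j y : 0 < sg -> 0 <= h <= 1 ->
  Rabs (walk j (heat sg) y - heat (sg + INR j * (h * h)) y) <=
  INR j * ((2 / (sg * sqrt sg) + 4 / (sg * sg)) * h ^ 3).
Proof.
move=> s0 h01; set C := _ * h ^ 3; elim: j y => [|j IH] y.
  by rewrite /= !Rmult_0_l Rplus_0_r Rminus_diag Rabs_R0; lra.
rewrite S_INR [walk _ _ _]/=.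
have e1 := IH (y + h); have e2 := IH (y - h).
have t0 : sg <= sg + INR j * (h * h) by have := pos_INR j; nra.
have e3 := heat_step y s0 t0 h01; rewrite -/C in e3.
rewrite (_ : sg + (INR j + 1) * (h * h) = sg + INR j * (h * h) + h * h); last ring.
move: e1 e2 e3; move: (walk j _ _) (walk j _ _) (heat _ (y + h)) (heat _ (y - h)) (heat _ y).
move=> a b c d e /Rabs_le_between e1 /Rabs_le_between e2 /Rabs_le_between e3.
by apply/Rabs_le_between; lra.
Qed.

Lemma walk_le j g g' y : (forall z, g z <= g' z) -> walk j g y <= walk j g' y.
Proof.
move=> gg; elim: j y => [|j IH] y /=; first exact: gg.
have := IH (y + h); have := IH (y - h); lra.
Qed.

Lemma walk_add j g c y : walk j (fun z => g z + c) y = walk j g y + c.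
Proof. by elim: j y => [//|j IH] y /=; rewrite !IH; field. Qed.

Lemma walk_reflect j g c y : walk j (fun z => g (c - z)) y = walk j g (c - y).
Proof.
elim: j y => [//|j IH] y /=; rewrite !IH.
have -> : c - (y + h) = c - y - h by ring.
have -> : c - (y - h) = c - y + h by ring.
by field.
Qed.

Lemma pascal_sum (m : nat) (G : nat -> R) :
  \big[Rplus/0]_(0 <= k < m.+2) (INR 'C(m.+1, k) * G k) =
  \big[Rplus/0]_(0 <= k < m.+1) (INR 'C(m, k) * (G k.+1 + G k)).
Proof.
rewrite big_nat_recl // bin0.
under eq_bigr do rewrite binS plus_INR Rmult_plus_distr_r.
under [RHS]eq_bigr do rewrite Rmult_plus_distr_l Rplus_comm.
rewrite !big_split /= -Rplus_assoc; congr (_ + _).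
have := @big_nat_recl R 0 Rplus m.+1 0 (fun k => INR 'C(m, k) * G k) isT.
rewrite bin0 => <-; rewrite big_nat_recr //= bin_small // Rmult_0_l Rplus_0_r.
by [].
Qed.

Lemma walk_sum m g y : walk m g y =
  / 2 ^ m * \big[Rplus/0]_(0 <= k < m.+1) (INR 'C(m, k) * g (y + (2 * INR k - INR m) * h)).
Proof.
elim: m y => [|m IH] y.
  by rewrite big_nat1 /= (_ : y + _ = y); [field | ring].
rewrite [walk _ _ _]/= !IH (pascal_sum m (fun k => g (y + (2 * INR k - INR m.+1) * h))).
set S1 := \big[Rplus/0]_(0 <= k < m.+1) (_ * g (y + h + _)).
set S2 := \big[Rplus/0]_(0 <= k < m.+1) (_ * g (y - h + _)).
have -> : \big[Rplus/0]_(0 <= k < m.+1) (INR 'C(m, k) *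
    (g (y + (2 * INR k.+1 - INR m.+1) * h) + g (y + (2 * INR k - INR m.+1) * h))) = S1 + S2.
  rewrite -big_split /=; apply: eq_bigr => k _; rewrite Rmult_plus_distr_l.
  by congr (_ * g _ + _ * g _); rewrite -/(INR m.+1) -/(INR k.+1) !S_INR; ring.
by rewrite -tech_pow_Rmult; field; apply: pow_nonzero; lra.
Qed.

Definition stepf (x y : R) : R :=
  match Rle_dec y x with left _ => 1 | right _ => 0 end.

Lemma RM_rate_walk (m v : nat) (x : R) :
  (forall k : nat, (k <= v)%N <-> (2 * INR k - INR m) * h <= x) ->
  RM_rate v m = walk m (stepf x) 0.
Proof.
move=> hv; rewrite walk_sum /RM_rate /Rdiv Rmult_comm; congr (_ * _).
rewrite (big_morph INR plus_INR (erefl _)).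
(* [v] may exceed [m]: both sums are extended to a common range, on which the binomial coefficients
   beyond [m] vanish. *)
rewrite (@big_nat_widen _ _ _ 0 v.+1 (v.+1 + m.+1)) ?leq_addr //.
rewrite [RHS](@big_nat_widen _ _ _ 0 m.+1 (v.+1 + m.+1)) ?leq_addl //.
rewrite [LHS]big_mkcond [RHS]big_mkcond /=; apply: eq_bigr => k _.
rewrite Rplus_0_l /stepf !ltnS; case: Rle_dec => hk.
  rewrite (proj2 (hv k) hk); case: leqP => // km; first by rewrite Rmult_1_r.
  by rewrite bin_small.
have -> : (k <= v)%N = false by apply/negP => /(proj1 (hv k)).
by case: ifP => // _; rewrite Rmult_0_r.
Qed.

End RandomWalk.

(** * Convergence of the rate *)

Lemma v_seq_floor r m : let w := INR m / 2 + sqrt (INR m) / 2 * Qinv (1 - r) in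
  0 <= w -> INR (v_seq r m) <= w < INR (v_seq r m) + 1.
Proof.
move=> w w0; rewrite /v_seq -/w; have [h1 h2] := base_Int_part w.
have z0 : (0 <= Int_part w)%Z.
  by have : (-1 < Int_part w)%Z; [apply: lt_IZR; lra | lia].
rewrite Z.max_l // INR_IZR_INZ Z2Nat.id //; lra.
Qed.

(** Makes the truncation at 0 in [v_seq] inactive for large [m]: it suffices that
    [sqrt m >= - x]. *)
Lemma w_nonneg (x : R) : exists N : nat, forall m : nat, (N <= m)%coq_nat ->
  0 <= INR m / 2 + sqrt (INR m) / 2 * x.
Proof.
have [N hN] := nfloor_ex (x * x) ltac:(nra).
exists N.+1 => m Nm.
have mx : x * x <= INR m.
  by have := le_INR _ _ Nm; rewrite S_INR; lra.
have m0 := pos_INR m; have ss := sqrt_sqrt _ m0; have s0 := sqrt_pos (INR m).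
have : - x <= sqrt (INR m) by nra.
rewrite -{1}ss; nra.
Qed.

Lemma RM_rate_cvg r : 0 < r < 1 -> Un_cv (fun m => RM_rate (v_seq r m) m) r.
Proof.
move=> hr eps eps0; set x := Qinv (1 - r); have hx : Phi x = r := Qinv_Phi hr.
pose e (n : nat) := / (INR n + 1).
have e_pos n : 0 < e n by apply: Rinv_0_lt_compat; have := pos_INR n; lra.
have e_lim : is_lim_seq e 0.
  have := is_lim_seq_inv (fun n => INR n + 1) p_infty; apply => //.
  by apply: (is_lim_seq_plus _ _ p_infty (Rbar.Finite 1)); [exact: is_lim_seq_INR | exact: is_lim_seq_const | ].
(* [gp 1 u] and [gp (-1) u] are the values of [heat] at time [1 + u ^ 4] and at [x + u], [x - u].
   They will enclose the rate, and both tend to [Phi x = r] as [u] tends to 0. *)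
pose gp (s : R) (u : R) := Phi ((x + s * u) / sqrt (1 + u ^ 4)).
have gp_lim s : is_lim_seq (fun n => gp s (e n)) r.
  have -> : Rbar.Finite r = Rbar.Finite (gp s 0).
    by rewrite /gp Rmult_0_r /= Rmult_0_l !Rplus_0_r sqrt_1 Rdiv_1_r hx.
  apply: is_lim_seq_continuous => //; apply/continuity_pt_filterlim.
  apply: (ex_derive_continuous (gp s)); rewrite /gp; auto_derive; repeat split.
  - eexists; exact: is_derive_Phi.
  - by rewrite /=; lra.
  - by rewrite /= Rmult_0_l Rplus_0_r sqrt_1; lra.
have t_lim : is_lim_seq (fun n => 8 * (e n * e n)) 0.
  have -> : Rbar.Finite 0 = Rbar.Finite (8 * (0 * 0)) by congr Rbar.Finite; ring.
  by apply: is_lim_seq_mult'; [exact: is_lim_seq_const | exact: is_lim_seq_mult'].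
have eps4 : 0 < eps / 4 by lra.
have ev := fun s => proj2 (is_lim_seq_spec _ _) (gp_lim s) (mkposreal _ eps4).
have [N [[hN1 hN2] hN3]] := filter_ex _ (filter_and _ _ (filter_and _ _ (ev 1) (ev (-1)))
  (proj2 (is_lim_seq_spec _ _) t_lim (mkposreal _ eps4))).
move: hN1 hN2 hN3; rewrite /= => hN1 hN2 hN3.
set u := e N in hN1 hN2 hN3; have u0 : 0 < u := e_pos N.
(* The smoothing width [sqrt sg = u ^ 2] is small against the shift [u], so the smooth profile
   shifted by [u] dominates the step function up to [dl = 1 - Phi (1 / u) = O(u ^ 2)]. *)
pose sg := u ^ 4; have sg0 : 0 < sg by apply: pow_lt.
have ssg : sqrt sg = u ^ 2.
  by rewrite /sg (_ : u ^ 4 = u ^ 2 * u ^ 2); [apply: sqrt_square; apply: pow_le; lra | ring].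
pose dl := 1 - Phi (/ u).
have iu : 0 < / u by exact: Rinv_0_lt_compat.
have [dl0 dl1] := Phi_tail iu; rewrite -/dl in dl0 dl1.
have dl2 : dl < eps / 4.
  apply: Rle_lt_trans dl1 _.
  have -> : 8 / (/ u * / u) = 8 * (u * u) by field; lra.
  by move: hN3; rewrite Rminus_0_r Rabs_pos_eq //; nra.
have up y : stepf x y <= heat sg (x + u - y) + dl.
  rewrite /stepf /heat ssg; case: Rle_dec => hy; last by have := Phi_bounds ((x + u - y) / u ^ 2); lra.
  have : Phi (/ u) <= Phi ((x + u - y) / u ^ 2).
    apply: Phi_le; apply: (Rle_trans _ (u / u ^ 2)); first by right; field; lra.
    by apply: Rmult_le_compat_r; [left; apply: Rinv_0_lt_compat; apply: pow_lt | lra].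
  by rewrite /dl; lra.
have lo y : heat sg (x - u - y) + - dl <= stepf x y.
  rewrite /stepf /heat ssg; case: Rle_dec => hy; first by have := Phi_bounds ((x - u - y) / u ^ 2); lra.
  have : Phi ((x - u - y) / u ^ 2) <= Phi (- / u).
    apply: Phi_le; apply: (Rle_trans _ (- u / u ^ 2)); last by right; field; lra.
    by apply: Rmult_le_compat_r; [left; apply: Rinv_0_lt_compat; apply: pow_lt | lra].
  by rewrite Phi_opp /dl; lra.
pose C := 2 / (sg * sqrt sg) + 4 / (sg * sg).
have C0 : 0 < C.
  by apply: Rplus_lt_0_compat; apply: Rdiv_lt_0_compat; try lra;
    apply: Rmult_lt_0_compat => //; apply: sqrt_lt_R0.
have [N1 hw] := w_nonneg x.
have [N2 hN2'] := nfloor_ex ((4 * C / eps) ^ 2) ltac:(apply: pow2_ge_0).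
exists (Nat.add N1 (Nat.add N2 1)) => m hm.
have m1 : 1 <= INR m.
  have : (1 <= m)%coq_nat by lia.
  by move/le_INR; rewrite /=.
have mC : (4 * C / eps) ^ 2 < INR m.
  have : (Nat.add N2 1 <= m)%coq_nat by lia.
  by move/le_INR; rewrite plus_INR /=; lra.
pose h := / sqrt (INR m).
have s1 : 1 <= sqrt (INR m) by rewrite -{1}sqrt_1; apply: sqrt_le_1; lra.
have ss : sqrt (INR m) * sqrt (INR m) = INR m by apply: sqrt_sqrt; lra.
have h01 : 0 <= h <= 1.
  split; first by left; apply: Rinv_0_lt_compat; lra.
  by rewrite /h -Rinv_1; apply: Rinv_le_contravar; lra.
have mh : INR m * (h * h) = 1 by rewrite -ss /h; field; lra.
have mh3 : INR m * (C * h ^ 3) = C * h.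
  by rewrite (_ : INR m * (C * h ^ 3) = C * h * (INR m * (h * h))); [rewrite mh; ring | ring].
have Ch : C * h < eps / 4.
  have : 4 * C / eps < sqrt (INR m).
    apply: Rsqr_incrst_0; last lra.
      by rewrite /Rsqr ss; move: mC; rewrite /=; lra.
    by left; apply: Rdiv_lt_0_compat; lra.
  move/Rlt_div_l => /(_ eps0) hh.
  rewrite /h; apply: (Rmult_lt_reg_r (sqrt (INR m))); first lra.
  by rewrite Rmult_assoc Rinv_l; lra.
have hw0 : 0 <= INR m / 2 + sqrt (INR m) / 2 * x by apply: hw; lia.
have [f1 f2] := v_seq_floor hw0.
have hv (k : nat) : (k <= v_seq r m)%N <-> (2 * INR k - INR m) * h <= x.
  have eq : (2 * INR k - INR m) * h <= x <-> INR k <= INR m / 2 + sqrt (INR m) / 2 * x.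
    have e1 : (2 * INR k - INR m) * h * sqrt (INR m) = 2 * INR k - INR m.
      by rewrite /h; field; lra.
    split => hh; first nra.
    by apply: (Rmult_le_reg_r (sqrt (INR m))); lra.
  rewrite eq; split => [/leP/le_INR|hk]; first by move: f1; rewrite -/x; lra.
  apply/leP; have : INR k < INR (v_seq r m).+1 by rewrite S_INR; move: f2; rewrite -/x; lra.
  by move/INR_lt; lia.
rewrite /Rdist (RM_rate_walk hv).
have w1 := walk_heat m (x + u) sg0 h01; rewrite -/C mh mh3 in w1.
have w2 := walk_heat m (x - u) sg0 h01; rewrite -/C mh mh3 in w2.
have w3 := @walk_le h m _ _ 0 up; rewrite walk_add walk_reflect Rminus_0_r in w3.
have w4 := @walk_le h m _ _ 0 lo; rewrite walk_add walk_reflect Rminus_0_r in w4.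
have g1 : heat (sg + 1) (x + u) = gp 1 u by rewrite /heat /gp /sg Rmult_1_l (Rplus_comm 1).
have g2 : heat (sg + 1) (x - u) = gp (-1) u.
  by rewrite /heat /gp /sg (Rplus_comm 1) (_ : x + -1 * u = x - u) //; ring.
rewrite g1 in w1; rewrite g2 in w2.
move: w1 w2 hN1 hN2 => /Rabs_le_between w1 /Rabs_le_between w2.
move=> /Rabs_lt_between hN1 /Rabs_lt_between hN2.
by apply/Rabs_lt_between; lra.
Qed.

Module Combinatorics.
Import all_order all_algebra.
Import mathcomp.algebra_tactics.ring mathcomp.algebra_tactics.lra mathcomp.zify.zify.
Import Order.TTheory GRing.Theory Num.Theory.

(** * Size of binomial coefficients *)

Section CentralBinomial.
Local Open Scope nat_scope.

Lemma bin_central_max (j k : nat) : 'C(j.*2, k) <= 'C(j.*2, j).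
Proof.
have low i : i <= j -> 'C(j.*2, j - i) <= 'C(j.*2, j).
  elim: i => [|i IH] ij; first by rewrite subn0.
  apply: leq_trans (IH (ltnW ij)).
  have e : j - i = (j - i.+1).+1 by rewrite subnSK.
  rewrite e -(@leq_pmul2l (j - i.+1).+1) // mul_bin_left leq_mul2r; apply/orP; right.
  lia.
have [kj|jk] := leqP k j; first by rewrite -{1}(subKn kj); apply: low; exact: leq_subr.
have [k2|k2] := leqP k j.*2; last by rewrite bin_small.
have kj : j.*2 - k <= j by lia.
by rewrite -(bin_sub k2) -{1}(subKn kj); apply: low; exact: leq_subr.
Qed.

(** Squared to stay in the integers. The induction closes because
    [(2j + 1)(2j + 3) <= (2j + 2)^2]. *)
Lemma bin_central_bound (j : nat) : 'C(j.*2, j) ^ 2 * j.*2.+1 <= 16 ^ j.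
Proof.
elim: j => [//|j IH].
have e : j.+1 * 'C(j.+1.*2, j.+1) = j.*2.+1 * 2 * 'C(j.*2, j).
  have h1 := mul_bin_diag j.+1.*2 j; have h2 := mul_bin_down j.*2.+1 j.
  rewrite doubleS /= in h1 h2 *; rewrite -h1.
  have e1 : j.*2.+1 - j = j.+1 by lia.
  rewrite e1 in h2; nia.
rewrite -(@leq_pmul2l (j.+1 ^ 2)) ?expn_gt0 // mulnA -expnMn e.
have -> : (j.*2.+1 * 2 * 'C(j.*2, j)) ^ 2 * j.+1.*2.+1 =
  4 * (j.*2.+1 * j.+1.*2.+1) * ('C(j.*2, j) ^ 2 * j.*2.+1) by rewrite !expnMn; nia.
have -> : j.+1 ^ 2 * 16 ^ j.+1 = 4 * (4 * j.+1 ^ 2) * 16 ^ j 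
  by rewrite (expnS 16); move: (16 ^ j) (j.+1 ^ 2) => x y; nia.
by apply: leq_mul => //; rewrite leq_mul2l /=; nia.
Qed.

Lemma bin_sqr_bound (n k : nat) : 'C(n, k) ^ 2 * n <= 4 ^ n.
Proof.
have h := bin_central_bound n./2; have m := bin_central_max n./2.
have e16 : 16 ^ n./2 = 4 ^ (n./2.*2) by rewrite -mul2n expnM.
have [on|en] := boolP (odd n).
  have en : n = n./2.*2.+1 by rewrite -{1}(odd_double_half n) on.
  have hk : 'C(n, k) <= 2 * 'C(n./2.*2, n./2).
    rewrite {1}en; case: k => [|k]; first by have := m 0; rewrite !bin0; lia.
    by have := m k; have := m k.+1; rewrite binS; lia.
  apply: (@leq_trans ((2 * 'C(n./2.*2, n./2)) ^ 2 * n./2.*2.+1)).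
    by rewrite -en leq_mul2r leq_exp2r // hk orbT.
  rewrite expnMn -mulnA [X in _ <= 4 ^ X]en (expnS 4) -e16 (_ : 2 ^ 2 = 4) //.
  by rewrite leq_mul2l h orbT.
have en' : n = n./2.*2 by rewrite -{1}(odd_double_half n) (negPf en).
apply: (@leq_trans ('C(n./2.*2, n./2) ^ 2 * n./2.*2.+1)).
  rewrite {1 2}en'; apply: leq_mul => //; by rewrite leq_exp2r.
by rewrite [X in _ <= 4 ^ X]en' -e16.
Qed.

(** Pascal's rule on partial sums. One more variable at fixed degree thus lowers the rate by
    ['C(n, v) / 2^(n+1)]. *)
Lemma sum_bin_step (n v : nat) :
  \sum_(0 <= k < v.+1) 'C(n.+1, k) + 'C(n, v) = 2 * \sum_(0 <= k < v.+1) 'C(n, k).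
Proof.
elim: v => [|v IH]; first by rewrite !big_nat1 !bin0.
by rewrite big_nat_recr // [in RHS]big_nat_recr //= binS; lia.
Qed.

End CentralBinomial.

Local Open Scope ring_scope.

(** * Fourier analysis of the erasure measure *)

Section ProductMeasure.
Variables (R : realFieldType) (T : finType).
Implicit Types (p : R) (E S A : {set T}) (f g : {set T} -> R).

Definition mu p E : R := \prod_i (if i \in E then p else 1 - p).
Definition Ex p f : R := \sum_(E : {set T}) mu p E * f E.

Lemma sum_set_prod (F G : T -> R) :
  \sum_(E : {set T}) \prod_i (if i \in E then F i else G i) =
  \prod_i (F i + G i).
Proof. by rewrite bigA_distr. Qed.

Lemma mu_ge0 p E : 0 <= p <= 1 -> 0 <= mu p E.
Proof.
move=> /andP[p0 p1]; apply: prodr_ge0 => i _.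
by case: ifP => _ //; rewrite subr_ge0.
Qed.

Lemma Ex_prod p (F G : T -> R) :
  Ex p (fun E => \prod_i (if i \in E then F i else G i)) =
  \prod_i (p * F i + (1 - p) * G i).
Proof.
rewrite -sum_set_prod; apply: eq_bigr => E _; rewrite -big_split /=.
by apply: eq_bigr => i _; case: ifP.
Qed.

Lemma eq_Ex p f g : f =1 g -> Ex p f = Ex p g.
Proof. by move=> fg; apply: eq_bigr => E _; rewrite fg. Qed.

Lemma Ex_cst p c : Ex p (fun=> c) = c.
Proof.
rewrite -[RHS]mulr1 /Ex -mulr_suml mulrC; congr (_ * _).
rewrite sum_set_prod big1 // => i _; ring.
Qed.

Lemma ExD p f g : Ex p (fun E => f E + g E) = Ex p f + Ex p g.
Proof. by rewrite /Ex -big_split; apply: eq_bigr => E _; rewrite mulrDr. Qed.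

Lemma ExZ p c f : Ex p (fun E => c * f E) = c * Ex p f.
Proof. by rewrite /Ex mulr_sumr; apply: eq_bigr => E _; rewrite mulrCA. Qed.

Lemma ExB p f g : Ex p (fun E => f E - g E) = Ex p f - Ex p g.
Proof.
rewrite -mulN1r -ExZ -ExD; apply: eq_Ex => E; by rewrite mulN1r.
Qed.

Lemma Ex_sum p (I : Type) (r : seq I) (P : pred I) (F : I -> {set T} -> R) :
  Ex p (fun E => \sum_(i <- r | P i) F i E) = \sum_(i <- r | P i) Ex p (F i).
Proof.
rewrite /Ex exchange_big; apply: eq_bigr => E _; exact: mulr_sumr.
Qed.

Lemma Ex_ge0 p f : 0 <= p <= 1 -> (forall E, 0 <= f E) -> 0 <= Ex p f.
Proof. by move=> hp hf; apply: sumr_ge0 => E _; rewrite mulr_ge0 ?mu_ge0. Qed.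

Lemma Ex_le p f g : 0 <= p <= 1 -> (forall E, f E <= g E) -> Ex p f <= Ex p g.
Proof.
by move=> hp fg; rewrite -subr_ge0 -ExB; apply: Ex_ge0 => // E; rewrite subr_ge0.
Qed.

Lemma sum_set_split (i : T) f :
  \sum_(E : {set T}) f E = \sum_(E : {set T} | i \notin E) (f E + f (i |: E)).
Proof.
rewrite (bigID (fun E : {set T} => i \in E)) /= addrC big_split /=; congr (_ + _).
rewrite (reindex_onto (fun E => i |: E) (fun E => E :\ i)) /=; last first.
  by move=> E iE; rewrite setD1K.
apply: eq_bigl => E; rewrite setU11 /=.
apply/eqP/idP => [<-|]; first by rewrite !inE eqxx.
by move=> iE; rewrite setU1K.
Qed.

Definition mu_off p (i : T) E : R :=
  \prod_(j | j != i) (if j \in E then p else 1 - p).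

Lemma mu_offE p i E : mu p E = (if i \in E then p else 1 - p) * mu_off p i E.
Proof. by rewrite /mu (bigD1 i). Qed.

Lemma mu_offU p i E : mu_off p i (i |: E) = mu_off p i E.
Proof. by apply: eq_bigr => j ji; rewrite in_setU1 (negPf ji). Qed.

Lemma Ex_off p i f :
  Ex p f = \sum_(E : {set T} | i \notin E)
             mu_off p i E * (p * f (i |: E) + (1 - p) * f E).
Proof.
rewrite /Ex (sum_set_split i); apply: eq_bigr => E iE.
rewrite (mu_offE p i E) (mu_offE p i (i |: E)) (negPf iE) setU11 mu_offU.
ring.
Qed.

Lemma Ex_split p i f :
  Ex p f = Ex p (fun E => p * f (i |: E) + (1 - p) * f (E :\ i)).
Proof.
rewrite !(Ex_off p i); apply: eq_bigr => E iE; congr (_ * _).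
rewrite setU1K // setUA setUid; have -> : E :\ i = E; last by ring.
by apply/setP => j; rewrite !inE; case: eqP => // ->; rewrite (negPf iE).
Qed.

Lemma Ex_indep p i (w : bool -> R) f :
  (forall E, f (i |: E) = f (E :\ i)) ->
  Ex p (fun E => w (i \in E) * f E) = (p * w true + (1 - p) * w false) * Ex p f.
Proof.
move=> fi; rewrite (Ex_split p i) (Ex_split p i f) -ExZ; apply: eq_Ex => E.
by rewrite fi setU11 !inE eqxx /=; ring.
Qed.

Lemma Ex_CS p f g : 0 <= p <= 1 ->
  (Ex p (fun E => f E * g E)) ^+ 2 <=
  Ex p (fun E => f E ^+ 2) * Ex p (fun E => g E ^+ 2).
Proof.
move=> hp.
set a := Ex p (fun E => f E ^+ 2); set b := Ex p (fun E => f E * g E).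
set c := Ex p (fun E => g E ^+ 2).
have a0 : 0 <= a by apply: Ex_ge0 => // E; exact: sqr_ge0.
have c0 : 0 <= c by apply: Ex_ge0 => // E; exact: sqr_ge0.
have q x y : 0 <= x ^+ 2 * a - 2 * x * y * b + y ^+ 2 * c.
  have -> : x ^+ 2 * a - 2 * x * y * b + y ^+ 2 * c =
     Ex p (fun E => (x * f E - y * g E) ^+ 2).
    rewrite -!ExZ -ExB -ExD; apply: eq_Ex => E; ring.
  by apply: Ex_ge0 => // E; exact: sqr_ge0.
have [a_eq0|a_neq0] := eqVneq a 0; last first.
  have apos : 0 < a by rewrite lt_def a_neq0.
  have := q b a.
  have -> : b ^+ 2 * a - 2 * b * a * b + a ^+ 2 * c = a * (a * c - b ^+ 2) by ring.
  by rewrite pmulr_rge0 // subr_ge0.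
rewrite a_eq0 mul0r; have [->|b_neq0] := eqVneq b 0; first by rewrite expr0n.
(* For [a = 0] and [b <> 0], this point gives the nonnegative quadratic form the value -1. *)
have := q ((c + 1) / (2 * b)) 1.
have -> : ((c + 1) / (2 * b)) ^+ 2 * a - 2 * ((c + 1) / (2 * b)) * 1 * b +
  1 ^+ 2 * c = -1 by rewrite a_eq0; field.
lra.
Qed.

End ProductMeasure.
Arguments eq_Ex {R T p f g}.

Section Fourier.
Variables (R : realFieldType) (T : finType) (p al be : R).
Hypothesis p01 : 0 <= p <= 1.
Hypothesis chi_mean : p * al + (1 - p) * be = 0.
Hypothesis chi_var : p * al ^+ 2 + (1 - p) * be ^+ 2 = 1.
Implicit Types (E S A : {set T}) (f g : {set T} -> R).

Local Notation Ex := (@Ex R T p).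

(** [al] and [be] are the values of a standardized coordinate at an erased and at a received
    position. They stay abstract because they are square roots, which an ordered field need not
    contain; [biased_basis] supplies them over the reals. *)
Definition chi S E : R := \prod_(i in S) (if i \in E then al else be).

Lemma chiE S E : chi S E =
  \prod_i (if i \in E then (if i \in S then al else 1)
                      else (if i \in S then be else 1)).
Proof.
rewrite /chi big_mkcond; apply: eq_bigr => i _.
by case: (i \in S); case: (i \in E).
Qed.

Lemma chi_albe : al * be = -1.
Proof.
apply: (@addIr _ 1); rewrite -{1}chi_var addNr.
have -> : al * be + (p * al ^+ 2 + (1 - p) * be ^+ 2) =
  (p * al + (1 - p) * be) * (al + be) by ring.
by rewrite chi_mean mul0r.
Qed.

Lemma Ex_chi2 S S' : Ex (fun E => chi S E * chi S' E) = (S == S')%:R.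
Proof.
under eq_Ex => E do rewrite !chiE -big_split /=.
transitivity (\prod_i (if (i \in S) == (i \in S') then 1 else 0 : R)).
  rewrite -(eq_Ex (f := fun E => \prod_i (if i \in E
    then (if i \in S then al else 1) * (if i \in S' then al else 1)
    else (if i \in S then be else 1) * (if i \in S' then be else 1)))); last first.
    by move=> E; apply: eq_bigr => i _; case: (i \in E).
  rewrite Ex_prod; apply: eq_bigr => i _.
  case: (i \in S); case: (i \in S') => /=; rewrite -?expr2 ?chi_var //.
  - by rewrite !mulr1 chi_mean.
  - by rewrite !mul1r chi_mean.
  - ring.
have [->|/eqP/setP SS'] := eqVneq S S'.
  by rewrite big1 // => i _; rewrite eqxx.
case: (pickP (fun i => (i \in S) != (i \in S'))) => [i /negPf Hi|H].
  by rewrite (bigD1 i) //= Hi mul0r.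
by case: SS' => i; have /negbFE/eqP := H i.
Qed.

Definition fhat f S : R := Ex (fun E => f E * chi S E).

(** Dual orthogonality, the source of Fourier inversion. The sum over [S] factors over positions,
    and a position where [E] and [E'] differ contributes [1 + al * be = 0]. *)
Lemma sum_chi2 E E' : mu p E * \sum_S chi S E * chi S E' = (E == E')%:R.
Proof.
have -> : \sum_S chi S E * chi S E' =
  \prod_i (1 + (if i \in E then al else be) * (if i \in E' then al else be)).
  under [RHS]eq_bigr do rewrite addrC.
  rewrite -sum_set_prod; apply: eq_bigr => S _.
  by rewrite /chi -big_split /= big_mkcond.
have [->|EE'] := eqVneq E E'.
  rewrite /mu -big_split /= big1 // => i _.
  have ab := chi_albe; case: (i \in E'); apply: (@addrI _ (- 1)); rewrite addNr.
    have -> : -1 + p * (1 + al * al) = al * (p * al + (1 - p) * be) -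
      (1 - p) * (al * be + 1) by ring.
    by rewrite chi_mean ab; ring.
  have -> : -1 + (1 - p) * (1 + be * be) = be * (p * al + (1 - p) * be) -
    p * (al * be + 1) by ring.
  by rewrite chi_mean ab; ring.
case: (pickP (fun i => (i \in E) != (i \in E'))) => [i Hi|H]; last first.
  by case/eqP: EE'; apply/setP => i; have /negbFE/eqP := H i.
rewrite [X in _ * X](bigD1 i) //=.
have -> : 1 + (if i \in E then al else be) * (if i \in E' then al else be) = 0.
  by move: Hi; case: (i \in E); case: (i \in E') => // _;
    rewrite ?[be * al]mulrC chi_albe subrr.
by rewrite mul0r mulr0.
Qed.

Lemma fhat_inv f E : f E = \sum_S fhat f S * chi S E.
Proof.
rewrite /fhat /Ex.
under eq_bigr do rewrite mulr_suml.
rewrite exchange_big /=.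
transitivity (\sum_E' f E' * (E' == E)%:R).
  rewrite (bigD1 E) //= eqxx mulr1 big1 ?addr0 // => E' /negPf->.
  by rewrite mulr0.
apply: eq_bigr => E' _; rewrite -sum_chi2 mulrCA mulr_sumr mulr_sumr.
by apply: eq_bigr => S _; ring.
Qed.

Lemma parseval f g : Ex (fun E => f E * g E) = \sum_S fhat f S * fhat g S.
Proof.
transitivity (Ex (fun E => \sum_S fhat f S * (g E * chi S E))).
  apply: eq_Ex => E; rewrite {1}(fhat_inv f) mulr_suml.
  by apply: eq_bigr => S _; ring.
by rewrite Ex_sum; apply: eq_bigr => S _; rewrite ExZ.
Qed.

Lemma chiU1 i S E : i \notin S ->
  chi (i |: S) E = (if i \in E then al else be) * chi S E.
Proof. by move=> iS; rewrite /chi big_setU1. Qed.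

Lemma chi_off i S E : i \notin S -> chi S (i |: E) = chi S (E :\ i).
Proof.
move=> iS; apply: eq_bigr => j jS; rewrite !inE.
by case: eqP jS => // ->; rewrite (negPf iS).
Qed.

Lemma sum_subset_split i A f : i \in A ->
  \sum_(S : {set T} | S \subset A) f S =
  \sum_(S : {set T} | S \subset A :\ i) (f S + f (i |: S)).
Proof.
move=> iA; rewrite big_mkcond (sum_set_split i) [RHS]big_mkcond [LHS]big_mkcond /=.
apply: eq_bigr => S _; rewrite subsetD1 subUset sub1set iA /= andbC.
by case: (i \in S) => //=; case: ifP => //=; rewrite addr0.
Qed.

Variable K : R.
Let M3 := p * al ^+ 3 + (1 - p) * be ^+ 3.
Let M4 := p * al ^+ 4 + (1 - p) * be ^+ 4.
Hypothesis K1 : 1 <= K.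
Hypothesis KM3 : 3 + `|M3| <= K.
Hypothesis KM4 : M4 + 2 * `|M3| <= K ^+ 2.

(** Induction on the variables. Write the sum as [g + x h] with a standardized coordinate [x]
    independent of [g] and [h]; its fourth moment is [G + 6 X + 4 M3 Y + M4 H], the term linear in
    [x] having mean 0. Cauchy-Schwarz gives [X <= a b], and [2 |Y| <= X + H] distributes the skew
    term over the other two, which leaves exactly the conditions [KM3] and [KM4] on [K]. *)
Lemma hypercontractive_set (c : {set T} -> R) A :
  Ex (fun E => (\sum_(S : {set T} | S \subset A) c S * chi S E) ^+ 4) <=
  (\sum_(S : {set T} | S \subset A) K ^+ #|S| * c S ^+ 2) ^+ 2.
Proof.
elim: {A}_.+1 {-2}A (ltnSn #|A|) c => // n IH A; rewrite ltnS => cA c.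
have [->|[i iA]] := set_0Vmem A.
  under eq_Ex => E do under eq_bigl => S do rewrite subset0.
  under [X in _ <= X ^+ 2]eq_bigl => S do rewrite subset0.
  rewrite big_pred1_eq; under eq_Ex => E do
    rewrite big_pred1_eq /chi big_set0 mulr1.
  by rewrite Ex_cst cards0 expr0 mul1r -exprM.
have cAi : (#|A :\ i| < n)%N by move: cA; rewrite (cardsD1 i) iA.
pose x E := if i \in E then al else be.
pose g E := \sum_(S : {set T} | S \subset A :\ i) c S * chi S E.
pose h E := \sum_(S : {set T} | S \subset A :\ i) c (i |: S) * chi S E.
have IHg := IH _ cAi c; have IHh := IH _ cAi (fun S => c (i |: S)).
rewrite -/(g _) in IHg; rewrite -/(h _) in IHh.
set a := \sum_(S | _) _ in IHg; set b := \sum_(S | _) _ in IHh.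
have a0 : 0 <= a.
  by apply: sumr_ge0 => S _; rewrite mulr_ge0 ?sqr_ge0 ?exprn_ge0 // (le_trans ler01).
have b0 : 0 <= b.
  by apply: sumr_ge0 => S _; rewrite mulr_ge0 ?sqr_ge0 ?exprn_ge0 // (le_trans ler01).
have -> : \sum_(S : {set T} | S \subset A) K ^+ #|S| * c S ^+ 2 = a + K * b.
  rewrite (sum_subset_split _ iA) big_split /=; congr (_ + _).
  rewrite /b mulr_sumr; apply: eq_bigr => S; rewrite subsetD1 => /andP[_ iS].
  by rewrite cardsU1 iS add1n exprS mulrA.
have fE E : \sum_(S : {set T} | S \subset A) c S * chi S E = g E + x E * h E.
  rewrite (sum_subset_split _ iA) big_split /=; congr (_ + _).
  rewrite /h mulr_sumr; apply: eq_bigr => S; rewrite subsetD1 => /andP[_ iS].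
  by rewrite chiU1 // /x; ring.
have gi E : g (i |: E) = g (E :\ i).
  by apply: eq_bigr => S; rewrite subsetD1 => /andP[_ iS]; rewrite chi_off.
have hi E : h (i |: E) = h (E :\ i).
  by apply: eq_bigr => S; rewrite subsetD1 => /andP[_ iS]; rewrite chi_off.
have Exw k u : (forall E, u (i |: E) = u (E :\ i)) ->
    Ex (fun E => x E ^+ k * u E) = (p * al ^+ k + (1 - p) * be ^+ k) * Ex u.
  by move=> ui; rewrite -(Ex_indep _ (fun b => (if b then al else be) ^+ k) ui).
set G := Ex (fun E => g E ^+ 4) in IHg; set H := Ex (fun E => h E ^+ 4) in IHh.
pose X := Ex (fun E => g E ^+ 2 * h E ^+ 2).
pose Y := Ex (fun E => g E * h E ^+ 3).
have -> : Ex (fun E => (\sum_(S : {set T} | S \subset A) c S * chi S E) ^+ 4) =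
    G + 6 * X + 4 * M3 * Y + M4 * H.
  transitivity (Ex (fun E => g E ^+ 4) + 4 * Ex (fun E => x E ^+ 1 * (g E ^+ 3 * h E))
    + 6 * Ex (fun E => x E ^+ 2 * (g E ^+ 2 * h E ^+ 2))
    + 4 * Ex (fun E => x E ^+ 3 * (g E * h E ^+ 3)) + Ex (fun E => x E ^+ 4 * h E ^+ 4)).
    rewrite -!ExZ -!ExD; apply: eq_Ex => E; rewrite fE; ring.
  rewrite !Exw ?expr1 ?chi_mean ?chi_var; try by move=> E; rewrite !(gi, hi).
  by rewrite /M3 /M4 /G /H /X /Y; ring.
have G0 : 0 <= G by apply: Ex_ge0 => // E; rewrite (_ : 4 = 2 * 2)%N // exprM sqr_ge0.
have H0 : 0 <= H by apply: Ex_ge0 => // E; rewrite (_ : 4 = 2 * 2)%N // exprM sqr_ge0.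
have X0 : 0 <= X by apply: Ex_ge0 => // E; rewrite mulr_ge0 ?sqr_ge0.
have XGH : X ^+ 2 <= G * H.
  have := Ex_CS (fun E => g E ^+ 2) (fun E => h E ^+ 2) p01.
  by rewrite -/X; under eq_Ex do rewrite -exprM;
     under [X in _ <= _ * X]eq_Ex do rewrite -exprM.
have Xab : X <= a * b.
  rewrite -(@ler_pXn2r _ 2) ?nnegrE ?mulr_ge0 // exprMn (le_trans XGH) //.
  by rewrite ler_pM.
have Yle : `|Y| * 2 <= X + H.
  have Y1 : 2 * Y <= X + H.
    rewrite -ExZ -ExD; apply: Ex_le => // E.
    have := sqr_ge0 (g E * h E - h E ^+ 2); lra.
  have Y2 : - (2 * Y) <= X + H.
    rewrite -mulNr -ExZ -ExD; apply: Ex_le => // E.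
    have := sqr_ge0 (g E * h E + h E ^+ 2); lra.
  by have [] := lerP 0 Y => hY; [rewrite ger0_norm | rewrite ltr0_norm]; lra.
have MY : 4 * M3 * Y <= 2 * `|M3| * (X + H).
  have : 4 * (M3 * Y) <= 4 * (`|M3| * `|Y|) by rewrite -normrM ler_pM2l ?ler_norm.
  have := ler_wpM2l (normr_ge0 M3) Yle; lra.
have M30 := normr_ge0 M3.
have K0 : 0 <= K by apply: le_trans K1.
have e1 : (6 + 2 * `|M3|) * X <= 2 * K * (a * b).
  by apply: ler_pM => //; move: KM3 M30; move: (`|M3|) => m; lra.
have e2 : (M4 + 2 * `|M3|) * H <= K ^+ 2 * b ^+ 2.
  apply: (@le_trans _ _ (K ^+ 2 * H)); first exact: ler_wpM2r.
  by apply: ler_wpM2l => //; exact: sqr_ge0.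
have -> : (a + K * b) ^+ 2 = a ^+ 2 + 2 * K * (a * b) + K ^+ 2 * b ^+ 2 by ring.
lra.
Qed.

Definition lowweight f (k : nat) : R := \sum_(S : {set T} | (#|S| <= k)%N) fhat f S ^+ 2.

(** Let [g] be the low-degree part of [F], so that [W = E[F g]]. Cauchy-Schwarz twice, with
    [F^2 = F], reaches [E[g^4]], which hypercontractivity bounds by [(K^k W)^2]. Hence
    [W^4 <= e^3 K^(2k) W^2], and cancelling [W^2] leaves [W] of order [e^(3/2)], the power larger
    than one that drives the boosting. *)
Lemma level_inequality (f : {set T} -> bool) k :
  lowweight (fun E => (f E)%:R) k ^+ 2 <=
  Ex (fun E => (f E)%:R) ^+ 3 * K ^+ (2 * k).
Proof.
set F : {set T} -> R := fun E => (f E)%:R; set W := lowweight F k; set e := Ex F.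
pose c (S : {set T}) := if (#|S| <= k)%N then fhat F S else 0.
pose g E := \sum_(S : {set T} | S \subset [set: T]) c S * chi S E.
have W0 : 0 <= W by apply: sumr_ge0 => S _; exact: sqr_ge0.
have K0 : 0 <= K by apply: le_trans K1.
have e0 : 0 <= e by apply: Ex_ge0 => // E; exact: ler0n.
have WE : W = Ex (fun E => F E * g E).
  transitivity (Ex (fun E => \sum_(S : {set T}) c S * (F E * chi S E))).
    rewrite Ex_sum /W /lowweight big_mkcond; apply: eq_bigr => S _.
    by rewrite ExZ -/(fhat _ _) /c; case: ifP; rewrite ?mul0r // expr2.
  apply: eq_Ex => E; rewrite /g mulr_sumr.
  under [RHS]eq_bigl => S do rewrite subsetT.
  by apply: eq_bigr => S _; ring.
have FF E : F E ^+ 2 = F E by rewrite /F; case: (f E); rewrite ?expr1n ?expr0n.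
set g2 := Ex (fun E => F E * g E ^+ 2); set g4 := Ex (fun E => g E ^+ 4).
have g20 : 0 <= g2 by apply: Ex_ge0 => // E; rewrite mulr_ge0 ?sqr_ge0 ?ler0n.
have eF : Ex (fun E => F E ^+ 2) = e by apply: eq_Ex.
have h1 : W ^+ 2 <= e * g2.
  have eW : Ex (fun E => F E * (F E * g E)) = W.
    by rewrite WE; apply: eq_Ex => E; rewrite mulrA -expr2 FF.
  have eg : Ex (fun E => (F E * g E) ^+ 2) = g2.
    by apply: eq_Ex => E; rewrite exprMn FF.
  by rewrite -eg -eF -{1}eW; exact: Ex_CS.
have h2 : g2 ^+ 2 <= e * g4.
  have eg : Ex (fun E => (g E ^+ 2) ^+ 2) = g4 by apply: eq_Ex => E; rewrite -exprM.
  by rewrite -eg -eF; exact: Ex_CS.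
have h3 : g4 <= (K ^+ k * W) ^+ 2.
  apply: (le_trans (hypercontractive_set c [set: T])).
  rewrite ler_pXn2r ?nnegrE ?mulr_ge0 ?exprn_ge0 //; last first.
    by apply: sumr_ge0 => S _; rewrite mulr_ge0 ?sqr_ge0 ?exprn_ge0.
  rewrite /W /lowweight mulr_sumr [leRHS]big_mkcond [leLHS]big_mkcond /=.
  apply: ler_sum => S _; rewrite subsetT /c.
  case: ifP => Sk; last by rewrite expr0n mulr0.
  by rewrite ler_wpM2r ?sqr_ge0 // ler_weXn2l.
have [-> |Wn0] := eqVneq W 0; first by rewrite expr0n mulr_ge0 ?exprn_ge0.
have Wpos : 0 < W by rewrite lt_def Wn0.
rewrite -(ler_pM2r (exprn_gt0 2 Wpos)) -exprD.
have -> : e ^+ 3 * K ^+ (2 * k) * W ^+ 2 = e ^+ 2 * (e * (K ^+ k * W) ^+ 2).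
  by rewrite exprMn -exprM [(k * 2)%N]mulnC; ring.
apply: (@le_trans _ _ ((e * g2) ^+ 2)).
  by rewrite (_ : (2 + 2 = 2 * 2)%N) // exprM ler_pXn2r ?nnegrE ?mulr_ge0 ?sqr_ge0.
rewrite exprMn ler_wpM2l ?sqr_ge0 // (le_trans h2) // ler_wpM2l //.
Qed.

End Fourier.

(** * Degree and the two-look inequality *)

Section Degree.
Implicit Types V W : finZmodType.

Definition der V (h : V) (f : V -> bool) (x : V) : bool := f (x + h) (+) f x.

(* Degree less than [k], expressed by the vanishing of all [k]-fold derivatives: this form
   is stable under composition with affine maps. *)
Fixpoint dle V (k : nat) (f : V -> bool) : bool :=
  if k is k'.+1 then [forall h, dle k' (der h f)] else [forall x, ~~ f x].

Lemma eq_dle V k (f g : V -> bool) : f =1 g -> dle k f = dle k g.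
Proof.
elim: k f g => [|k IH] f g fg /=; first by apply: eq_forallb => x; rewrite fg.
by apply: eq_forallb => h; apply: IH => x; rewrite /der !fg.
Qed.

Lemma dle_add V k (f g : V -> bool) :
  dle k f -> dle k g -> dle k (fun x => f x (+) g x).
Proof.
elim: k f g => [|k IH] f g /=.
  move=> /forallP hf /forallP hg; apply/forallP => x.
  by rewrite (negPf (hf x)) (negPf (hg x)).
move=> /forallP hf /forallP hg; apply/forallP => h.
rewrite -(eq_dle _ (f := fun x => der h f x (+) der h g x)); first exact: IH.
by move=> x; rewrite /der addbACA.
Qed.

Lemma dle_false V k : dle k (fun _ : V => false).
Proof.
elim: k => [|k IH] /=; apply/forallP => // h.
Qed.

Lemma dle_comp V W k (phi : V -> W) (f : W -> bool) :
  {morph phi : x y / x + y} -> dle k f -> dle k (f \o phi).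
Proof.
move=> phiD; elim: k f => [|k IH] f /= /forallP hf; apply/forallP => h //=.
rewrite (eq_dle _ (g := der (phi h) f \o phi)); first exact: IH.
by move=> x; rewrite /der /= phiD.
Qed.

Lemma dle_shift V k (a : V) (f : V -> bool) :
  dle k f -> dle k (fun x => f (x + a)).
Proof.
elim: k f => [|k IH] f /= /forallP hf; apply/forallP => h //.
rewrite (eq_dle _ (g := fun x => der h f (x + a))); first exact: IH.
by move=> x; rewrite /der addrAC.
Qed.

Lemma dleS V k (f : V -> bool) : dle k f -> dle k.+1 f.
Proof.
elim: k f => [|k IH] f.
  by move=> /= /forallP hf; apply/forallP => h; apply/forallP => x; rewrite /der !(negPf (hf _)).
by move=> /forallP hf; apply/forallP => h; apply: IH.
Qed.

(* The loss event behind the EXIT function; whether [0] itself lies in [E] is irrelevant. *)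
Definition unrec V k (E : {set V}) : bool :=
  [exists c : {ffun V -> bool}, [&& dle k c, c 0 & [forall x, c x ==> (x \in 0 |: E)]]].

Lemma unrecP V k (E : {set V}) :
  reflect (exists c : V -> bool, [/\ dle k c, c 0 & forall x, c x -> x \in 0 |: E])
    (unrec k E).
Proof.
apply: (iffP existsP) => [[c /and3P[h1 h2 /forallP h3]]|[c [h1 h2 h3]]].
  by exists c; split => // x; apply/implyP.
exists [ffun x => c x]; apply/and3P; split.
- by rewrite (eq_dle _ (g := c)) // => x; rewrite ffunE.
- by rewrite ffunE.
- by apply/forallP => x; rewrite ffunE; apply/implyP/h3.
Qed.

Lemma unrec_sub V k (E E' : {set V}) : E \subset E' -> unrec k E -> unrec k E'.
Proof.
move=> sE /unrecP[c [h1 h2 h3]]; apply/unrecP; exists c; split => // x /h3.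
by apply/subsetP/setUS.
Qed.

Lemma unrec_off V k (E : {set V}) : unrec k (0 |: E) = unrec k (E :\ 0).
Proof.
by apply/unrecP/unrecP => -[c [h1 h2 h3]]; exists c; split => // x /h3; rewrite !inE;
  case: eqP.
Qed.

(** Composition with an additive injection does not raise the degree, so the codeword witnessing a
    loss in the large space restricts to a witness in the small one. *)
Lemma unrec_restrict V W k (phi : V -> W) (E : {set W}) :
  {morph phi : x y / x + y} -> injective phi -> unrec k E -> unrec k (phi @^-1: E).
Proof.
move=> phiD phiI /unrecP[c [h1 h2 h3]].
have phi0 : phi 0 = 0 by apply: (@addrI _ (phi 0)); rewrite -phiD !addr0.
apply/unrecP; exists (c \o phi); split; first exact: dle_comp.
  by rewrite /= phi0.
by move=> x /= /h3; rewrite !inE -{1}phi0 (inj_eq phiI).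
Qed.

End Degree.

(** * Counting the matrices that annihilate a set of vectors *)

Section Annihilator.
Variables (n a : nat).

Let dot (x : 'rV[bool]_n) (c : 'cV[bool]_n) : bool := (x *m c) 0 0.

Let dotDl x y c : dot (x + y) c = dot x c (+) dot y c.
Proof. by rewrite /dot mulmxDl mxE. Qed.
Let dotDr x c d : dot x (c + d) = dot x c (+) dot x d.
Proof. by rewrite /dot mulmxDr mxE. Qed.

Let sgn (b : bool) : int := if b then -1 else 1.
Let sgnD b b' : sgn (b (+) b') = sgn b * sgn b'.
Proof. by case: b; case: b'. Qed.

(** Count the character sum [w] over all [x] and all [c] in [Z] in two ways. Summing over [x] first,
    only [c = 0] survives and gives [2^n]; summing over [c] first, each [x] in [S] gives [|Z|] and
    no [x] gives a negative amount. The bound uses [|S|] rather than a rank because the index sets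
    of Fourier coefficients have no linear structure. *)
Lemma annihilator_card (S : {set 'rV[bool]_n}) :
  (#|[set c : 'cV[bool]_n | [forall x in S, x *m c == 0%R]]| * #|S| <= 2 ^ n)%N.
Proof.
set Z := [set c | _].
have ZP c : reflect (forall x, x \in S -> dot x c = false) (c \in Z).
  rewrite inE; apply: (iffP forall_inP) => h x xS.
    by rewrite /dot (eqP (h x xS)) mxE.
  apply/eqP/matrixP => i j; rewrite !ord1 [RHS]mxE; exact: (h x xS).
have ZD c d : c \in Z -> d \in Z -> c + d \in Z.
  by move=> /ZP hc /ZP hd; apply/ZP => x xS; rewrite dotDr hc ?hd.
have Z0 : 0 \in Z by apply/ZP => x _; rewrite /dot mulmx0 mxE.
have dd m k (x d : 'M[bool]_(m, k)) : x + d + d = x.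
  by apply/matrixP => i j; rewrite !mxE; case: (x i j); case: (d i j).
pose w := \sum_(x : 'rV[bool]_n) \sum_(c in Z) sgn (dot x c).
have w1 : w = (2 ^ n)%:R.
  rewrite /w exchange_big (bigD1 0) //= [X in _ + X]big1 ?addr0.
    under eq_bigr do rewrite /dot mulmx0 mxE /=.
    by rewrite sumr_const card_mx card_bool mul1n.
  move=> c /andP[_ c0].
  have [i ci] : exists i, c i 0.
    have /matrix0Pn[i [j]] := c0; rewrite ord1 => cij; exists i.
    by move: cij; case: (c i 0).
  have xc : dot (delta_mx 0 i) c by rewrite /dot -rowE mxE.
  set s := \sum_x _; suff : s = - s by lia.
  rewrite {1}/s (reindex_inj (addIr (delta_mx 0 i))) /= -sumrN.
  apply: eq_bigr => x _; rewrite dotDl xc sgnD /=; lia.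
have w2 : w = \sum_(x | [forall c in Z, ~~ dot x c]) (#|Z|)%:R.
  rewrite /w [RHS]big_mkcond; apply: eq_bigr => x _; case: ifP.
    move=> /forall_inP h; rewrite -sumr_const; apply: eq_bigr => c cZ.
    by rewrite (negPf (h c cZ)).
  move=> /negbT; rewrite negb_forall => /existsP[d].
  rewrite negb_imply negbK => /andP[dZ xd].
  set s := \sum_(c in Z) _; suff : s = - s by lia.
  rewrite {1}/s (reindex_inj (addIr d)) /= -sumrN; apply: eq_big => [c|c _].
    apply/idP/idP => [cd|cZ]; last exact: ZD.
    by rewrite -(dd _ _ c d); exact: ZD.
  rewrite dotDr xd sgnD /=; lia.
have : (\sum_(x in S) (#|Z|)%:R <= w :> int).
  rewrite w2 [leLHS]big_mkcond [leRHS]big_mkcond; apply: ler_sum => x _.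
  case: ifP => xS; last by case: ifP; rewrite ?ler0n.
  case: ifP => // /forall_inP[] c /ZP h; by rewrite h.
by rewrite sumr_const w1 -mulrnA ler_nat.
Qed.

Lemma annihilator_card_mx (S : {set 'rV[bool]_n}) :
  (#|[set M : 'M[bool]_(n, a) | [forall x in S, x *m M == 0%R]]| * #|S| ^ a
   <= #|{: 'M[bool]_(n, a)}|)%N.
Proof.
set Z := [set c : 'cV[bool]_n | [forall x in S, x *m c == 0%R]].
have Zn : (#|Z| * #|S| <= 2 ^ n)%N := annihilator_card S.
pose g (M : 'M[bool]_(n, a)) := [ffun j => col j M].
have gI : injective g.
  move=> M N /ffunP MN; apply/matrixP => i j.
  by have := MN j; rewrite !ffunE => /colP/(_ i); rewrite !mxE.
rewrite card_mx card_bool.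
have : (#|[set M : 'M[bool]_(n, a) | [forall x in S, x *m M == 0%R]]| <= #|Z| ^ a)%N.
  rewrite -[a in leqRHS]card_ord -card_ffun_on -(card_imset _ gI).
  apply/subset_leq_card/subsetP => _ /imsetP[M /[!inE] /forall_inP hM ->].
  apply/ffun_onP => j; rewrite ffunE inE; apply/forall_inP => x /hM /eqP xM.
  by rewrite colE mulmxA xM mul0mx.
move=> h; apply: (leq_trans (leq_mul h (leqnn _))).
rewrite -expnMn expnM; case: (a) => [|a']; first by rewrite !expn0.
by rewrite leq_exp2r.
Qed.
End Annihilator.

Section TwoLook.
Variables (R : realFieldType) (p al be : R).
Hypothesis p01 : 0 <= p <= 1.
Hypothesis chi_mean : p * al + (1 - p) * be = 0.
Hypothesis chi_var : p * al ^+ 2 + (1 - p) * be ^+ 2 = 1.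

Definition exitR (n k : nat) : R := Ex p (fun E : {set 'rV[bool]_n} => (unrec k E)%:R).

Lemma chi_preimset (T U : finType) (phi : T -> U) (S : {set T}) (E : {set U}) :
  injective phi -> chi al be S (phi @^-1: E) = chi al be (phi @: S) E.
Proof.
move=> phiI; rewrite /chi big_imset /=; last by move=> x y _ _; exact: phiI.
by apply: eq_bigr => i _; rewrite inE.
Qed.

Variables (n a k : nat).
Let f (E : {set 'rV[bool]_n}) : R := (unrec k E)%:R.
Let fh := fhat p al be f.

(** [unrec] ignores whether 0 is erased, so the factor of coordinate 0 integrates to its mean 0.
    Thus only sets of nonzero points occur; 0 itself lies in every kernel and could not be excluded
    by a random [M]. *)
Lemma fhat_unrec0 (S : {set 'rV[bool]_n}) : 0 \in S -> fh S = 0.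
Proof.
move=> S0; rewrite /fh /fhat -(setD1K S0).
have S0' : 0 \notin S :\ 0 by rewrite !inE eqxx.
transitivity (Ex p (fun E => (if 0 \in E then al else be) * (f E * chi al be (S :\ 0) E))).
  by apply: eq_Ex => E; rewrite chiU1 // mulrCA.
rewrite (Ex_indep _ (fun b => if b then al else be)) ?chi_mean ?mul0r // => E.
by rewrite /f unrec_off chi_off.
Qed.

(* Two n-dimensional subspaces of an (n+a)-dimensional one, the graphs of [0] and of
   [M], meet exactly in the kernel of [M]; the bit at the origin is lost in the large
   code only if it is lost in both restrictions. *)
Lemma exit_two_looks (M : 'M[bool]_(n, a)) :
  exitR (n + a) k <= \sum_(S : {set 'rV[bool]_n} | [forall x in S, x *m M == 0]) fh S ^+ 2.
Proof.
pose iA (x : 'rV[bool]_n) := row_mx x (0 : 'rV[bool]_a).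
pose iB (x : 'rV[bool]_n) := row_mx x (x *m M).
have iAD : {morph iA : x y / x + y} by move=> x y; rewrite /iA add_row_mx addr0.
have iBD : {morph iB : x y / x + y} by move=> x y; rewrite /iB add_row_mx mulmxDl.
have iAI : injective iA by move=> x y /eq_row_mx[].
have iBI : injective iB by move=> x y /eq_row_mx[].
apply: (@le_trans _ _ (Ex p (fun E => f (iA @^-1: E) * f (iB @^-1: E)))).
  apply: Ex_le => // E; rewrite /f -natrM ler_nat.
  have [u|//] := boolP (unrec k E).
  by rewrite !(unrec_restrict _ _ u).
have -> : Ex p (fun E => f (iA @^-1: E) * f (iB @^-1: E)) =
  \sum_S \sum_S' fh S * fh S' * (iA @: S == iB @: S')%:R.
  transitivity (Ex p (fun E => \sum_S \sum_S' fh S * fh S' *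
    (chi al be (iA @: S) E * chi al be (iB @: S') E))).
    apply: eq_Ex => E; rewrite (fhat_inv chi_mean chi_var f (iA @^-1: E)).
    rewrite (fhat_inv chi_mean chi_var f (iB @^-1: E)) mulr_suml.
    apply: eq_bigr => S _; rewrite mulr_sumr; apply: eq_bigr => S' _.
    by rewrite !chi_preimset // mulrACA.
  rewrite Ex_sum; apply: eq_bigr => S _; rewrite Ex_sum; apply: eq_bigr => S' _.
  by rewrite ExZ Ex_chi2.
rewrite [leRHS]big_mkcond; apply: ler_sum => S _.
(* [row_mx x 0 = row_mx y (y *m M)] forces [y = x] and [x *m M = 0], so only modes supported in the
   kernel of [M] are common to the two looks, and each meets only itself. *)
have key (S' : {set 'rV[bool]_n}) : iA @: S = iB @: S' -> S' = S /\ [forall x in S, x *m M == 0].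
  move=> SS'; have kS x : x \in S -> x \in S' /\ x *m M = 0.
    move=> xS; have : iA x \in iB @: S' by rewrite -SS' imset_f.
    by case/imsetP => y yS' /eq_row_mx[-> <-].
  split; last by apply/forall_inP => x /kS[_ ->].
  apply/setP => x; apply/idP/idP => [xS'|/kS[]//].
  have : iB x \in iA @: S by rewrite SS' imset_f.
  by case/imsetP => y yS /eq_row_mx[->].
case: ifP => hS; last first.
  rewrite big1 // => S' _; case: eqP => [/key[_]|]; first by rewrite hS.
  by rewrite mulr0.
rewrite (bigD1 S) //= [X in _ + X]big1 ?addr0 => [|S' SS'].
  by rewrite -expr2 ler_piMr ?sqr_ge0 // lern1 leq_b1.
by case: eqP => [/key[e _]|]; [rewrite e eqxx in SS' | rewrite mulr0].
Qed.

(** Average of [exit_two_looks] over all matrices [M]. Adjoining 0 to [S] before counting gives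
    [|S| + 1], so that even a singleton gains a factor [2^(-a)]. *)
Lemma exit_average :
  exitR (n + a) k <=
  \sum_(S : {set 'rV[bool]_n} | 0 \notin S) fh S ^+ 2 / ((#|S|.+1)%:R ^+ a).
Proof.
set N := #|{: 'M[bool]_(n, a)}|.
have N0 : 0 < N%:R :> R by rewrite ltr0n; apply/card_gt0P; exists 0.
rewrite -(ler_pM2l N0).
apply: (@le_trans _ _ (\sum_(M : 'M[bool]_(n, a))
   \sum_(S : {set 'rV[bool]_n} | [forall x in S, x *m M == 0]) fh S ^+ 2)).
  rewrite mulr_natl -sumr_const; apply: ler_sum => M _; exact: exit_two_looks.
rewrite (exchange_big_dep predT) //= mulr_sumr [leRHS]big_mkcond.
apply: ler_sum => S _; rewrite sumr_const; case: ifPn => S0; last first.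
  by rewrite negbK in S0; rewrite fhat_unrec0 // expr0n mul0rn.
rewrite -[leLHS]mulr_natr mulrCA; apply: ler_wpM2l; first exact: sqr_ge0.
rewrite ler_pdivlMr ?exprn_gt0 ?ltr0n // -natrX -natrM ler_nat.
have := annihilator_card_mx a (0 |: S); rewrite cardsU1 S0 add1n; apply: leq_trans.
rewrite leq_mul2r; apply/orP; right; apply/subset_leq_card/subsetP => M.
rewrite !inE => /forall_inP h; apply/forall_inP => x.
by rewrite in_setU1 => /orP[/eqP->|/h//]; rewrite mul0mx.
Qed.

Lemma exit_fhat_set0 : fh set0 = exitR n k.
Proof. by apply: eq_Ex => E; rewrite /chi big_set0 mulr1. Qed.

Lemma exit_sum_fhat2 : \sum_S fh S ^+ 2 = exitR n k.
Proof.
under eq_bigr do rewrite expr2.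
rewrite -(parseval chi_mean chi_var); apply: eq_Ex => E.
by rewrite /f; case: (unrec _ _); rewrite ?mulr1 ?mulr0.
Qed.

Lemma exitR_ge0 m : 0 <= exitR m k.
Proof. by apply: Ex_ge0 => // E; rewrite ler0n. Qed.

(** The empty set contributes the square of the mean; every other set has at least one point, and by
    Parseval the total weight is [exitR n k], since the loss event is an indicator. *)
Lemma exit_square : exitR (n + a) k <= exitR n k ^+ 2 + exitR n k / 2 ^+ a.
Proof.
apply: (le_trans exit_average); rewrite (bigD1 set0) ?inE //=.
rewrite cards0 expr1n divr1 exit_fhat_set0 lerD2l -exit_sum_fhat2 mulr_suml.
rewrite [leLHS]big_mkcond; apply: ler_sum => S _; case: ifP => [/andP[S0 Sn]|_].
  apply: ler_wpM2l; first exact: sqr_ge0.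
  rewrite lef_pV2 ?posrE ?exprn_gt0 ?ltr0n // -natrX -natrX ler_nat.
  by case: (a) => // a'; rewrite leq_exp2r // ltnS card_gt0.
by rewrite divr_ge0 ?sqr_ge0 // exprn_ge0 // ler0n.
Qed.

Lemma exit_antitone : exitR (n + a) k <= exitR n k.
Proof.
apply: (le_trans exit_average); rewrite -exit_sum_fhat2 [leLHS]big_mkcond.
apply: ler_sum => S _; case: ifP => _; last exact: sqr_ge0.
rewrite ler_piMr ?sqr_ge0 // invf_le1 ?exprn_gt0 ?ltr0n //.
by rewrite -natrX ler1n expn_gt0.
Qed.

Variable K : R.
Let M3 := p * al ^+ 3 + (1 - p) * be ^+ 3.
Let M4 := p * al ^+ 4 + (1 - p) * be ^+ 4.
Hypothesis K1 : 1 <= K.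
Hypothesis KM3 : 3 + `|M3| <= K.
Hypothesis KM4 : M4 + 2 * `|M3| <= K ^+ 2.

(** Cut at size [l]: sets of at most [l] points fall under [level_inequality], larger ones gain
    [(l + 2)^(-a)]. The bound on [W] stays squared because it is a power 3/2. *)
Lemma exit_boost l : exists2 W : R,
  0 <= W /\ W ^+ 2 <= exitR n k ^+ 3 * K ^+ (2 * l) &
  exitR (n + a) k <= W + exitR n k / (l.+2)%:R ^+ a.
Proof.
exists (lowweight p al be f l).
  split; last exact: (level_inequality p01 chi_mean chi_var K1 KM3 KM4 (unrec k) l).
  by apply: sumr_ge0 => S _; exact: sqr_ge0.
apply: (le_trans exit_average); rewrite -exit_sum_fhat2 mulr_suml /lowweight.
rewrite [X in X + _]big_mkcond -big_split [leLHS]big_mkcond; apply: ler_sum => S _ /=.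
have s0 : 0 <= fh S ^+ 2 / l.+2%:R ^+ a by rewrite divr_ge0 ?sqr_ge0 // exprn_ge0 // ler0n.
case: ifP => _; last by rewrite addr_ge0 //; case: ifP => _ //; exact: sqr_ge0.
case: leqP => Sl.
  rewrite -[leLHS]addr0 lerD // ler_piMr ?sqr_ge0 // invf_le1 ?exprn_gt0 ?ltr0n //.
  by rewrite -natrX ler1n expn_gt0.
rewrite add0r; apply: ler_wpM2l; first exact: sqr_ge0.
rewrite lef_pV2 ?posrE ?exprn_gt0 ?ltr0n // -!natrX ler_nat.
by case: (a) => // a'; rewrite leq_exp2r.
Qed.

End TwoLook.

(** * Algebraic normal form *)

HB.instance Definition _ (m : nat) := GRing.Zmodule.copy (point m) {ffun 'I_m -> bool}.
HB.instance Definition _ (m : nat) := Finite.copy (point m) {ffun 'I_m -> bool}.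

Section AlgebraicNormalForm.
Variable m : nat.
Implicit Types (A B X : {set 'I_m}) (x : point m).

Definition ind A : point m := [ffun i => i \in A].

Lemma xor_subset_split i A (F : {set 'I_m} -> bool) : i \in A ->
  \big[addb/false]_(B : {set 'I_m} | B \subset A) F B =
  \big[addb/false]_(B : {set 'I_m} | B \subset A :\ i) (F B (+) F (i |: B)).
Proof.
move=> iA; rewrite big_split /= [LHS](bigID (fun B : {set 'I_m} => i \notin B)) /=; congr (_ (+) _).
  by apply: eq_bigl => B; rewrite subsetD1.
rewrite (reindex_onto (fun B => i |: B) (fun B => B :\ i)) /=; last first.
  by move=> B /andP[_]; rewrite negbK => iB; rewrite setD1K.
apply: eq_bigl => B; rewrite setU11 /= andbT subUset sub1set iA /= subsetD1.
congr (_ && _); apply/eqP/idP => [<-|]; first by rewrite !inE eqxx.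
by move=> iB; rewrite setU1K.
Qed.

Lemma moebius_xor (F : {set 'I_m} -> bool) X :
  \big[addb/false]_(A : {set 'I_m} | A \subset X) \big[addb/false]_(B : {set 'I_m} | B \subset A) F B = F X.
Proof.
elim: {X}_.+1 {-2}X (ltnSn #|X|) F => // n IH X; rewrite ltnS => cX F.
have [->|[i iX]] := set_0Vmem X.
  under eq_bigl do rewrite subset0; rewrite big_pred1_eq.
  by under eq_bigl do rewrite subset0; rewrite big_pred1_eq.
have cXi : (#|X :\ i| < n)%N by move: cX; rewrite (cardsD1 i) iX.
rewrite (xor_subset_split _ iX).
rewrite (eq_bigr (fun A => \big[addb/false]_(B : {set 'I_m} | B \subset A) F (i |: B))).
  by rewrite IH // setD1K.
move=> A; rewrite subsetD1 => /andP[_ iA].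
rewrite (@xor_subset_split i (i |: A)) ?setU11 // setU1K // big_split /=.
by rewrite addbA addbb.
Qed.

Definition anf (S : {set {set 'I_m}}) : word m :=
  [ffun x => \big[addb/false]_(A in S) monomial_eval A x].

Lemma monomial_ind A B : monomial_eval A (ind B) = (A \subset B).
Proof.
apply/forall_inP/subsetP => h i /h; by rewrite ffunE.
Qed.

Lemma anf_ind S X : anf S (ind X) = \big[addb/false]_(A : {set 'I_m} | A \subset X) (A \in S).
Proof.
rewrite ffunE [LHS]big_mkcond [RHS]big_mkcond; apply: eq_bigr => A _.
by rewrite monomial_ind; case: ifP; case: ifP.
Qed.

Lemma indK x : ind [set i | x i] = x.
Proof. by apply/ffunP => i; rewrite ffunE inE. Qed.

Lemma anf_inj : injective anf.
Proof.
move=> S S' SS'; apply/setP => X.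
rewrite -(moebius_xor (fun A => A \in S)) -(moebius_xor (fun A => A \in S')).
by apply: eq_bigr => A _; rewrite -!anf_ind SS'.
Qed.

Definition anf_coef (w : word m) : {set {set 'I_m}} :=
  [set A : {set 'I_m} | \big[addb/false]_(B : {set 'I_m} | B \subset A) w (ind B)].

Lemma anf_coefK w : anf (anf_coef w) = w.
Proof.
apply/ffunP => x; rewrite -(indK x) anf_ind -(moebius_xor (fun B => w (ind B))).
by apply: eq_bigr => A _; rewrite inE.
Qed.

Lemma RM_imset v : RM v m = anf @: powerset [set A : {set 'I_m} | (#|A| <= v)%N].
Proof.
apply/setP => w; apply/idP/imsetP.
  rewrite inE => /existsP[S /andP[hS /forallP hw]]; exists S; first by rewrite inE.
  by apply/ffunP => x; rewrite ffunE; apply/eqP.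
case=> S; rewrite !inE => hS ->; apply/existsP; exists S; rewrite hS /=.
by apply/forallP => x; rewrite ffunE.
Qed.

Lemma card_RM v : #|RM v m| = (2 ^ \sum_(0 <= k < v.+1) 'C(m, k))%N.
Proof.
rewrite RM_imset card_imset; last exact: anf_inj.
rewrite card_powerset; congr (_ ^ _)%N.
rewrite -sum1_card (partition_big (fun A : {set 'I_m} => inord #|A| : 'I_v.+1) xpredT) //=.
rewrite big_mkord; apply: eq_bigr => k _; rewrite sum1_card.
have := card_draws 'I_m k; rewrite card_ord => <-; apply: eq_card => A.
rewrite !inE unfold_in /= inE; apply/andP/eqP => [[hA /eqP <-]|hA].
  by rewrite inordK.
by rewrite hA -ltnS ltn_ord; split => //; apply/eqP/val_inj; rewrite /= inordK.
Qed.

(** Discrete Leibniz rule: the derivative of [x_i g] along [h] is [x_i] times the derivative of [g]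
    plus [h_i] times a translate of [g]. *)
Lemma dle_coord k i (g : point m -> bool) :
  dle k g -> dle k.+1 (fun x => x i && g x).
Proof.
elim: k g => [|k IH] g.
  move=> /forallP hg; rewrite (eq_dle _ (g := fun=> false)) ?dle_false // => x.
  by rewrite (negPf (hg x)) andbF.
move=> hg; apply/forallP => h.
have hd : dle k.+1 (fun x => x i && der h g x) by apply: IH; exact: (forallP hg).
have hs : dle k.+1 (fun x => h i && g (x + h)).
  by case: (h i); [exact: (dle_shift h hg) | exact: dle_false].
change (dle k.+1 (der h (fun x => x i && g x))).
rewrite (eq_dle _ (g := fun x => (x i && der h g x) (+) (h i && g (x + h)))).
  exact: dle_add.
move=> x; rewrite /der ffunE.
by case: (x i); case: (h i); case: (g _); case: (g _).
Qed.

Lemma dle_leq k l (g : point m -> bool) : (k <= l)%N -> dle k g -> dle l g.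
Proof. by move=> /subnK <-; elim: (_ - _)%N => // d IH /IH; exact: dleS. Qed.

Lemma dle_xor k (I : Type) (r : seq I) (P : pred I) (F : I -> point m -> bool) :
  (forall i, P i -> dle k (F i)) ->
  dle k (fun x => \big[addb/false]_(i <- r | P i) F i x).
Proof.
move=> hF; elim: r => [|i r IH].
  by rewrite (eq_dle _ (g := fun=> false)) ?dle_false // => x; rewrite big_nil.
case: (boolP (P i)) => Pi.
  rewrite (eq_dle _ (g := fun x => F i x (+) \big[addb/false]_(j <- r | P j) F j x)).
    by apply: dle_add => //; exact: hF.
  by move=> x; rewrite big_cons Pi.
rewrite (eq_dle _ (g := fun x => \big[addb/false]_(j <- r | P j) F j x)) // => x.
by rewrite big_cons (negPf Pi).
Qed.

Lemma dle_monomial A : dle #|A|.+1 (monomial_eval A).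
Proof.
elim: {A}_.+1 {-2}A (ltnSn #|A|) => // n IH A; rewrite ltnS => cA.
have [->|[i iA]] := set_0Vmem A.
  rewrite cards0 (eq_dle _ (g := fun=> true)); first by apply/forallP => h; apply/forallP.
  by move=> x; apply/forall_inP => i; rewrite inE.
have cAi : (#|A :\ i| < n)%N by move: cA; rewrite (cardsD1 i) iA.
rewrite (cardsD1 i) iA add1n.
rewrite (eq_dle _ (g := fun x => x i && monomial_eval (A :\ i) x)).
  by apply: dle_coord; exact: IH.
move=> x; apply/forall_inP/andP => [h|[xi /forall_inP h] j jA].
  by split; [exact: h | apply/forall_inP => j; rewrite inE => /andP[_ /h]].
have [->//|ji] := eqVneq j i; by apply: h; rewrite !inE ji.
Qed.

(** A sum over a cube is an iterated derivative along the directions of [A]. At the origin it is the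
    coefficient of the monomial [A], which is how vanishing derivatives bound the degree in
    [RM_dle]. *)
Lemma dle_xor_cube k A (f : point m -> bool) x : (k <= #|A|)%N -> dle k f ->
  \big[addb/false]_(B : {set 'I_m} | B \subset A) f (x + ind B) = false.
Proof.
elim: k A f x => [|k IH] A f x kA; first by move=> /forallP h; rewrite big1 // => B _; exact/negbTE.
have [i iA] : exists i, i \in A by apply/card_gt0P; exact: leq_trans kA.
move=> /forallP /(_ (ind [set i])) hf; rewrite (xor_subset_split _ iA).
rewrite -[RHS](IH (A :\ i) _ x _ hf); last by move: kA; rewrite (cardsD1 i) iA.
apply: eq_bigr => B; rewrite subsetD1 => /andP[_ iB]; rewrite /der addbC -addrA.
congr (f (x + _) (+) _); apply/ffunP => j; rewrite !ffunE !inE.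
by case: eqP => [->|]; [rewrite (negPf iB) | case: (j \in B)].
Qed.

Lemma RM_dle v (w : word m) : (w \in RM v m) = dle v.+1 (fun x : point m => w x).
Proof.
apply/idP/idP.
  rewrite RM_imset => /imsetP[S]; rewrite inE => /subsetP hS ->.
  rewrite (eq_dle _ (g := fun x => \big[addb/false]_(A in S) monomial_eval A x)); last first.
    by move=> x; rewrite ffunE.
  apply: dle_xor => A /hS; rewrite inE => Av; apply: dle_leq (dle_monomial A).
  by rewrite ltnS.
move=> hw; rewrite RM_imset; apply/imsetP; exists (anf_coef w); last by rewrite anf_coefK.
rewrite inE; apply/subsetP => A; rewrite !inE; apply: contraTT.
rewrite -ltnNge => hA.
have := dle_xor_cube 0 hA hw; under eq_bigr do rewrite add0r.
by move=> ->.
Qed.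
End AlgebraicNormalForm.

(** * Supports of subcodes *)

Definition fword (m : nat) : predArgType := {ffun 'rV[bool]_m -> bool}.
HB.instance Definition _ (m : nat) :=
  GRing.Zmodule.copy (fword m) {ffun 'rV[bool]_m -> bool}.
HB.instance Definition _ (m : nat) := Finite.copy (fword m) {ffun 'rV[bool]_m -> bool}.

Lemma card_additive_image (G H : finZmodType) (g : G -> H) (S : {set G}) :
  {morph g : x y / x - y} -> {in S &, forall x y, x - y \in S} ->
  #|S| = (#|g @: S| * #|[set c in S | g c == 0%R]|)%N.
Proof.
move=> gB SB; rewrite -[LHS]sum1_card (partition_big_imset g) /=.
rewrite (eq_bigr (fun=> #|[set c in S | g c == 0%R]|)) ?sum_nat_const // => y.
move=> /imsetP[c0 c0S ->]; rewrite sum1_card.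
rewrite -(card_imset _ (addIr (- c0))); apply: eq_card => c; rewrite inE.
apply/imsetP/andP => [[d /andP[dS /eqP gd] ->]|[cS /eqP gc]].
  by rewrite SB // gB gd subrr.
exists (c + c0); last by rewrite addrK.
have g0 : g 0 = 0 by rewrite -(subrr 0) gB subrr.
have S0 : 0 \in S by rewrite -(subrr c0) SB.
have Sm : - c0 \in S by rewrite -sub0r SB.
have gN : g (- c0) = - g c0 by rewrite -sub0r gB g0 sub0r.
have e : c + c0 = c - (- c0) by rewrite opprK.
by rewrite unfold_in /= e SB //= gB gc gN sub0r opprK.
Qed.

Section SubcodeDimension.

Definition wsupp m (S : {set fword m}) : {set 'rV[bool]_m} :=
  [set x | [exists c in S, c x]].

Lemma wsuppP m (S : {set fword m}) x :
  reflect (exists2 c : fword m, c \in S & c x) (x \in wsupp S).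
Proof. by rewrite inE; apply: (iffP exists_inP) => -[c]; exists c. Qed.

Lemma fword_addE m (c d : fword m) x : (c + d) x = c x (+) d x.
Proof. by rewrite ffunE. Qed.

Lemma fword_oppE m (c : fword m) : - c = c.
Proof. by apply/ffunP => x; rewrite !ffunE. Qed.

Lemma fword0E m x : (0 : fword m) x = false.
Proof. by rewrite ffunE. Qed.

Definition rcons0 m (b : bool) (x : 'rV[bool]_m) : 'rV[bool]_(1 + m) :=
  row_mx (b%:M : 'rV[bool]_1) x.

Lemma rcons0_inj m b b' (x x' : 'rV[bool]_m) :
  rcons0 b x = rcons0 b' x' -> b = b' /\ x = x'.
Proof.
by move=> /eq_row_mx[/matrixP/(_ 0 0)]; rewrite !mxE eqxx !mulr1n.
Qed.

Definition wrestr m b (c : fword (1 + m)) : fword m := [ffun x => c (rcons0 b x)].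

Lemma rcons0D m b b' (x x' : 'rV[bool]_m) :
  rcons0 b x + rcons0 b' x' = rcons0 (b (+) b') (x + x').
Proof.
rewrite /rcons0 add_row_mx; congr row_mx.
by apply/matrixP => i j; rewrite !ord1 !mxE eqxx.
Qed.

Lemma dle_wrestr m b k (c : fword (1 + m)) : dle k c -> dle k (wrestr b c).
Proof.
move=> hc; pose f := (fun x => c (x + rcons0 b 0)) \o @rcons0 m false.
rewrite (eq_dle _ (g := f)); last first.
  by move=> x; rewrite ffunE /f /= rcons0D addr0.
apply: dle_comp; last exact: dle_shift.
by move=> x y; rewrite rcons0D.
Qed.

(** If [c] vanishes on the half [b], then on the other half it coincides with its own derivative
    along the first coordinate, which has one degree less. *)
Lemma dle_wrestr_neg m b k (c : fword (1 + m)) :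
  dle k.+1 c -> wrestr b c = 0 -> dle k (wrestr (~~ b) c).
Proof.
move=> /forallP /(_ (rcons0 true 0)) hc c0.
pose f := (fun x => der (rcons0 true 0) c (x + rcons0 b 0)) \o @rcons0 m false.
rewrite (eq_dle _ (g := f)); last first.
  move=> x; rewrite ffunE /f /= /der !rcons0D !addr0 addbT /=.
  have : wrestr b c x = (0 : fword m) x by rewrite c0.
  rewrite ffunE fword0E => ->.
  by rewrite addbF.
apply: dle_comp; last exact: dle_shift.
by move=> x y; rewrite rcons0D.
Qed.

Lemma wrestrB m b (c d : fword (1 + m)) : wrestr b (c - d) = wrestr b c - wrestr b d.
Proof.
by apply/ffunP => x; rewrite !fword_oppE !ffunE.
Qed.

Lemma wrestr_ext m b (c d : fword (1 + m)) :
  wrestr b c = wrestr b d -> wrestr (~~ b) c = wrestr (~~ b) d -> c = d.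
Proof.
move=> /ffunP h1 /ffunP h2; apply/ffunP => y.
have [b' [x ->]] : exists b' x, y = rcons0 b' x.
  exists (y 0 (lshift m 0)), (rsubmx (y : 'rV_(1 + m))).
  apply/matrixP => i j; rewrite !ord1 -(splitK j); case: split => l /=.
    by rewrite !ord1 row_mxEl mxE eqxx.
  by rewrite row_mxEr mxE.
have := h1 x; have := h2 x; rewrite !ffunE.
by case: b b' {h1 h2} => -[].
Qed.

Variables (R : realFieldType) (phi : nat -> R) (th : R).
Hypothesis th1 : 1 <= th.
Hypothesis phi_ge0 : forall u, 0 <= phi u.
Hypothesis phi_mono : forall u u', (u <= u')%N -> phi u <= phi u'.
Hypothesis phi1 : 1 <= phi 1.
Hypothesis phi_conv : forall u0 u1, (u0 <= u1)%N ->
  th * phi u0 + phi u1 <= phi (u0 + u1)%N.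

(** Split along the first coordinate. The restriction of [S] to one half keeps the degree bound; the
    codewords vanishing on that half, restricted to the other, have one degree less. By induction
    the two dimensions are charged to [th * phi u0 + phi u1], which [phi_conv] absorbs. Powers of
    [th] on both sides avoid negative exponents. *)
Lemma subcode_dim_bound m k (S : {set fword m}) :
  0 \in S -> {in S &, forall c d, c - d \in S} -> (forall c, c \in S -> dle k c) ->
  exists2 j, #|S| = (2 ^ j)%N & th ^+ m.+1 * j%:R <= th ^+ k * phi #|wsupp S|.
Proof.
have th0 : 0 <= th := le_trans ler01 th1.
have zero_case m' k' (S' : {set fword m'}) : S' = [set 0] ->
    exists2 j, #|S'| = (2 ^ j)%N & th ^+ m'.+1 * j%:R <= th ^+ k' * phi #|wsupp S'|.
  move=> ->; exists 0; first by rewrite cards1.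
  by rewrite mulr0 mulr_ge0 ?exprn_ge0.
elim: m k S => [|m IH] k S S0 SB Sk.
  have [/forall_inP SS|] := boolP [forall c in S, c == 0].
    apply: zero_case; apply/setP => c; rewrite inE.
    by apply/idP/eqP => [/SS/eqP//|->].
  rewrite negb_forall => /existsP[c]; rewrite negb_imply => /andP[cS cn0].
  have c0 : c 0.
    apply: contraR cn0 => c0; apply/eqP/ffunP => x; rewrite fword0E.
    by rewrite [x]thinmx0; exact/negbTE.
  have ST : S = [set: fword 0].
    apply/setP => d; rewrite inE; case: (boolP (d 0)) => d0.
      have -> : d = c by apply/ffunP => x; rewrite [x]thinmx0 d0 c0.
      exact: cS.
    have -> : d = 0 by apply/ffunP => x; rewrite [x]thinmx0 fword0E; exact/negbTE.
    exact: S0.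
  exists 1%N.
    by rewrite ST cardsT card_ffun card_bool card_mx mul1n expn0.
  have s1 : #|wsupp S| = 1%N.
    apply/eqP/cards1P; exists 0; apply/setP => x; rewrite in_set1 [x]thinmx0 eqxx.
    by apply/wsuppP; exists c.
  rewrite s1 expr1 mulr1; case: k Sk => [/(_ c cS)/forallP/(_ 0)|k _].
    by rewrite c0.
  rewrite exprS -mulrA ler_peMr // mulr_ege1 // exprn_ege1 //.
case: k Sk => [|k] Sk.
  apply: zero_case; apply/setP => c; rewrite inE.
  apply/idP/eqP => [/Sk/forallP hc|->//].
  by apply/ffunP => x; rewrite fword0E; exact/negbTE.
pose U b := wsupp (wrestr b @: S).
have Usum : (#|U false| + #|U true| <= #|wsupp S|)%N.
  have inj b : injective (@rcons0 m b) by move=> x y /rcons0_inj[].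
  rewrite -(card_imset (mem (U false)) (inj false)) -(card_imset (mem (U true)) (inj true)).
  rewrite -cardsUI [X in (_ + X <= _)%N](_ : _ = 0)%N ?addn0.
    apply: subset_leq_card; rewrite subUset; apply/andP.
    by split; apply/subsetP => y /imsetP[x /wsuppP[_ /imsetP[c cS ->]]]; rewrite ffunE => cx ->;
      apply/wsuppP; exists c.
  apply/eqP; rewrite cards_eq0 -subset0; apply/subsetP => y /setIP[/imsetP[x _ ->]].
  by case/imsetP => x' _ /rcons0_inj[].
(* The half on which the degree is kept carries the extra factor [th]; [phi_conv] allows it only on
   the smaller support. *)
have [b Ub] : exists b, (#|U b| <= #|U (~~ b)|)%N.
  by case: (leqP #|U false| #|U true|) => h; [exists false | exists true; exact: ltnW].
have Usum' : (#|U b| + #|U (~~ b)| <= #|wsupp S|)%N.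
  by move: Usum; case: (b) => //=; rewrite addnC.
pose S0' := wrestr b @: S.
pose Sk' := [set c in S | wrestr b c == 0].
pose S1 := wrestr (~~ b) @: Sk'.
have w0 b' : wrestr b' (0 : fword (1 + m)) = 0 by apply/ffunP => x; rewrite ffunE !fword0E.
have SkB : {in Sk' &, forall c d, c - d \in Sk'}.
  move=> c d; rewrite !inE => /andP[cS /eqP c0] /andP[dS /eqP d0].
  by rewrite SB // wrestrB c0 d0 subrr eqxx.
have [j0 cj0 bj0] : exists2 j, #|S0'| = (2 ^ j)%N &
    th ^+ m.+1 * j%:R <= th ^+ k.+1 * phi #|wsupp S0'|.
  apply: IH.
  - by apply/imsetP; exists 0; rewrite ?w0.
  - by move=> _ _ /imsetP[c cS ->] /imsetP[d dS ->]; rewrite -wrestrB imset_f // SB.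
  - by move=> _ /imsetP[c cS ->]; apply: dle_wrestr; exact: Sk.
have [j1 cj1 bj1] : exists2 j, #|S1| = (2 ^ j)%N &
    th ^+ m.+1 * j%:R <= th ^+ k * phi #|wsupp S1|.
  apply: IH.
  - by apply/imsetP; exists 0; rewrite ?w0 // inE S0 w0 eqxx.
  - by move=> _ _ /imsetP[c cS ->] /imsetP[d dS ->]; rewrite -wrestrB imset_f // SkB.
  - move=> _ /imsetP[c /[!inE] /andP[cS /eqP c0] ->].
    by apply: dle_wrestr_neg => //; exact: Sk.
exists (j0 + j1)%N.
  rewrite (card_additive_image (wrestrB b) SB) expnD -cj0 -cj1; congr (_ * _)%N.
  rewrite card_in_imset // => c d; rewrite !inE => /andP[_ /eqP c0] /andP[_ /eqP d0].
  by apply: wrestr_ext; rewrite c0 d0.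
have U1 : (#|wsupp S1| <= #|U (~~ b)|)%N.
  apply/subset_leq_card/subsetP => x /wsuppP[_ /imsetP[c /[!inE] /andP[cS _] ->] cx].
  have hx : exists2 d : fword m, d \in wrestr (~~ b) @: S & d x.
    by exists (wrestr (~~ b) c) => //; exact: imset_f.
  by apply/exists_inP; case: hx => d dS dx; exists d.
have e1 : th ^+ m.+1 * j1%:R <= th ^+ k * phi #|U (~~ b)|.
  by apply: (le_trans bj1); apply: ler_wpM2l; [exact: exprn_ge0 | exact: phi_mono].
have e2 := phi_conv Ub; have e3 := phi_mono Usum'.
have tk : 0 <= th ^+ k.+1 by exact: exprn_ge0.
apply: (@le_trans _ _ (th ^+ k.+1 * (th * phi #|U b| + phi #|U (~~ b)|))); last first.
  by apply: ler_wpM2l => //; exact: le_trans e3.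
have := lerD (ler_wpM2l th0 bj0) (ler_wpM2l th0 e1).
rewrite -/(U b) natrD !exprS; lra.
Qed.
End SubcodeDimension.

(** * The subcode supported on the erasures *)

Section ErasureDimension.
Variables (m k : nat).
Implicit Types (E : {set 'rV[bool]_m}) (c d : fword m).

Definition subc E : {set fword m} :=
  [set c : fword m | dle k c && [forall x, c x ==> (x \in E)]].
Definition dimc E : nat := trunc_log 2 #|subc E|.
Definition lost E : {set 'rV[bool]_m} := wsupp (subc E).

Lemma subcP E c : reflect (dle k c /\ forall x, c x -> x \in E) (c \in subc E).
Proof.
rewrite inE; apply: (iffP andP) => -[h1 h2]; split => //.
  by move=> x; apply/implyP/(forallP h2).
by apply/forallP => x; apply/implyP/h2.
Qed.

Lemma subc0 E : 0 \in subc E.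
Proof.
apply/subcP; split => [|x]; last by rewrite fword0E.
rewrite (eq_dle _ (g := fun=> false)) ?dle_false // => x; exact: fword0E.
Qed.

Lemma subcB E : {in subc E &, forall c d, c - d \in subc E}.
Proof.
move=> c d /subcP[c1 c2] /subcP[d1 d2]; apply/subcP; split.
  rewrite (eq_dle _ (g := fun x => c x (+) d x)); first exact: dle_add.
  by move=> x; rewrite fword_oppE fword_addE.
move=> x; rewrite fword_oppE fword_addE.
by have := c2 x; have := d2 x; case: (c x); case: (d x) => //=; auto.
Qed.

Lemma dimc_bound (R : realFieldType) (phi : nat -> R) (th : R) E :
  1 <= th -> (forall u, 0 <= phi u) -> (forall u u', (u <= u')%N -> phi u <= phi u') ->
  1 <= phi 1%N ->
  (forall u0 u1, (u0 <= u1)%N -> th * phi u0 + phi u1 <= phi (u0 + u1)%N) ->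
  th ^+ m.+1 * (dimc E)%:R <= th ^+ k * phi #|lost E|.
Proof.
move=> h1 h2 h3 h4 h5.
have [j cj bj] := subcode_dim_bound h1 h2 h3 h4 h5 (subc0 E) (@subcB E)
   (fun c cS => proj1 (subcP _ _ cS)).
by rewrite /dimc cj trunc_expnK.
Qed.

Lemma card_subc E : #|subc E| = (2 ^ dimc E)%N.
Proof.
(* The instance [th = 1], [phi u = u] serves to extract that the subcode has [2^j] elements. *)
have [||||j cj _] := @subcode_dim_bound rat (fun n => n%:R) 1 (lexx _) _ _ _ _ m k (subc E) (subc0 E)
   (@subcB E) (fun c cS => proj1 (subcP _ _ cS)).
- by move=> u; rewrite ler0n.
- by move=> u u' h; rewrite ler_nat.
- by [].
- by move=> u u' _; rewrite mul1r natrD.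
- by rewrite /dimc cj trunc_expnK.
Qed.

Lemma lostP E x : reflect (exists c, [/\ dle k c, c x & forall y, c y -> y \in E]) (x \in lost E).
Proof.
apply: (iffP (wsuppP _ _)) => [[c /subcP[h1 h2] cx]|[c [h1 h2 h3]]]; exists c => //.
by apply/subcP.
Qed.

Lemma lost_sub E : lost E \subset E.
Proof. by apply/subsetP => x /lostP[c [_ cx /(_ x cx)]]. Qed.

(** Evaluation at [i] has kernel the subcode of [E :\ i], and it is onto [bool] exactly when [i] is
    lost. *)
Lemma dimc_step E i : dimc E = (dimc (E :\ i) + (i \in lost E))%N.
Proof.
pose g (c : fword m) : bool := c i.
have gB : {morph g : c d / c - d} by move=> c d; rewrite /g fword_oppE fword_addE.
have kerE : [set c in subc E | g c == 0] = subc (E :\ i).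
  apply/setP => c; rewrite inE; apply/andP/subcP.
    case=> /subcP[h1 h2] ci; split => // x cx; rewrite !inE h2 // andbT.
    by apply: contraL ci => /eqP xi; rewrite /g -xi cx.
  case=> h1 h2; split; first by apply/subcP; split => // x /h2 /[!inE] /andP[].
  by rewrite /g; case ci: (c i) => //; have /[!inE] := h2 _ ci; rewrite eqxx.
have := card_additive_image gB (@subcB E); rewrite kerE !card_subc.
case: (boolP (i \in lost E)) => iE; last first.
  have -> : g @: subc E = [set false].
    apply/setP => b; rewrite inE; apply/imsetP/eqP => [[c cS ->]|->]; last first.
      by exists 0; rewrite ?subc0 // /g fword0E.
    by apply/negbTE/negP => ci; case/negP: iE; apply/wsuppP; exists c.
  by rewrite cards1 mul1n addn0 => /eqP; rewrite eqn_exp2l // => /eqP.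
have -> : g @: subc E = [set: bool].
  apply/setP => b; rewrite inE; apply/imsetP; case: b.
    by case/wsuppP: iE => c cS ci; exists c.
  by exists 0; rewrite ?subc0 // /g fword0E.
by rewrite cardsT card_bool addn1 -expnS => /eqP; rewrite eqn_exp2l // => /eqP.
Qed.

Lemma dimc_set0 : dimc set0 = 0%N.
Proof.
rewrite /dimc; have -> : subc set0 = [set 0]; last by rewrite cards1.
apply/setP => c; rewrite in_set1; apply/subcP/eqP => [[_ h]|-> ].
  apply/ffunP => x; rewrite fword0E; apply/negbTE/negP => /h; by rewrite inE.
by apply/subcP; exact: subc0.
Qed.

Lemma dimc_mono E E' : E \subset E' -> (dimc E <= dimc E')%N.
Proof.
move=> sE; apply: leq_trunc_log; apply/subset_leq_card/subsetP => c /subcP[h1 h2].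
by apply/subcP; split => // x /h2; apply/subsetP.
Qed.

Definition shift (i : 'rV[bool]_m) E := [set x | x + i \in E].

Lemma rv_add2 (i x : 'rV[bool]_m) : x + i + i = x.
Proof. by apply/matrixP => a b; rewrite !mxE; case: (x a b); case: (i a b). Qed.

Lemma lost_unrec i E : (i \in lost (i |: E)) = unrec k (shift i E).
Proof.
apply/lostP/unrecP => [[c [h1 h2 h3]]|[c [h1 h2 h3]]].
  exists (fun x => c (x + i)); split; first exact: dle_shift.
    by rewrite add0r.
  by move=> x /h3; rewrite !inE -[x + i == i]subr_eq0 addrK.
pose d : fword m := [ffun x => c (x + i)]; exists d; split.
- rewrite (eq_dle _ (g := fun x => c (x + i))) ?dle_shift // => x.
  by rewrite ffunE.
- by rewrite ffunE -[i in i + _]add0r rv_add2.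
- move=> x; rewrite ffunE => /h3; rewrite !inE rv_add2.
  by rewrite addr_eq0; have -> : - i = i by apply/matrixP => a b; rewrite !mxE.
Qed.

Lemma dimc_diff i E : dimc (i |: E) = (dimc (E :\ i) + unrec k (shift i E))%N.
Proof.
rewrite (dimc_step (i |: E) i) lost_unrec; congr (dimc _ + _)%N.
by apply/setP => x; rewrite !inE; case: eqP.
Qed.

End ErasureDimension.

Section ExReindex.
Variables (R : realFieldType) (T : finType) (p : R).

Lemma Ex_preimset (h : T -> T) (f : {set T} -> R) : injective h ->
  Ex p (fun E => f (h @^-1: E)) = Ex p f.
Proof.
move=> hI; rewrite /Ex [RHS](reindex_inj (h := fun E : {set T} => h @^-1: E)) /=; last first.
  move=> E E' /setP EE'; apply/setP => x.
  by have := EE' (invF hI x); rewrite !inE f_invF.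
apply: eq_bigr => E _; congr (_ * _); rewrite /mu (reindex_inj hI) /=.
by apply: eq_bigr => i _; rewrite inE.
Qed.
End ExReindex.

Section ErasureExpectation.
Variables (R : realFieldType) (p : R) (m k : nat).
Hypothesis p01 : 0 <= p <= 1.
Implicit Types E : {set 'rV[bool]_m}.

Lemma Ex_shift_unrec i :
  Ex p (fun E : {set 'rV[bool]_m} => (unrec k (shift i E))%:R) = exitR p m k.
Proof. exact: (@Ex_preimset _ _ p (fun x => x + i) (fun E => (unrec k E)%:R) (addIr i)). Qed.

Lemma card_rv : #|{: 'rV[bool]_m}| = (2 ^ m)%N.
Proof. by rewrite card_mx card_bool mul1n. Qed.

(** Core of the area theorem: by [russo] the left side is the derivative of the mean dimension.
    Translating [i] to the origin makes all positions equivalent. *)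
Lemma Ex_dimc_diff :
  \sum_i Ex p (fun E => (dimc k (i |: E))%:R - (dimc k (E :\ i))%:R) =
  2 ^+ m * exitR p m k :> R.
Proof.
rewrite (eq_bigr (fun=> exitR p m k)); last first.
  move=> i _; rewrite -(Ex_shift_unrec i); apply: eq_Ex => E.
  by rewrite dimc_diff natrD addrC addKr.
by rewrite sumr_const card_rv -natrX mulr_natl.
Qed.

Lemma Ex_lost : Ex p (fun E => #|lost k E|%:R) <= 2 ^+ m * exitR p m k :> R.
Proof.
have -> : 2 ^+ m * exitR p m k = \sum_(i : 'rV[bool]_m) exitR p m k.
  by rewrite sumr_const card_rv -natrX mulr_natl.
apply: (@le_trans _ _ (Ex p (fun E => \sum_i (i \in lost k E)%:R))).
  apply: Ex_le => // E; rewrite -natr_sum ler_nat -sum1_card big_mkcond.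
  by apply: leq_sum => i _; case: ifP.
rewrite Ex_sum; apply: ler_sum => i _; rewrite -(Ex_shift_unrec i).
apply: Ex_le => // E; rewrite ler_nat -lost_unrec.
case: (boolP (i \in lost k E)) => // /lostP[c [h1 h2 h3]].
suff -> : i \in lost k (i |: E) by [].
by apply/lostP; exists c; split => // y /h3 yE; rewrite inE yE orbT.
Qed.

(** When the dimension is [j], removing any lost position takes it to [j - 1], so every lost
    position is pivotal for the event [j <= dimc k E]. By [russo] the right side is the derivative
    of the probability of that event. *)
Lemma Ex_level_diff j : (0 < j)%N ->
  Ex p (fun E => #|lost k E|%:R * (dimc k E == j)%:R) <=
  \sum_i Ex p (fun E => (j <= dimc k (i |: E))%N%:R - (j <= dimc k (E :\ i))%N%:R) :> R.
Proof.
move=> j0; rewrite -Ex_sum; apply: Ex_le => // E.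
have mono i : 0 <= (j <= dimc k (i |: E))%N%:R - (j <= dimc k (E :\ i))%N%:R :> R.
  rewrite subr_ge0 ler_nat; case: (leqP j (dimc k (E :\ i))) => // h.
  rewrite (leq_trans h) // dimc_mono //.
  by apply: (subset_trans (subD1set _ _)); exact: subsetUr.
have [dE|_] := eqVneq (dimc k E) j; last by rewrite mulr0 sumr_ge0.
rewrite mulr1 -sum1_card natr_sum big_mkcond /=; apply: ler_sum => i _.
case: ifP => // iE; have iE' : i \in E by apply: (subsetP (lost_sub k E)).
have -> : i |: E = E by apply/setUidPr; rewrite sub1set.
have := dimc_step k E i; rewrite iE addn1 dE => jE.
by rewrite jE leqnn ltnn subr0.
Qed.

End ErasureExpectation.

(** * Real-valued erasure functions *)

Arguments is_derive_eq (f g)%_R x%_R (l l')%_R _ _ _.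

Lemma is_derive_big_sum (I : Type) (r : seq I) (P : pred I) (F : I -> R -> R) (dF : I -> R) (x : R) :
  (forall i, P i -> is_derive (F i) x (dF i)) ->
  is_derive (fun y => \sum_(i <- r | P i) F i y) x (\sum_(i <- r | P i) dF i).
Proof.
move=> h; elim: r => [|i r IH].
  apply: (@is_derive_eq (fun=> 0) _ x 0); last exact: is_derive_const.
    by move=> t; rewrite big_nil.
  by rewrite big_nil.
case: (boolP (P i)) => Pi.
  apply: (@is_derive_eq (fun y => F i y + \sum_(j <- r | P j) F j y) _ x
    (dF i + \sum_(j <- r | P j) dF j)).
  - by move=> t; rewrite big_cons Pi.
  - by rewrite big_cons Pi.
  - by apply: is_derive_plus => //; exact: h.
apply: (is_derive_eq _ _ IH) => [t|]; by rewrite big_cons (negPf Pi).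
Qed.

Lemma is_derive_big_prod (I : eqType) (r : seq I) (F : I -> R -> R) (dF : I -> R) (x : R) :
  uniq r -> (forall i, is_derive (F i) x (dF i)) ->
  is_derive (fun y => \prod_(i <- r) F i y) x
    (\sum_(i <- r) dF i * \prod_(j <- r | j != i) F j x).
Proof.
move=> ur h; elim: r ur => [|a r IH] /=.
  move=> _; apply: (@is_derive_eq (fun=> 1) _ x 0); last exact: is_derive_const.
    by move=> t; rewrite big_nil.
  by rewrite big_nil.
move=> /andP[ar ur]; apply: (@is_derive_eq (fun y => F a y * \prod_(j <- r) F j y) _ x
  (dF a * \prod_(j <- r) F j x + F a x * \sum_(i <- r) dF i * \prod_(j <- r | j != i) F j x)).
- by move=> t; rewrite big_cons.
- rewrite !big_cons eqxx /=; congr (_ * _ + _).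
    rewrite [LHS]big_seq [RHS]big_seq_cond; apply: eq_bigl => j.
    by case: (boolP (j \in r)) => //= jr; apply/esym; apply: contraNneq ar => <-.
    rewrite mulr_sumr [LHS]big_seq [RHS]big_seq; apply: eq_bigr => i ir.
  rewrite big_cons; have -> : a != i by apply: contraNneq ar => ->.
  ring.
- by apply: is_derive_mult => //; [exact: IH | move=> ? ?; exact: Rmult_comm].
Qed.

Section Russo.
Variable T : finType.
Implicit Types (E : {set T}) (f : {set T} -> R).

(** In the product [mu], the factor of position [i] has derivative 1 or -1 according to whether [i]
    is erased; this sign pairs [i |: E] with [E :\ i]. *)
Lemma russo f (p : R) :
  is_derive (fun q : R => Ex q f) p (\sum_i Ex p (fun E => f (i |: E) - f (E :\ i))).
Proof.
pose s i E : R := if i \in E then 1 else -1.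
have -> : \sum_i Ex p (fun E => f (i |: E) - f (E :\ i)) =
  \sum_(E : {set T}) f E * (\sum_i s i E * mu_off p i E).
  under [RHS]eq_bigr do rewrite mulr_sumr.
  rewrite [RHS]exchange_big; apply: eq_bigr => i _.
  rewrite (Ex_off _ i) [RHS](sum_set_split i); apply: eq_bigr => E iE.
  rewrite /s (negPf iE) setU11 mu_offU setU1K // setUA setUid.
  have -> : E :\ i = E by apply/setP => j; rewrite !inE; case: eqP => // ->; rewrite (negPf iE).
  ring.
apply: is_derive_big_sum => E _.
apply: (@is_derive_eq (fun q : R => f E * mu q E) _ p (f E * (\sum_i s i E * mu_off p i E))) => //.
  by move=> t; rewrite mulrC.
apply: is_derive_scal; apply: is_derive_big_prod; first exact: index_enum_uniq.
move=> i; rewrite /s; case: ifP => _; first exact: is_derive_id.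
apply: (@is_derive_eq (fun y : R => 1 - y) _ p (0 - 1)) => //; first by rewrite sub0r.
by apply: is_derive_minus; [exact: is_derive_const | exact: is_derive_id].
Qed.

Lemma Ex_mono_p f (p q : R) : (0 <= p)%coqR -> (p <= q)%coqR -> (q <= 1)%coqR ->
  (forall E E', E \subset E' -> (f E <= f E')) -> (Ex p f <= Ex q f)%coqR.
Proof.
move=> p0 pq q1 hf.
have := @increase_bound (fun p : R => Ex p f) _ p q 0 pq (fun x _ => russo f x).
suff h x : (p < x < q)%coqR -> (0 <= \sum_i Ex x (fun E => (f (i |: E) - f (E :\ i))%R))%coqR.
  by move=> /(_ h); Lra.lra.
move=> hx; apply/RleP; apply: sumr_ge0 => i _; apply: Ex_ge0.
  apply/andP; split; apply/RleP.
    exact: Rle_trans p0 (Rlt_le _ _ (proj1 hx)).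
  exact: Rle_trans (Rlt_le _ _ (proj2 hx)) q1.
move=> E; rewrite subr_ge0; apply: hf.
by apply: (subset_trans (subD1set _ _)); exact: subsetUr.
Qed.
End Russo.

Lemma hyper_constant (F : realFieldType) (x z : F) :
  [/\ 1 <= 3 + `|x| + `|z|, 3 + `|x| <= 3 + `|x| + `|z| &
      z + 2 * `|x| <= (3 + `|x| + `|z|) ^+ 2].
Proof.
have := normr_ge0 x; have := normr_ge0 z; have := ler_norm z.
move: (`|x|) (`|z|) => a b zb b0 a0; split; [lra | lra |].
have := sqr_ge0 (a + b); lra.
Qed.

Section RealInterface.

Lemma p01_R (p : R) : (0 <= p <= 1)%coqR -> (0 <= p <= 1)%R.
Proof. by case=> h1 h2; apply/andP; split; apply/RleP. Qed.

Definition exit_fn (n k : nat) (p : R) : R := exitR p n k.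
Definition mean_dimc (n k : nat) (p : R) : R :=
  Ex p (fun E : {set 'rV[bool]_n} => (dimc k E)%:R).
Definition dimc_tail (n k j : nat) (p : R) : R :=
  Ex p (fun E : {set 'rV[bool]_n} => (j <= dimc k E)%N%:R).

Lemma biased_basis (p : R) : (0 < p < 1)%coqR -> exists al be : R,
  p * al + (1 - p) * be = 0 /\ p * al ^+ 2 + (1 - p) * be ^+ 2 = 1.
Proof.
move=> [p0 p1]; exists (sqrt ((1 - p) / p)%coqR), (- (sqrt (p / (1 - p))%coqR)).
have h1 : (0 <= (1 - p) / p)%coqR.
  apply: Rlt_le; apply: Rdiv_lt_0_compat; Lra.lra.
have h2 : (0 <= p / (1 - p))%coqR by apply: Rlt_le; apply: Rdiv_lt_0_compat; Lra.lra.
have pn0 : p != 0 by apply/eqP; rewrite -R0E; Lra.lra.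
have qn0 : 1 - p != 0 by apply/eqP; rewrite -R0E -R1E -RminusE; Lra.lra.
split; last first.
  rewrite sqrrN -!RpowE -!Rsqr_pow2 !Rsqr_sqrt // !RdivE !RminusE R1E.
  by field; rewrite pn0 qn0.
rewrite mulrN; apply/eqP; rewrite subr_eq0; apply/eqP; apply: Rsqr_inj.
- by apply: Rmult_le_pos; [Lra.lra | exact: sqrt_pos].
- by apply: Rmult_le_pos; [rewrite -R1E -RminusE; Lra.lra | exact: sqrt_pos].
rewrite !Rsqr_mult !Rsqr_sqrt // !RdivE /Rsqr !RminusE R1E !RmultE.
by field; rewrite pn0 qn0.
Qed.

Lemma exit_fn_bounds n k p : (0 <= p <= 1)%coqR -> (0 <= exit_fn n k p <= 1)%coqR.
Proof.
move=> /p01_R hp; split; apply/RleP; first exact: exitR_ge0.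
rewrite R1E -[X in _ <= X](@Ex_cst _ 'rV[bool]_n p); apply: Ex_le => // E.
by case: (unrec _ _).
Qed.

Lemma exit_fn_mono n k (p q : R) : (0 <= p)%coqR -> (p <= q)%coqR -> (q <= 1)%coqR ->
  (exit_fn n k p <= exit_fn n k q)%coqR.
Proof.
move=> p0 pq q1; apply: Ex_mono_p => // E E' sE; rewrite ler_nat.
by case: (boolP (unrec k E)) => // /(unrec_sub sE) ->.
Qed.

Lemma exit_fn_square n a k p : (0 < p < 1)%coqR ->
  (exit_fn (n + a) k p <= exit_fn n k p ^ 2 + exit_fn n k p / 2 ^ a)%coqR.
Proof.
move=> hp; have [al [be [h1 h2]]] := biased_basis hp.
have hp' : 0 <= p <= 1 by apply: p01_R; Lra.lra.
apply/RleP; rewrite RplusE RdivE !RpowE; exact: (exit_square hp' h1 h2).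
Qed.

Lemma exit_fn_anti n a k p : (0 < p < 1)%coqR -> (exit_fn (n + a) k p <= exit_fn n k p)%coqR.
Proof.
move=> hp; have [al [be [h1 h2]]] := biased_basis hp.
have hp' : 0 <= p <= 1 by apply: p01_R; Lra.lra.
apply/RleP; exact: (exit_antitone hp' h1 h2).
Qed.

Lemma exit_fn_boost p : (0 < p < 1)%coqR -> exists K : R, (1 <= K)%coqR /\
  forall n a k l : nat, exists W : R, (0 <= W)%coqR /\
    (W ^ 2 <= exit_fn n k p ^ 3 * K ^ (2 * l)%N)%coqR /\
    (exit_fn (n + a) k p <= W + exit_fn n k p / INR l.+2 ^ a)%coqR.
Proof.
move=> hp; have [al [be [h1 h2]]] := biased_basis hp.
have hp' : 0 <= p <= 1 by apply: p01_R; Lra.lra.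
pose M3 := p * al ^+ 3 + (1 - p) * be ^+ 3.
pose M4 := p * al ^+ 4 + (1 - p) * be ^+ 4.
pose K := 3 + `|M3| + `|M4|.
have [K1 K3 K4] := hyper_constant M3 M4.
exists K; split; first exact/RleP.
move=> n a k l; have [W [W0 W1] W2] := exit_boost hp' h1 h2 n a k K1 K3 K4 l.
exists W; split; first exact/RleP; split.
  by apply/RleP; rewrite RmultE !RpowE.
by apply/RleP; rewrite RplusE RdivE RpowE INRE.
Qed.

Lemma mean_dimc_derive n k p : is_derive (mean_dimc n k) p (2 ^ n * exit_fn n k p)%coqR.
Proof.
apply: (is_derive_eq _ _ (russo _ p)) => //.
by rewrite Ex_dimc_diff RmultE RpowE.
Qed.

Lemma mu0 (T : finType) (E : {set T}) : mu (0 : R) E = (E == set0)%:R.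
Proof.
rewrite /mu; have [->|/set0Pn[i iE]] := eqVneq E set0.
  by rewrite big1 // => i _; rewrite inE subr0.
by rewrite (bigD1 i) //= iE mul0r.
Qed.

Lemma mu1 (T : finType) (E : {set T}) : mu (1 : R) E = (E == setT)%:R.
Proof.
rewrite /mu; have [->|ET] := eqVneq E setT.
  by rewrite big1 // => i _; rewrite inE.
have [i iE] : exists i, i \notin E.
  by move: ET; rewrite -subTset => /subsetPn[i _ iE]; exists i.
by rewrite (bigD1 i) //= (negPf iE) subrr mul0r.
Qed.

Lemma mean_dimc0 n k : mean_dimc n k (IZR 0) = IZR 0.
Proof.
rewrite R0E /mean_dimc /Ex big1 // => E _; rewrite mu0.
by case: eqP => [->|]; rewrite ?dimc_set0 ?mulr0 ?mul0r.
Qed.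

Lemma mean_dimc1 n k : mean_dimc n k (IZR 1) = (dimc k [set: 'rV[bool]_n])%:R.
Proof.
rewrite R1E /mean_dimc /Ex (bigD1 setT) //= mu1 eqxx mul1r big1 ?addr0 // => E ET.
by rewrite mu1 (negPf ET) mul0r.
Qed.

(** * Transfer of [RM], [RM_rate] and [PB] to row vectors and [dimc] *)

Definition toP n (x : 'rV[bool]_n) : point n := [ffun i => x 0 i].
Definition ofP n (x : point n) : 'rV[bool]_n := \row_i x i.
Lemma toPK n : cancel (@toP n) (@ofP n).
Proof. by move=> x; apply/rowP => i; rewrite mxE ffunE. Qed.
Lemma ofPK n : cancel (@ofP n) (@toP n).
Proof. by move=> x; apply/ffunP => i; rewrite ffunE mxE. Qed.
Lemma toPD n : {morph @toP n : x y / x + y}.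
Proof. by move=> x y; apply/ffunP => i; rewrite !ffunE mxE. Qed.
Lemma ofPD n : {morph @ofP n : x y / x + y}.
Proof. by move=> x y; apply/rowP => i; rewrite !mxE ffunE. Qed.

Definition toW n (w : word n) : fword n := [ffun x => w (toP x)].
Definition ofW n (c : fword n) : word n := [ffun x => c (ofP x)].
Lemma toWK n : cancel (@toW n) (@ofW n).
Proof. by move=> w; apply/ffunP => x; rewrite !ffunE ofPK. Qed.
Lemma ofWK n : cancel (@ofW n) (@toW n).
Proof. by move=> w; apply/ffunP => x; rewrite !ffunE toPK. Qed.

Lemma RM_toW v n (w : word n) : (w \in RM v n) = dle v.+1 (toW w).
Proof.
rewrite RM_dle; apply/idP/idP => h.
  rewrite (eq_dle _ (g := (fun x : point n => w x) \o @toP n)).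
    by apply: dle_comp => //; exact: toPD.
  by move=> x; rewrite ffunE.
rewrite (eq_dle _ (g := toW w \o @ofP n)).
  by apply: dle_comp => //; exact: ofPD.
by move=> x; rewrite /= ffunE ofPK.
Qed.

Lemma dimc_full v n :
  dimc v.+1 [set: 'rV[bool]_n] = (\sum_(0 <= k < v.+1) 'C(n, k))%N.
Proof.
rewrite /dimc -[RHS](@trunc_expnK 2) // -card_RM -(card_imset _ (can_inj (@ofWK n))).
congr (trunc_log 2 _); apply: eq_card => w; apply/imsetP/idP => [[c /subcP[h _] ->]|h].
  by rewrite RM_toW ofWK.
exists (toW w); rewrite ?toWK //; apply/subcP; rewrite -RM_toW; split => // x _; exact: in_setT.
Qed.

Lemma RM_rate_mean_dimc v n : RM_rate v n = (mean_dimc n v.+1 (IZR 1) / 2 ^ n)%coqR.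
Proof. by rewrite mean_dimc1 dimc_full /RM_rate INRE. Qed.

Lemma Ex_toP n (p : R) (f : {set 'rV[bool]_n} -> R) :
  Ex p (fun E : {set point n} => f (@toP n @^-1: E)) = Ex p f.
Proof.
have bij : {on [pred _ | true], bijective (fun E : {set point n} => @toP n @^-1: E)}.
  exists (fun E : {set 'rV[bool]_n} => @ofP n @^-1: E) => E _; apply/setP => x; rewrite !inE.
    by rewrite ofPK.
  by rewrite toPK.
rewrite /Ex [RHS](reindex _ bij) /=; apply: eq_bigr => E _; congr (_ * _).
rewrite /mu (reindex (@toP n)) /=.
  by apply: eq_bigr => i _; rewrite inE.
by exists (@ofP n) => x _; rewrite ?toPK ?ofPK.
Qed.

Lemma mu_pow n (p : R) (E : {set point n}) :
  (p ^ #|E| * (1 - p) ^ (#|point n| - #|E|)%N)%coqR = mu p E.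
Proof.
rewrite RmultE !RpowE RminusE R1E /mu (bigID (fun i => i \in E)) /=; congr (_ * _).
  rewrite (eq_bigr (fun=> p)); first by rewrite prodr_const.
  by move=> i ->.
rewrite (eq_bigr (fun=> 1 - p)) => [|i /negPf->//].
rewrite prodr_const; congr (_ ^+ _).
by rewrite -(cardC (mem E)) addKn; apply: eq_card => i; rewrite !inE.
Qed.

Lemma ambiguous_dimc v n (w : word n) (E : {set point n}) : w \in RM v n ->
  ambiguous (RM v n) w E = (0 < dimc v.+1 (@toP n @^-1: E))%N.
Proof.
move=> wRM; have -> : (0 < dimc v.+1 (@toP n @^-1: E))%N =
  (1 < #|subc v.+1 (@toP n @^-1: E)|)%N.
  by rewrite card_subc -{3}(expn0 2) ltn_exp2l.
apply/exists_inP/card_gt1P.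
  case=> x xRM /andP[xw /forall_inP h].
  exists 0, (toW x + toW w); split; first exact: subc0.
    apply/subcP; split.
      rewrite (eq_dle _ (g := fun y => toW x y (+) toW w y)).
        by apply: dle_add; rewrite -RM_toW.
      by move=> y; rewrite fword_addE.
    move=> y; rewrite fword_addE !ffunE inE; apply: contraLR => yE.
    by rewrite (eqP (h (toP y) _)) ?inE // addbb.
  apply: contra xw => /eqP e; apply/eqP/(can_inj (@toWK n)).
  by apply/eqP; rewrite -subr_eq0 fword_oppE -e.
case=> c [d [cS dS cd]].
pose e := c - d; have /subcP[e1 e2] : e \in subc v.+1 (@toP n @^-1: E) by exact: subcB.
exists (ofW (toW w + e)).
  rewrite RM_toW ofWK (eq_dle _ (g := fun y => toW w y (+) e y)).
    by apply: dle_add; rewrite -?RM_toW.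
  by move=> y; rewrite fword_addE.
apply/andP; split.
  apply: contra cd => /eqP h; rewrite -subr_eq0 -/e.
  by apply/eqP/(@addrI _ (toW w)); rewrite addr0 -(ofWK (toW w + e)) h.
apply/forall_inP => y; rewrite inE => yE; rewrite ffunE fword_addE ffunE ofPK.
case ey : (e (ofP y)); last by rewrite addbF.
by have := e2 _ ey; rewrite inE ofPK (negPf yE).
Qed.

(** By linearity, ambiguity depends on the erasures but not on the codeword sent, so the average
    over codewords is that of a constant. *)
Lemma PB_dimc_tail v n p : PB (RM v n) p = dimc_tail n v.+1 1 p.
Proof.
rewrite /PB /dimc_tail -Ex_toP.
rewrite (eq_bigr (fun=> / INR #|RM v n| * Ex p (fun E : {set point n} =>
   (0 < dimc v.+1 (@toP n @^-1: E))%N%:R)))%coqR; last first.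
  move=> w wRM; congr (_ * _)%coqR; apply: eq_bigr => E _.
  rewrite mu_pow ambiguous_dimc // RmultE; congr (_ * _).
  by case: (0 < _)%N.
have N0 : INR #|RM v n| <> 0%coqR.
  apply: not_0_INR; rewrite card_RM; apply/eqP; by rewrite expn_eq0.
transitivity ((INR #|RM v n| * (/ INR #|RM v n| * Ex p (fun E : {set point n} =>
   (0 < dimc v.+1 (@toP n @^-1: E))%N%:R)))%coqR); last first.
  by rewrite -Rmult_assoc Rinv_r // Rmult_1_l.
set c := (/ _ * _)%coqR.
transitivity ((c : R) *+ #|RM v n|); first exact: sumr_const.
by rewrite -mulr_natl -INRE.
Qed.

Lemma dimc_tail_bounds n k j p : (0 <= p <= 1)%coqR -> (0 <= dimc_tail n k j p <= 1)%coqR.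
Proof.
move=> /p01_R hp; split; apply/RleP; first by apply: Ex_ge0 => // E; rewrite ler0n.
rewrite R1E -[X in _ <= X](@Ex_cst _ 'rV[bool]_n p); apply: Ex_le => // E.
by case: (j <= _)%N.
Qed.

Lemma dimc_tail_mono n k j (p q : R) : (0 <= p)%coqR -> (p <= q)%coqR -> (q <= 1)%coqR ->
  (dimc_tail n k j p <= dimc_tail n k j q)%coqR.
Proof.
move=> p0 pq q1; apply: Ex_mono_p => // E E' sE; rewrite ler_nat.
by case: (leqP j (dimc k E)) => // /leq_trans -> //; exact: dimc_mono.
Qed.

(* Lowering [p] removes erasures; when the ambiguity dimension is [j], at least [d_j]
   of the positions reduce it by one, so that the dimension dies out like a pure death
   process with rates [d_j]. *)
Lemma death_process n k (J : nat) (lam p0 p1 : R) :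
  (0 < lam)%coqR -> (0 <= p0)%coqR -> (p0 <= p1)%coqR -> (p1 <= 1)%coqR ->
  (forall E : {set 'rV[bool]_n}, (0 < dimc k E)%N -> (dimc k E <= J)%N ->
     (lam * INR (dimc k E) <= INR #|lost k E|)%coqR) ->
  ((p1 - p0) * (dimc_tail n k 1 p0 - dimc_tail n k J.+1 p1) <= / lam * \sum_(1 <= j < J.+1) (/ INR j)%coqR)%coqR.
Proof.
move=> lam0 hp0 hp hp1 hl.
pose c (j : nat) : R := (/ (lam * INR j))%coqR.
(* [F p] is the expectation of the sum of [1 / (lam j)] over [j] up to the smaller of the current
   dimension and [J], the mean time to die out if the death rate at [j] were exactly [lam j]. Its
   derivative is therefore at least the probability of a dimension between 1 and [J]. *)
pose F (p : R) : R := \sum_(1 <= j < J.+1) c j * dimc_tail n k j p.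
pose dq j (p : R) : R := \sum_i Ex p (fun E : {set 'rV[bool]_n} =>
  (j <= dimc k (i |: E))%N%:R - (j <= dimc k (E :\ i))%N%:R).
pose dF (p : R) : R := \sum_(1 <= j < J.+1) c j * dq j p.
have dFP p : is_derive F p (dF p).
  by apply: is_derive_big_sum => j _; apply: is_derive_scal; exact: russo.
have c0 j : (0 < j)%N -> (0 < c j)%coqR.
  move=> j0; apply: Rinv_0_lt_compat; apply: Rmult_lt_0_compat => //.
  by apply: lt_0_INR; apply/ssrnat.ltP.
have dFge p : (p0 < p < p1)%coqR -> (dimc_tail n k 1 p0 - dimc_tail n k J.+1 p1 <= dF p)%coqR.
  move=> hpp; have hp' : (0 <= p <= 1)%R by apply: p01_R; Lra.lra.
  have m1 := @dimc_tail_mono n k 1 p0 p hp0 (Rlt_le _ _ (proj1 hpp)) ltac:(Lra.lra).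
  have m2 := @dimc_tail_mono n k J.+1 p p1 ltac:(Lra.lra) (Rlt_le _ _ (proj2 hpp)) hp1.
  suff : (dimc_tail n k 1 p - dimc_tail n k J.+1 p <= dF p)%coqR by Lra.lra.
  apply/RleP; rewrite RminusE -ExB.
  apply: (@le_trans _ _ (\sum_(1 <= j < J.+1) c j *
     Ex p (fun E : {set 'rV[bool]_n} => #|lost k E|%:R * (dimc k E == j)%:R))); last first.
    rewrite /dF big_nat [leRHS]big_nat; apply: ler_sum => j /andP[j0 _].
    apply: ler_wpM2l; first by apply/RleP/Rlt_le/c0.
    exact: Ex_level_diff.
  under [leRHS]eq_bigr do rewrite -ExZ.
  rewrite -Ex_sum; apply: Ex_le => // E.
  have cl j : (0 < j)%N -> 0 <= c j by move=> /c0 h; apply/RleP/Rlt_le.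
  have term0 : 0 <= \sum_(1 <= j < J.+1) c j * (#|lost k E|%:R * (dimc k E == j)%:R).
    rewrite big_nat; apply: sumr_ge0 => j /andP[j0 _].
    by rewrite !mulr_ge0 ?ler0n // cl.
  case: (posnP (dimc k E)) => [d0|d0]; first by apply: le_trans term0; rewrite d0 !ltn0 subrr.
  case: (leqP J.+1 (dimc k E)) => dJ; first by rewrite subrr.
  rewrite subr0 (bigD1_seq (dimc k E)) ?mem_index_iota ?d0 ?dJ ?iota_uniq //=.
  rewrite eqxx mulr1 -[leLHS]addr0 lerD //; last first.
    rewrite big_nat_cond; apply: sumr_ge0 => j /andP[/andP[j0 _] _].
    by rewrite !mulr_ge0 ?ler0n // cl.
  have hle := hl E d0 dJ.
  have hpos : (0 < lam * INR (dimc k E))%coqR.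
    by apply: Rmult_lt_0_compat => //; apply: lt_0_INR; apply/ssrnat.ltP.
  have i1 : INR 1 = 1%coqR by [].
  apply/RleP; rewrite -!INRE -RmultE i1 /c.
  apply: (Rmult_le_reg_l _ _ _ hpos); rewrite -Rmult_assoc Rinv_r; last exact: Rgt_not_eq.
  by rewrite Rmult_1_r Rmult_1_l.
have := @increase_bound F dF p0 p1 _ hp (fun x _ => dFP x) dFge.
rewrite Rmult_comm => /Rle_trans; apply.
have Fp0 : (0 <= F p0)%coqR.
  apply/RleP; rewrite /F big_nat; apply: sumr_ge0 => j /andP[j0 _].
  apply: mulr_ge0; first by apply/RleP/Rlt_le/c0.
  by have [] := @dimc_tail_bounds n k j p0 ltac:(Lra.lra) => /RleP.
have Fp1 : (F p1 <= / lam * \sum_(1 <= j < J.+1) (/ INR j)%coqR)%coqR.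
  apply/RleP; rewrite RmultE mulr_sumr /F big_nat [leRHS]big_nat.
  apply: ler_sum => j /andP[j0 _].
  have -> : (/ lam)%coqR * (/ INR j)%coqR = c j :> R by rewrite /c Rinv_mult.
  apply: ler_piMr; first by apply/RleP/Rlt_le/c0.
  by have [_ /RleP] := @dimc_tail_bounds n k j p1 ltac:(Lra.lra).
Lra.lra.
Qed.

Lemma dimc_tail_markov n k J (u p : R) : (0 <= p <= 1)%coqR -> (0 < u)%coqR ->
  (forall E : {set 'rV[bool]_n}, (J < dimc k E)%N -> (u <= INR #|lost k E|)%coqR) ->
  (dimc_tail n k J.+1 p <= 2 ^ n * exit_fn n k p / u)%coqR.
Proof.
move=> hp u0 hu; have hp' := p01_R hp.
apply: (proj1 (Rle_div_r _ _ _ u0)); rewrite Rmult_comm.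
apply: Rle_trans (_ : (_ <= Ex p (fun E : {set 'rV[bool]_n} => #|lost k E|%:R))%coqR) _; last first.
  by have /RleP := Ex_lost n k hp'; rewrite RmultE RpowE.
apply/RleP; rewrite RmultE.
rewrite -ExZ; apply: Ex_le => // E.
case: (leqP J.+1 (dimc k E)) => h; last by rewrite mulr0 ler0n.
by rewrite mulr1; apply/RleP; rewrite -INRE; exact: hu.
Qed.

Lemma dimc_boundR m k (phi : nat -> R) (th : R) (E : {set 'rV[bool]_m}) :
  (1 <= th)%coqR -> (forall u, (0 <= phi u)%coqR) ->
  (forall u u', (u <= u')%N -> (phi u <= phi u')%coqR) -> (1 <= phi 1%N)%coqR ->
  (forall u0 u1, (u0 <= u1)%N -> (th * phi u0 + phi u1 <= phi (u0 + u1)%N)%coqR) ->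
  (th ^ m.+1 * INR (dimc k E) <= th ^ k * phi #|lost k E|)%coqR.
Proof.
move=> h1 h2 h3 h4 h5; apply/RleP; rewrite !RmultE !RpowE INRE.
apply: dimc_bound; first exact/RleP.
- by move=> u; apply/RleP.
- by move=> u u' h; apply/RleP/h3.
- exact/RleP.
- by move=> u0 u1 h; apply/RleP; rewrite -RmultE -RplusE; exact: h5.
Qed.

Lemma sum_inv_le (J : nat) : (0 < J)%N ->
  ((\sum_(1 <= j < J.+1) (/ INR j)%coqR : R) <= 1 + ln (INR J))%coqR.
Proof.
elim: J => // -[|J] IH _.
  by rewrite big_nat1 /= ln_1 Rinv_1 Rplus_0_r; apply: Rle_refl.
rewrite big_nat_recr //= -/(INR J.+2); apply: Rle_trans (Rplus_le_compat_r _ _ _ (IH isT)) _.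
have j1 : (0 < INR J.+1)%coqR by apply: lt_0_INR; apply/ssrnat.ltP.
have e : (INR J.+2 = INR J.+1 + 1)%coqR by rewrite S_INR.
have j2 : (0 < INR J.+2)%coqR by rewrite e; Lra.lra.
have h : (ln (INR J.+1 / INR J.+2) <= - / INR J.+2)%coqR.
  have := @exp_ineq1_le (- / INR J.+2)%coqR => h.
  rewrite -[X in (_ <= X)%coqR]ln_exp; apply: ln_le.
    by apply: Rdiv_lt_0_compat.
  apply: Rle_trans h; apply: Req_le; rewrite {1}(_ : INR J.+1 = INR J.+2 - 1)%coqR; last by Lra.lra.
  by rewrite /Rdiv Rmult_minus_distr_r Rinv_r ?Rmult_1_l //; apply: Rgt_not_eq.
by move: h; rewrite ln_div //; Lra.lra.
Qed.

End RealInterface.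

End Combinatorics.

Import all_algebra Combinatorics.
Open Scope R_scope.

(** * From bits to blocks *)

Lemma INR_pos n : (0 < n)%N -> 0 < INR n.
Proof. by move=> h; apply: lt_0_INR; apply/ssrnat.ltP. Qed.

Lemma INR_leq n m : (n <= m)%N -> INR n <= INR m.
Proof. by move=> h; apply: le_INR; apply/ssrnat.leP. Qed.

Lemma exp_monotone x y : x <= y -> exp x <= exp y.
Proof. by case=> [h|->]; [left; exact: exp_increasing | right]. Qed.

Section PowerBound.
Variable s : R.
Hypothesis s1 : 1 <= s.

(** The value at 0 is set apart because [Rpower 0 s] evaluates to 1. *)
Definition powphi (u : nat) : R := if u is 0%N then 0 else Rpower (INR u) s.

(** Increments of the convex function [t^s] over a fixed length grow with [t]. As
    [(2a)^s - a^s = (2^s - 1) a^s], this is the condition [phi_conv] with [th = 2^s - 1], an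
    equality at [a = b]. *)
Lemma Rpower_increment (a b : R) : 0 < a -> a <= b ->
  Rpower (2 * a) s - Rpower a s <= Rpower (b + a) s - Rpower b s.
Proof.
move=> a0 ab.
pose F t := Rpower (t + a) s - Rpower t s.
pose dF t := s * Rpower (t + a) (s - 1) - s * Rpower t (s - 1).
have rp t : 0 < t -> Rpower t (s - 1) = Rpower t s / t.
  by move=> t0; rewrite /Rminus Rpower_plus Rpower_Ropp Rpower_1.
have h : 0 * (b - a) <= F b - F a.
  apply: (increase_bound (dF := dF)) => // x hx.
    rewrite /F /dF !rp; try lra.
    rewrite /Rpower; auto_derive; first lra.
    field; lra.
  rewrite /dF.
  have : Rpower x (s - 1) <= Rpower (x + a) (s - 1) by apply: Rle_Rpower_l; lra.
  nra.
move: h; rewrite /F (_ : a + a = 2 * a); lra.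
Qed.

Lemma powphi_ge0 u : 0 <= powphi u.
Proof. by case: u => [|u]; [rewrite /powphi; lra | left; apply: exp_pos]. Qed.

Lemma powphi_mono u u' : (u <= u')%N -> powphi u <= powphi u'.
Proof.
case: u => [|u]; first by move=> _; exact: powphi_ge0.
case: u' => // u' h; apply: Rle_Rpower_l; first lra.
by split; [exact: INR_pos | exact: INR_leq].
Qed.

Lemma powphi_conv u0 u1 : (u0 <= u1)%N ->
  (Rpower 2 s - 1) * powphi u0 + powphi u1 <= powphi (u0 + u1)%N.
Proof.
case: u0 => [|u0]; first by rewrite add0n /=; lra.
case: u1 => // u1 h; rewrite addSn /powphi -addSn plus_INR.
have a0 := INR_pos (ltn0Sn u0); have ab := INR_leq h.
have := Rpower_increment a0 ab; rewrite -Rpower_mult_distr; [|lra|lra].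
rewrite (Rplus_comm (INR u0.+1)); lra.
Qed.

Lemma dimc_power m k (E : {set 'rV[bool]_m}) :
  (Rpower 2 s - 1) ^ m.+1 * INR (dimc k E) <= (Rpower 2 s - 1) ^ k * powphi #|lost k E|.
Proof.
apply: dimc_boundR.
- have : Rpower 2 1 <= Rpower 2 s by apply: Rle_Rpower; lra.
  rewrite Rpower_1; lra.
- exact: powphi_ge0.
- exact: powphi_mono.
- by rewrite /powphi /= /Rpower ln_1 Rmult_0_r exp_0; lra.
- exact: powphi_conv.
Qed.
End PowerBound.

(** The left side is the second-order Taylor polynomial of the right side at 0. It controls
    [th = 2 exp y - 1] for the small [y] used next, where the second-order term matters. *)
Lemma ln_two_exp_minus1 y : 0 <= y -> 2 * y - y ^ 2 <= ln (2 * exp y - 1).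
Proof.
move=> y0.
pose F t := ln (2 * exp t - 1) - 2 * t + t ^ 2.
pose dF t := 2 * exp t / (2 * exp t - 1) - 2 + 2 * t.
have e1 t : 0 <= t -> 1 <= exp t by move=> t0; rewrite -exp_0; apply: exp_monotone.
have h : 0 * (y - 0) <= F y - F 0.
  apply: (increase_bound (dF := dF)) => // x hx; have ex := e1 x ltac:(lra).
    rewrite /F /dF; auto_derive; first lra.
    field; lra.
  have hx1 : exp x - 1 <= x * exp x.
    have := exp_ineq1_le (- x); rewrite exp_Ropp => h.
    have : (1 - x) * exp x <= 1.
      apply: (Rle_trans _ (/ exp x * exp x)); last by rewrite Rinv_l; lra.
      apply: Rmult_le_compat_r; lra.
    lra.
  rewrite /dF; apply: (Rmult_le_reg_r (2 * exp x - 1)); first lra.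
  rewrite Rmult_0_l.
  have -> : (2 * exp x / (2 * exp x - 1) - 2 + 2 * x) * (2 * exp x - 1) =
     2 * (x * (2 * exp x - 1) - (exp x - 1)) by field; lra.
  nra.
move: h; rewrite /F exp_0 (_ : 2 * 1 - 1 = 1); last lra.
rewrite ln_1; lra.
Qed.

Lemma ln2_pos : 0 < ln 2.
Proof. by rewrite -ln_1; apply: ln_increasing; lra. Qed.

(* The exponent of the power bound is [1 + y / ln 2] with [y = L / sqrt m]. *)
Lemma lost_ratio (m v : nat) (c L : R) (E : {set 'rV[bool]_m}) :
  (0 < m)%N -> (v <= m)%N -> 0 <= c -> 8 * c <= L -> 0 < L -> L <= sqrt (INR m) ->
  INR m / 2 - c * sqrt (INR m) <= INR m - INR v ->
  INR #|lost v.+1 E| <= 2 ^ m * exp (- (L * sqrt (INR m) * ln 2)) ->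
  exp (L ^ 2 / 4) * INR (dimc v.+1 E) <= INR #|lost v.+1 E|.
Proof.
move=> m0 vm c0 cL L0 Lm hv hu.
have l2 := ln2_pos.
set x := sqrt (INR m) in hv hu Lm *.
have x0 : 0 < x by apply: sqrt_lt_R0; exact: INR_pos.
have xx : x * x = INR m by apply: sqrt_sqrt; apply: pos_INR.
pose y := L / x.
have y0 : 0 < y by apply: Rdiv_lt_0_compat.
have yx : y * x = L by rewrite /y; field; lra.
have y1 : y <= 1.
  apply: (Rmult_le_reg_r x) => //; rewrite yx; lra.
pose s := 1 + y / ln 2.
have s1 : 1 <= s by rewrite /s; have := Rdiv_lt_0_compat _ _ y0 l2; lra.
have e2s : Rpower 2 s = 2 * exp y.
  rewrite /Rpower /s (_ : (1 + y / ln 2) * ln 2 = ln 2 + y); last by field; lra.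
  by rewrite exp_plus exp_ln; lra.
have := dimc_power s1 v.+1 E; rewrite e2s; set th := 2 * exp y - 1.
case Du : #|lost v.+1 E| hu => [|u] hu hD.
  move: hD; rewrite /= Rmult_0_r => hD.
  have th0 : 0 < th.
    rewrite /th; have := exp_ineq1_le y; lra.
  have : 0 < th * th ^ m by apply: Rmult_lt_0_compat => //; exact: pow_lt.
  have := pos_INR (dimc v.+1 E); move: (INR (dimc _ _)) hD => d hD d0 tp.
  have -> : d = 0; last lra.
  nra.
have u0 : 0 < INR u.+1 := INR_pos (ltn0Sn u).
have th1 : 1 < th by rewrite /th; have := exp_ineq1 y; lra.
have thm : th ^ m.+1 = th ^ v.+1 * th ^ (m - v)%N.
  by rewrite -pow_add; congr (_ ^ _); rewrite -[RHS]/(v.+1 + (m - v))%N addSn subnKC.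
have tv : 0 < th ^ v.+1 by apply: pow_lt; lra.
have hD2 : th ^ (m - v)%N * INR (dimc v.+1 E) <= Rpower (INR u.+1) s.
  apply: (Rmult_le_reg_l _ _ _ tv); rewrite -Rmult_assoc -thm; exact: hD.
have hp : Rpower (INR u.+1) s <= INR u.+1 * exp (y * (INR m - L * x)).
  rewrite /s Rpower_plus Rpower_1 //; apply: Rmult_le_compat_l; first lra.
  rewrite /Rpower; apply: exp_monotone.
  have hl : ln (INR u.+1) <= (INR m - L * x) * ln 2.
    apply: (Rle_trans _ (ln (2 ^ m * exp (- (L * x * ln 2))))); first exact: ln_le.
    rewrite ln_mult; try exact: exp_pos; try (apply: pow_lt; lra).
    by rewrite ln_exp ln_pow; lra.
  rewrite /Rdiv Rmult_assoc; apply: Rmult_le_compat_l; first lra.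
  apply: (Rmult_le_reg_l _ _ _ l2); rewrite -Rmult_assoc Rinv_r; lra.
have ht : exp ((INR m - INR v) * (2 * y - y ^ 2)) <= th ^ (m - v)%N.
  rewrite -[th ^ _]Rpower_pow; last lra.
  rewrite /Rpower minus_INR; last exact/ssrnat.leP.
  apply: exp_monotone; apply: Rmult_le_compat_l.
    by have := INR_leq vm; lra.
  by apply: ln_two_exp_minus1; lra.
pose A := (INR m - INR v) * (2 * y - y ^ 2).
pose B := y * (INR m - L * x).
(* The terms [y * INR m] cancel. The small support gains [L^2], the quadratic Taylor term takes back
   [L^2 / 2], and the deviation of [v] from [m / 2] takes [2 c L], at most [L^2 / 4] because
   [8 c <= L]. *)
have hAB : L ^ 2 / 4 + B <= A.
  have h1 : (INR m / 2 - c * x) * (2 * y - y ^ 2) <= A.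
    by rewrite /A; apply: Rmult_le_compat_r => //; nra.
  have e3 : (INR m / 2 - c * x) * (2 * y - y ^ 2) =
     y * INR m - (y * x) * (y * x) / 2 - 2 * c * (y * x) + c * (y * x) * y.
    by rewrite -xx; field.
  have e4 : B = y * INR m - L * (y * x) by rewrite /B; ring.
  rewrite e4; rewrite e3 yx in h1.
  have : 0 <= c * L * y by apply: Rmult_le_pos; [apply: Rmult_le_pos|]; lra.
  nra.
have d0 := pos_INR (dimc v.+1 E).
have eA : exp A * INR (dimc v.+1 E) <= INR u.+1 * exp B.
  apply: Rle_trans hp; apply: Rle_trans hD2.
  by apply: Rmult_le_compat_r.
have eB := exp_pos B.
apply: (Rmult_le_reg_r _ _ _ eB); apply: Rle_trans eA.
rewrite Rmult_assoc (Rmult_comm _ (exp B)) -Rmult_assoc -exp_plus.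
by apply: Rmult_le_compat_r => //; apply: exp_monotone.
Qed.

(** The first term is Markov's bound, at [p1], on having a large subcode; the second is the time a
    small one needs to die out, compared with the available time [p1 - p0]. *)
Lemma block_bound (m v : nat) (c L p0 p1 : R) :
  (0 < m)%N -> (v <= m)%N -> 0 <= c -> 8 * c <= L -> 0 < L -> L <= sqrt (INR m) ->
  INR m / 2 - c * sqrt (INR m) <= INR m - INR v ->
  0 <= p0 -> p0 < p1 -> p1 <= 1 ->
  PB (RM v m) p0 <= exp (L * sqrt (INR m) * ln 2) * exit_fn m v.+1 p1 +
    (INR m + 1) * exp (- (L ^ 2 / 4)) / (p1 - p0).
Proof.
move=> m0 vm c0 cL L0 Lm hv hp0 hp hp1.
rewrite PB_dimc_tail.
pose lam := exp (L ^ 2 / 4).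
pose us := 2 ^ m * exp (- (L * sqrt (INR m) * ln 2)).
have lam0 : 0 < lam by exact: exp_pos.
have us0 : 0 < us by apply: Rmult_lt_0_compat; [apply: pow_lt; lra | exact: exp_pos].
(* [J] is the last dimension with [J * lam <= us]. Up to [J], the rate [lam * D] holds by
   [lost_ratio] if the support is at most [us] and by the choice of [J] otherwise. Above [J],
   [lost_ratio] forces a support of at least [us]. *)
have [J [hJ1 hJ2]] : exists J : nat, INR J * lam <= us < (INR J + 1) * lam.
  have [J hJ] := nfloor_ex (us / lam) (Rlt_le _ _ (Rdiv_lt_0_compat _ _ us0 lam0)).
  exists J; split.
    by apply/Rle_div_r => //; case: hJ.
  by apply/Rlt_div_l => //; case: hJ.
have ratio (E : {set 'rV[bool]_m}) := @lost_ratio m v c L E m0 vm c0 cL L0 Lm hv.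
have h1 (E : {set 'rV[bool]_m}) : (0 < dimc v.+1 E)%N -> (dimc v.+1 E <= J)%N ->
     lam * INR (dimc v.+1 E) <= INR #|lost v.+1 E|.
  move=> _ dJ; case: (Rle_lt_dec (INR #|lost v.+1 E|) us); first exact: ratio.
  move=> h; apply: Rlt_le; apply: Rle_lt_trans h; apply: Rle_trans hJ1.
  by rewrite Rmult_comm; apply: Rmult_le_compat_r; [lra | exact: INR_leq].
have h2 (E : {set 'rV[bool]_m}) : (J < dimc v.+1 E)%N -> us <= INR #|lost v.+1 E|.
  move=> dJ; case: (Rle_lt_dec us (INR #|lost v.+1 E|)) => // h.
  have := ratio E (Rlt_le _ _ h); rewrite -/lam => h3.
  have : INR J + 1 <= INR (dimc v.+1 E) by rewrite -S_INR; exact: INR_leq.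
  move=> h4; have : (INR J + 1) * lam <= lam * INR (dimc v.+1 E).
    by rewrite Rmult_comm; apply: Rmult_le_compat_l; lra.
  lra.
have hd := death_process lam0 hp0 (Rlt_le _ _ hp) hp1 h1.
have hm := @dimc_tail_markov m v.+1 J us p1 ltac:(lra) us0 h2.
have hs : (\sum_(1 <= j < J.+1) (/ INR j)%coqR)%R <= INR m + 1.
  case: (posnP J) => [->|J0].
    rewrite big_nil; have := pos_INR m; rewrite -[0%R]/0%coqR; lra.
  apply: Rle_trans (sum_inv_le J0) _.
  have : ln (INR J) <= ln (2 ^ m).
    apply: ln_le; first exact: INR_pos.
    have : us <= 2 ^ m.
      rewrite -[X in _ <= X]Rmult_1_r; apply: Rmult_le_compat_l.
        by apply: pow_le; lra.
      rewrite -exp_0; apply: exp_monotone.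
      have : 0 < L * sqrt (INR m) * ln 2.
        apply: Rmult_lt_0_compat; last exact: ln2_pos.
        by apply: Rmult_lt_0_compat => //; apply: sqrt_lt_R0; exact: INR_pos.
      lra.
    have : 1 <= lam by rewrite /lam -exp_0; apply: exp_monotone; nra.
    have := pos_INR J; nra.
  rewrite ln_pow; last lra.
  have : ln 2 <= 1.
    rewrite -[X in _ <= X]ln_exp; apply: ln_le; first lra.
    by have := exp_ineq1_le 1; lra.
  by have := pos_INR m; nra.
have e1 : 2 ^ m * exit_fn m v.+1 p1 / us = exp (L * sqrt (INR m) * ln 2) * exit_fn m v.+1 p1.
  rewrite /us exp_Ropp; field; split; first exact: Rgt_not_eq (exp_pos _).
  by apply: pow_nonzero; lra.
have e2 : exp (- (L ^ 2 / 4)) = / lam by rewrite exp_Ropp.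
rewrite e1 in hm; rewrite e2.
have il : 0 < / lam by exact: Rinv_0_lt_compat.
have h5 : (p1 - p0) * (dimc_tail m v.+1 1 p0 - dimc_tail m v.+1 J.+1 p1) <= / lam * (INR m + 1).
  by apply: Rle_trans hd _; apply: Rmult_le_compat_l; lra.
have h6 : dimc_tail m v.+1 1 p0 - dimc_tail m v.+1 J.+1 p1 <= (INR m + 1) * / lam / (p1 - p0).
  apply/Rle_div_r; lra.
lra.
Qed.

(** * Bit erasure probability *)

(* By the area theorem the gap between the rates of the two codes is the integral of
   [H_n - H_(n+a)], which is at least about the integral of [H_n (1 - H_n)]. *)
Lemma exit_gap (n a v : nat) (p1 p2 eta eta' : R) :
  0 < p1 -> p1 < p2 -> p2 < 1 -> 0 <= eta -> 0 <= eta' ->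
  RM_rate v n <= (1 - eta') * (1 - p2) -> eta <= exit_fn n v.+1 p1 ->
  (eta * eta' - / 2 ^ a) * (p2 - p1) <= RM_rate v n - RM_rate v (n + a).
Proof.
move=> p10 p12 p21 e0 e0' hr; set k := v.+1 => he.
have pow2 i : 0 < 2 ^ i by apply: pow_lt; lra.
pose g i p := / 2 ^ i * mean_dimc i k p.
have dg i p : is_derive (g i) p (exit_fn i k p).
  have -> : exit_fn i k p = / 2 ^ i * (2 ^ i * exit_fn i k p).
    by rewrite -Rmult_assoc Rinv_l ?Rmult_1_l //; have := pow2 i; lra.
  exact: (is_derive_scal _ _ (/ 2 ^ i) _ (mean_dimc_derive i k p)).
pose D p := g n p - g (n + a)%N p.
have dD p : is_derive D p (exit_fn n k p - exit_fn (n + a)%N k p).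
  exact: (is_derive_minus _ _ _ _ _ (dg n p) (dg (n + a)%N p)).
have D0 : D 0 = 0 by rewrite /D /g !mean_dimc0; ring.
have D1 : D 1 = RM_rate v n - RM_rate v (n + a).
  by rewrite /D /g !RM_rate_mean_dimc /Rdiv -/k; ring.
have anti p : 0 < p < 1 -> 0 <= exit_fn n k p - exit_fn (n + a)%N k p.
  by move=> hp; have := exit_fn_anti n a k hp; lra.
have d1 : 0 * (p1 - 0) <= D p1 - D 0.
  by apply: (increase_bound _ (fun x _ => dD x)); [lra | move=> x hx; apply: anti; lra].
have d3 : 0 * (1 - p2) <= D 1 - D p2.
  by apply: (increase_bound _ (fun x _ => dD x)); [lra | move=> x hx; apply: anti; lra].
(* Monotonicity bounds [H(p2) * (1 - p2)] by the integral of [H] over the interval from [p2] to 1,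
   hence by the rate. *)
have hp2 : exit_fn n k p2 <= 1 - eta'.
  have h : exit_fn n k p2 * (1 - p2) <= g n 1 - g n p2.
    apply: (increase_bound _ (fun x _ => dg n x)); first lra.
    by move=> x hx; apply: exit_fn_mono; lra.
  have h0 : 0 * (p2 - 0) <= g n p2 - g n 0.
    apply: (increase_bound _ (fun x _ => dg n x)); first lra.
    by move=> x hx; have := @exit_fn_bounds n k x ltac:(lra); lra.
  have g0 : g n 0 = 0 by rewrite /g mean_dimc0; ring.
  have g1 : g n 1 = RM_rate v n by rewrite /g RM_rate_mean_dimc /Rdiv -/k; ring.
  apply: (Rmult_le_reg_r (1 - p2)); lra.
have d2 : (eta * eta' - / 2 ^ a) * (p2 - p1) <= D p2 - D p1.
  apply: (increase_bound _ (fun x _ => dD x)); first lra.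
  move=> x hx; have hs := @exit_fn_square n a k x ltac:(lra).
  have m1 := @exit_fn_mono n k p1 x ltac:(lra) ltac:(lra) ltac:(lra).
  have m2 := @exit_fn_mono n k x p2 ltac:(lra) ltac:(lra) ltac:(lra).
  have [b1 b2] := @exit_fn_bounds n k x ltac:(lra).
  have ia : 0 < / 2 ^ a by apply: Rinv_0_lt_compat.
  move: hs; rewrite /Rdiv; move: (exit_fn n k x) (exit_fn (n + a)%N k x) (/ 2 ^ a) m1 m2 b1 b2 ia.
  move=> h h' i m1 m2 b1 b2 ia hs.
  have : eta * eta' <= h * (1 - h) by apply: Rmult_le_compat; lra.
  nra.
lra.
Qed.

Lemma le_of_sqr_le (x y : R) : 0 <= y -> x ^ 2 <= y ^ 2 -> x <= y.
Proof. by move=> y0 h; apply: Rsqr_incr_0_var => //; rewrite !Rsqr_pow2. Qed.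

(** * Boosting a small bit erasure probability *)

Section Boost.
Variables (p : R) (K : R).
Hypothesis p01 : 0 < p < 1.
Hypothesis K1 : 1 <= K.
Hypothesis HK : forall n a k l : nat, exists W : R, (0 <= W) /\
    (W ^ 2 <= exit_fn n k p ^ 3 * K ^ (2 * l)%N) /\
    (exit_fn (n + a) k p <= W + exit_fn n k p / INR l.+2 ^ a).

(** The low-degree part is [exp (- 3/2 e)] up to [K^l]; the rest is [exp (- e)] divided by
    [(l + 2)^a]. The factor 5/4, midway between 1 and 3/2, leaves [e / 4] to pay for [K^l], and the
    spare 1 in both exponents pays for adding two terms, as [2 / exp 1 <= 1]. *)
Lemma boost_step (n a k l : nat) (e : R) :
  exit_fn n k p <= exp (- e) -> INR l * ln K + 1 <= e / 4 -> e / 4 + 1 <= INR a * ln (INR l.+2) ->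
  exit_fn (n + a) k p <= exp (- (5 / 4 * e)).
Proof.
move=> h0 h1 h2; have [W [W0 [W1 W2]]] := HK n a k l.
have hp : 0 <= p <= 1 by lra.
have [H0 _] := exit_fn_bounds n k hp.
have K0 : 0 < K by lra.
have Kl : K ^ (2 * l)%N = exp (2 * (INR l * ln K)).
  rewrite -Rpower_pow // /Rpower mult_INR; congr exp; rewrite /=; ring.
have lpos : 0 < INR l.+2 by exact: INR_pos.
have hW : W <= exp (- (5 / 4 * e) - 1).
  apply: le_of_sqr_le; first by left; exact: exp_pos.
  apply: Rle_trans W1 _; rewrite Kl.
  have h3 : exit_fn n k p ^ 3 <= exp (- e) ^ 3 by apply: pow_incr.
  apply: (Rle_trans _ (exp (- e) ^ 3 * exp (2 * (INR l * ln K)))).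
    by apply: Rmult_le_compat_r => //; left; exact: exp_pos.
  rewrite /= !Rmult_1_r -!exp_plus; apply: exp_monotone; lra.
have hS : exit_fn n k p / INR l.+2 ^ a <= exp (- (5 / 4 * e) - 1).
  have -> : INR l.+2 ^ a = exp (INR a * ln (INR l.+2)) by rewrite -Rpower_pow.
  rewrite /Rdiv -exp_Ropp.
  apply: (Rle_trans _ (exp (- e) * exp (- (INR a * ln (INR l.+2))))).
    by apply: Rmult_le_compat_r => //; left; exact: exp_pos.
  rewrite -exp_plus; apply: exp_monotone; lra.
apply: Rle_trans W2 _; apply: (Rle_trans _ (2 * exp (- (5 / 4 * e) - 1))); first lra.
rewrite /Rminus exp_plus.
have e1 : exp (- (1)) <= / 2.
  rewrite exp_Ropp; apply: Rinv_le_contravar; first lra.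
  by have := exp_ineq1_le 1; lra.
have := exp_pos (- (5 / 4 * e)); nra.
Qed.

Lemma nceil_ex (x : R) : 0 <= x -> exists a : nat, x <= INR a <= x + 1.
Proof.
move=> x0; have [a [h1 h2]] := nfloor_ex x x0.
by exists a.+1; rewrite S_INR; lra.
Qed.

Lemma ln_l2 l : / 2 < ln (INR l.+2).
Proof.
apply: Rlt_le_trans ln_lt_2 _; apply: ln_le; first lra.
by have := @INR_leq 2 l.+2 isT; rewrite /=; lra.
Qed.

(** A step from exponent [e] costs [e / (4 b)] dimensions with [b = ln (l + 2)], which telescopes to
    the new exponent over [b], plus at most 3: less than 2 for [1 / b] and 1 for rounding up. *)
Lemma boost_iter (n k l : nat) (e0 : R) (i : nat) :
  exit_fn n k p <= exp (- e0) -> INR l * ln K + 1 <= e0 / 4 ->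
  exists B : nat, INR B <= (5 / 4) ^ i * e0 / ln (INR l.+2) + 3 * INR i /\
    exit_fn (n + B) k p <= exp (- ((5 / 4) ^ i * e0)).
Proof.
move=> h0 h1; have b0 := ln_l2 l; set b := ln _ in b0 *.
have lK : 0 <= INR l * ln K.
  apply: Rmult_le_pos; first exact: pos_INR.
  by rewrite -ln_1; apply: ln_le; lra.
have e0p : 0 < e0 by lra.
elim: i => [|i [B [IH1 IH2]]].
  exists 0%N; rewrite addn0 /= !Rmult_1_l; split => //.
  have := Rdiv_lt_0_compat _ _ e0p (Rlt_trans _ _ _ (Rinv_0_lt_compat 2 ltac:(lra)) b0); lra.
set e := (5 / 4) ^ i * e0 in IH1 IH2.
have ee : e0 <= e.
  rewrite -{1}(Rmult_1_l e0); apply: Rmult_le_compat_r; first lra.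
  by apply: pow_R1_Rle; lra.
have ib : / b < 2 by rewrite -(Rinv_inv 2); apply: Rinv_lt_contravar; nra.
have ib0 : 0 < / b by apply: Rinv_0_lt_compat; lra.
have [a [ha1 ha2]]   := @nceil_ex ((e / 4 + 1) / b) ltac:(apply: Rmult_le_pos; lra).
have hab : e / 4 + 1 <= INR a * b by apply/Rle_div_l; lra.
exists (B + a)%N; split; last first.
  rewrite addnA; have := @boost_step (n + B) a k l e IH2 ltac:(lra) hab.
  by rewrite /e (_ : 5 / 4 * ((5 / 4) ^ i * e0) = (5 / 4) ^ i.+1 * e0) //= ; ring.
rewrite plus_INR S_INR.
have -> : (5 / 4) ^ i.+1 * e0 / b = e / b + e / 4 / b by rewrite /e /=; field; lra.
have : (e / 4 + 1) / b = e / 4 / b + / b by field; lra.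
lra.
Qed.

Lemma least_index (P : nat -> Prop) N : P N ->
  exists2 i, P i & forall j, (j < i)%N -> ~ P j.
Proof.
elim: {N}_.+1 {-2}N (ltnSn N) => // M IH N; rewrite ltnS => NM PN.
case: (Classical_Prop.classic (exists2 j, (j < N)%N & P j)) => [[j jN Pj]|h].
  by apply: (IH j) => //; exact: leq_trans NM.
by exists N => // j jN Pj; apply: h; exists j.
Qed.

(** Stopping at the first exponent that reaches [X] overshoots by a factor of at most 5/4.
    Bernoulli's inequality [1 + i / 4 <= (5/4)^i] then bounds the number of steps and gives the
    constant 15. *)
Lemma boost_reach (n k l : nat) (e0 X : R) :
  exit_fn n k p <= exp (- e0) -> INR l * ln K + 1 <= e0 / 4 -> e0 <= X ->
  exists B : nat, INR B <= 5 / 4 * X / ln (INR l.+2) + 15 * X / e0 /\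
    exit_fn (n + B) k p <= exp (- X).
Proof.
move=> h0 h1 eX; have b0 := ln_l2 l.
have lK : 0 <= INR l * ln K.
  apply: Rmult_le_pos; first exact: pos_INR.
  by rewrite -ln_1; apply: ln_le; lra.
have e0p : 0 < e0 by lra.
have [N hN] : exists N : nat, X <= (5 / 4) ^ N * e0.
  have [N hN] := Pow_x_infinity (5 / 4) ltac:(rewrite Rabs_pos_eq; lra) (X / e0).
  exists N; have := hN N (Nat.le_refl N); rewrite Rabs_pos_eq; last by apply: pow_le; lra.
  by move=> h; apply/Rle_div_l; lra.
have [i hi1 hi2] := @least_index (fun i => X <= (5 / 4) ^ i * e0) N hN.
have [B [hB1 hB2]] := @boost_iter n k l e0 i h0 h1.
exists B; split; last by apply: Rle_trans hB2 _; apply: exp_monotone; lra.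
have hi3 : (5 / 4) ^ i * e0 <= 5 / 4 * X.
  case: i hi1 hi2 {hB1 hB2} => [|i] hi1 hi2; first by rewrite /=; lra.
  have := hi2 i (ltnSn i) => /Rnot_le_lt h.
  by rewrite /=; lra.
apply: Rle_trans hB1 _; apply: Rplus_le_compat.
  by apply: Rmult_le_compat_r => //; left; apply: Rinv_0_lt_compat; lra.
have hb : 1 + INR i / 4 <= (5 / 4) ^ i.
  have := Rfunctions.poly i (/ 4) ltac:(lra); rewrite (_ : 1 + / 4 = 5 / 4); lra.
apply: (proj1 (Rle_div_r (3 * INR i) (15 * X) e0 e0p)).
have : (1 + INR i / 4) * e0 <= (5 / 4) ^ i * e0 by apply: Rmult_le_compat_r; lra.
lra.
Qed.
End Boost.

(** * Asymptotics *)

Lemma INR_expn (b n : nat) : INR (b ^ n)%N = INR b ^ n.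
Proof. by elim: n => [//|n IH]; rewrite expnS mult_INR IH. Qed.

Lemma bin_le_sqrt (n k : nat) : INR 'C(n, k) * sqrt (INR n) <= 2 ^ n.
Proof.
apply: le_of_sqr_le; first by apply: pow_le; lra.
have -> : (INR 'C(n, k) * sqrt (INR n)) ^ 2 = INR ('C(n, k) ^ 2 * n)%N.
  rewrite mult_INR INR_expn /= -{3}(sqrt_sqrt _ (pos_INR n)); ring.
have -> : (2 ^ n) ^ 2 = INR (4 ^ n)%N.
  rewrite INR_expn -pow_mult (_ : Nat.mul n 2 = Nat.mul 2 n); last lia.
  by rewrite pow_mult; congr (_ ^ _); rewrite /=; ring.
by apply: INR_leq; exact: bin_sqr_bound.
Qed.

Lemma rate_step (n v : nat) : (0 < n)%N -> RM_rate v n - RM_rate v n.+1 <= / sqrt (INR n).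
Proof.
move=> n0; have := sum_bin_step n v; rewrite /RM_rate.
move: (\sum_(0 <= k < v.+1) 'C(n.+1, k))%N (\sum_(0 <= k < v.+1) 'C(n, k))%N => S' S e.
have eR : INR S' + INR 'C(n, v) = 2 * INR S by have := congr1 INR e; rewrite plus_INR mult_INR -[INR 2]/2.
have s0 : 0 < sqrt (INR n) by apply: sqrt_lt_R0; exact: INR_pos.
have p0 : 0 < 2 ^ n by apply: pow_lt; lra.
have -> : INR S / 2 ^ n - INR S' / 2 ^ n.+1 = INR 'C(n, v) / (2 * 2 ^ n).
  have -> : INR S' = 2 * INR S - INR 'C(n, v) by lra.
  by rewrite /=; field; lra.
apply: (Rmult_le_reg_r (sqrt (INR n))) => //; rewrite Rinv_l; last lra.
have -> : INR 'C(n, v) / (2 * 2 ^ n) * sqrt (INR n) = INR 'C(n, v) * sqrt (INR n) / (2 * 2 ^ n).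
  by field; lra.
apply/Rle_div_l; first lra.
by have := bin_le_sqrt n v; lra.
Qed.

Lemma rate_drop (n a v : nat) : (0 < n)%N ->
  RM_rate v n - RM_rate v (n + a) <= INR a / sqrt (INR n).
Proof.
move=> n0; have s0 : 0 < sqrt (INR n) by apply: sqrt_lt_R0; exact: INR_pos.
elim: a => [|a IH]; first by rewrite addn0 Rminus_diag /= /Rdiv Rmult_0_l; lra.
have na0 : (0 < n + a)%N by rewrite addn_gt0 n0.
have h := rate_step v na0; rewrite addnS S_INR.
have : / sqrt (INR (n + a)) <= / sqrt (INR n).
  apply: Rinv_le_contravar => //; apply: sqrt_le_1; try exact: pos_INR.
  by apply: INR_leq; exact: leq_addr.
have -> : (INR a + 1) / sqrt (INR n) = INR a / sqrt (INR n) + / sqrt (INR n) by field; lra.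
lra.
Qed.

Lemma exp_ge_self x : x <= exp x.
Proof. by have := exp_ineq1_le x; lra. Qed.

Lemma exp_neg_le x : 0 < x -> exp (- x) <= / x.
Proof.
move=> x0; rewrite exp_Ropp; apply: Rinv_le_contravar => //; exact: exp_ge_self.
Qed.

Section Asymptotics.
Variables (m : nat) (y : R).
Hypothesis y1 : 1 <= y.
Hypothesis hm : INR m = exp (y ^ 4).

(** [sq] is [sqrt m] and [X1] is [m^(1/4)]. [X2] is twice the exponent [L sqrt m ln 2] of
    [block_bound] at [L = y^3]: one half cancels the factor there, the other half makes the product
    small. *)
Let sq := exp (y ^ 4 / 2).
Let X1 := exp (y ^ 4 / 4).
Let X2 := 2 * y ^ 3 * sq * ln 2.

Lemma sqrt_m : sqrt (INR m) = sq.
Proof.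
rewrite hm /sq -(sqrt_square (exp (y ^ 4 / 2))); last by left; exact: exp_pos.
by rewrite -exp_plus; congr (sqrt (exp _)); field.
Qed.

Lemma y_pow_le (i j : nat) : (i <= j)%coq_nat -> y ^ i <= y ^ j.
Proof. by move=> ij; apply: Rle_pow. Qed.

(* The two boosting phases start at exponents [4] and [X1], and the second one uses
   sets of size about [m^(1/8)]; their total cost is [o(sqrt m)] dimensions. *)
Lemma exit_tiny (k n : nat) (p K : R) : 0 < p < 1 -> 1 <= K ->
  (forall n a k l : nat, exists W : R, (0 <= W) /\
    (W ^ 2 <= exit_fn n k p ^ 3 * K ^ (2 * l)%N) /\
    (exit_fn (n + a) k p <= W + exit_fn n k p / INR l.+2 ^ a)) ->
  32 * (ln K + 1) <= y ->
  exit_fn n k p <= exp (- (4)) ->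
  exists B : nat, INR B <= 165 * sq / y /\ exit_fn (n + B) k p <= exp (- X2).
Proof.
move=> hp K1 HK yK h0.
have lK : 0 <= ln K by rewrite -ln_1; apply: ln_le; lra.
have l2 := ln_lt_2; have l2' : ln 2 <= 1.
  rewrite -[X in _ <= X]ln_exp; apply: ln_le; first lra.
  by have := exp_ineq1_le 1; lra.
pose q := exp (y ^ 4 / 8).
have y3 : 1 <= y ^ 3 by apply: pow_R1_Rle.
have y4 : y <= y ^ 4 by have := @y_pow_le 1 4 ltac:(lia); rewrite pow_1.
have qX : X1 = q * q by rewrite /q /X1 -exp_plus; congr exp; field.
have Xs : sq = X1 * X1 by rewrite /sq /X1 -exp_plus; congr exp; field.
have q4 : 4 * (ln K + 1) <= q by apply: Rle_trans (exp_ge_self _); lra.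
have X14 : 4 <= X1 by rewrite qX; nra.
have sX1 : X1 <= sq by rewrite Xs; nra.
have X12 : X1 <= X2.
  apply: Rle_trans sX1 _; rewrite /X2.
  have : sq <= y ^ 3 * sq by have := exp_pos (y ^ 4 / 2); rewrite -/sq; nra.
  have : 0 < y ^ 3 * sq by apply: Rmult_lt_0_compat; [lra | exact: exp_pos].
  nra.
(* With [l = 0] the condition on the starting exponent is [1 <= e0 / 4], whence the value 4. This
   phase costs [O(X1)] dimensions. *)
have [B1 [hB1 hH1]] := @boost_reach p K hp K1 HK n k 0 4 X1 h0 ltac:(rewrite /=; lra) X14.
have q0 : 0 <= q by left; exact: exp_pos.
(* Since [q * q = X1], [l * ln K] stays well below [X1 / 4], while [ln l] is still of order
   [ln m = y^4]. *)
have [l [hl1 hl2]] := nfloor_ex q q0.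
have hl : INR l * ln K + 1 <= X1 / 4.
  have : INR l * ln K <= q * ln K by apply: Rmult_le_compat_r.
  rewrite qX; nra.
have [B2 [hB2 hH2]] := @boost_reach p K hp K1 HK (n + B1)%N k l X1 X2 hH1 hl X12.
exists (B1 + B2)%N; split; last by rewrite addnA.
have sq0 : 0 < sq by exact: exp_pos.
have X10 : 0 < X1 by exact: exp_pos.
have y40 : 0 < y ^ 4 by lra.
have bl : y ^ 4 / 8 <= ln (INR l.+2).
  rewrite -(ln_exp (y ^ 4 / 8)) -/q; apply: ln_le; first exact: exp_pos.
  by rewrite !S_INR; lra.
have X1s : X1 <= sq * (4 / y ^ 4).
  have -> : X1 = sq * exp (- (y ^ 4 / 4)) by rewrite /X1 /sq -exp_plus; congr exp; field.
  apply: Rmult_le_compat_l; first lra.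
  apply: Rle_trans (exp_neg_le _) _; first lra.
  by right; field; lra.
have y4i : 4 / y ^ 4 <= 4 / y.
  by apply: Rmult_le_compat_l; [lra | apply: Rinv_le_contravar; lra].
have X1s' : X1 <= 4 * (sq / y).
  apply: Rle_trans X1s _; apply: (Rle_trans _ (sq * (4 / y))).
    by apply: Rmult_le_compat_l; lra.
  by right; field; lra.
have b1 : INR B1 <= 25 * (sq / y).
  apply: Rle_trans hB1 _; rewrite -[INR 2]/2.
  have : 5 / 4 * X1 / ln 2 <= 5 / 4 * X1 * 2.
    apply: Rmult_le_compat_l; first lra.
    apply: (Rle_trans _ (/ / 2)); last by rewrite Rinv_inv; lra.
    by apply: Rinv_le_contravar; lra.
  lra.
have X2b : X2 <= 2 * y ^ 3 * sq.
  have : 0 < y ^ 3 * sq by apply: Rmult_lt_0_compat; lra.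
  rewrite /X2; nra.
have X20 : 0 < X2 by lra.
have b2 : 5 / 4 * X2 / ln (INR l.+2) <= 20 * (sq / y).
  apply: (Rle_trans _ (5 / 4 * (2 * y ^ 3 * sq) / (y ^ 4 / 8))).
    apply: Rmult_le_compat; [lra | left; apply: Rinv_0_lt_compat; lra | lra | ].
    by apply: Rinv_le_contravar; lra.
  by right; field; lra.
have b3 : 15 * X2 / X1 <= 120 * (sq / y).
  apply/Rle_div_l => //; apply: (Rle_trans _ (30 * y ^ 3 * sq)); first lra.
  have : y ^ 4 / 4 <= X1 by exact: exp_ge_self.
  move=> hx; apply: (Rle_trans _ (120 * (sq / y) * (y ^ 4 / 4))).
    by right; field; lra.
  apply: Rmult_le_compat_l => //.
  by apply: Rmult_le_pos; [lra | left; apply: Rdiv_lt_0_compat; lra].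
rewrite plus_INR (_ : 165 * sq / y = 165 * (sq / y)); last by field; lra.
lra.
Qed.

End Asymptotics.

(** * Choice of the constants and conclusion *)

Lemma capacity_bound (r p : R) : 0 < r < 1 -> 0 <= p < 1 - r ->
  exists Y A : R, forall (m : nat) (y : R), Y <= y -> 0 < y -> INR m = exp (y ^ 4) ->
    RM_rate (v_seq r m) m <= r + (1 - r - p) / 12 ->
    PB (RM (v_seq r m) m) p <= A / y.
Proof.
move=> hr hp; set dl := 1 - r - p; have dl0 : 0 < dl by rewrite /dl; lra.
(* The distance from [p] to [1 - r] is cut into thirds: the death process runs between [p1] and [p],
   the jump of the EXIT function is located with the help of [p1] and [p2], and the last third keeps
   [H(p2)] away from 1. *)
pose p1 := p + dl / 3; pose p2 := p + 2 * dl / 3.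
have p2e : 1 - p2 = r + dl / 3 by rewrite /p2 /dl; field.
have dle : dl = 1 - r - p by [].
have hp1 : 0 < p1 < 1 by rewrite /p1; lra.
(* [eta'] makes [exit_gap] apply to rates up to [r + dl / 6]: [dl / 12] is granted at dimension [m],
   and [dl / 12] is kept for the drop of the rate between [n] and [m]. *)
pose eta := exp (- (4)); pose eta' := dl / 6 / (1 - p2).
have eta0 : 0 < eta by exact: exp_pos.
have eta0' : 0 < eta' by apply: Rdiv_lt_0_compat; lra.
have er : (1 - eta') * (1 - p2) = r + dl / 6.
  by rewrite /eta' Rmult_minus_distr_r /Rdiv Rmult_assoc Rinv_l; lra.
have ee0 : 0 < eta * eta' / 2 by apply: Rmult_lt_0_compat; [exact: Rmult_lt_0_compat | lra].
have [a ha] : exists a : nat, / 2 ^ a <= eta * eta' / 2.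
  have [a ha] := pow_lt_1_zero (/ 2) ltac:(rewrite Rabs_pos_eq; lra) _ ee0.
  exists a; have := ha a (Nat.le_refl a); rewrite pow_inv => h.
  by have := Rle_abs (/ 2 ^ a); lra.
have [K [K1 HK]] := exit_fn_boost hp1.
have lK : 0 <= ln K by rewrite -ln_1; apply: ln_le; lra.
pose x := Qinv (1 - r); pose c := Rabs x / 2.
have c0 : 0 <= c by rewrite /c; have := Rabs_pos x; lra.
pose g := eta * eta' / 2 * (dl / 3).
have g0 : 0 < g by apply: Rmult_lt_0_compat => //; lra.
(* In the threshold, [8 * c] serves [block_bound], the term with [ln K] serves [exit_tiny],
   [332 * (12 / dl)] keeps the rate drop from [n] to [m] below [dl / 12], and [3 * INR a / g] keeps
   the drop over [a] dimensions below [g]. *)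
exists (1000 + 8 * c + 32 * (ln K + 1) + 332 * (12 / dl) + 3 * INR a / g), (2 + 6 / dl).
move=> m y hY y0 hm hrate.
have dl12 : 0 < 12 / dl by apply: Rdiv_lt_0_compat; lra.
have ag : 0 <= 3 * INR a / g.
  by apply: Rmult_le_pos; [have := pos_INR a; lra | left; apply: Rinv_0_lt_compat].
have y1 : 1000 <= y by lra.
have y1' : 1 <= y by lra.
have hsq := sqrt_m hm; set sq := exp (y ^ 4 / 2) in hsq.
have yp i j := @y_pow_le y y1' i j.
have y13 : y <= y ^ 3 by have := yp 1%N 3%N ltac:(lia); rewrite pow_1.
have y34 : 1000 * y ^ 3 <= y ^ 4.
  by rewrite -[y ^ 4]tech_pow_Rmult; apply: Rmult_le_compat_r; lra.
have sq_y3 : y ^ 3 <= sq by apply: Rle_trans (exp_ge_self _); lra.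
have sq0 : 0 < sq by exact: exp_pos.
have mm : sq * sq = INR m by rewrite hm /sq -exp_plus; congr exp; field.
have m0 : (0 < m)%N.
  by case: (m) hm => // h; have := exp_pos (y ^ 4); rewrite -h /=; lra.
set v := v_seq r m in hrate *.
have hxa : - (2 * c) <= x <= 2 * c.
  have -> : 2 * c = Rabs x by rewrite /c; field.
  by apply/Rabs_le_between; lra.
have w0 : 0 <= INR m / 2 + sqrt (INR m) / 2 * x by rewrite hsq -mm; nra.
have [hv _] := v_seq_floor w0; rewrite -/v -/x hsq in hv.
have hvm : INR m / 2 - c * sq <= INR m - INR v by nra.
have vm : (v <= m)%N.
  apply/ssrnat.leP; apply: INR_le; nra.
pose X2 := 2 * y ^ 3 * sq * ln 2.
have sqy : y <= sq by lra.
have sqy1 : 1 <= sq / y by apply/Rle_div_r; lra.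
(* [t] is the number of dimensions set aside for boosting; the jump is studied in dimension
   [n = m - t]. *)
have [t [ht1 ht2]] := @nceil_ex (165 * sq / y)
  ltac:(left; apply: Rdiv_lt_0_compat; lra).
have ht : INR t <= 166 * (sq / y).
  by move: ht2; rewrite (_ : 165 * sq / y = 165 * (sq / y)); [lra | field; lra].
have ht4 : INR t <= 3 / 4 * INR m.
  apply: Rle_trans ht _; apply: (Rle_trans _ (166 * (sq / 1000))).
    apply: Rmult_le_compat_l; first lra.
    by apply: Rmult_le_compat_l; [lra | apply: Rinv_le_contravar; lra].
  by rewrite -mm; nra.
have tm : (t <= m)%N by apply/ssrnat.leP; apply: INR_le; have := pos_INR m; lra.
pose n := (m - t)%N.
have nm : (n + t)%N = m by rewrite /n subnK.
have nR : INR n = INR m - INR t by rewrite -nm plus_INR; ring.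
have n4 : INR m / 4 <= INR n by lra.
have mpos : 0 < INR m by exact: INR_pos.
have n0 : (0 < n)%N by apply/ssrnat.ltP; apply: INR_lt; rewrite /=; lra.
have sn : sq / 2 <= sqrt (INR n).
  have -> : sq / 2 = sqrt (INR m / 4); last by apply: sqrt_le_1; lra.
  by rewrite -mm (_ : sq * sq / 4 = (sq / 2) * (sq / 2)); [rewrite sqrt_square; lra | field].
have isn : / sqrt (INR n) <= 2 / sq.
  have -> : 2 / sq = / (sq / 2) by field; lra.
  by apply: Rinv_le_contravar; lra.
(* Otherwise the EXIT function stays away from 0 and 1 between [p1] and [p2], and [exit_gap] makes
   the rate fall by at least [g] over [a] dimensions. Since [a] and [g] are fixed, this contradicts
   the fall of order [a / sqrt n]. *)
have start : exit_fn n v.+1 p1 <= exp (- (4)).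
  case: (Rle_lt_dec (exit_fn n v.+1 p1) (exp (- (4)))) => // hbig; exfalso.
  have d1 := rate_drop t v n0; rewrite nm in d1.
  have d2 : INR t / sqrt (INR n) <= 332 / y.
    apply: (Rle_trans _ (166 * (sq / y) * (2 / sq))).
      by apply: Rmult_le_compat => //; [exact: pos_INR | left; apply: Rinv_0_lt_compat; lra].
    by right; field; lra.
  have d3 : 332 / y <= dl / 12.
    apply/Rle_div_l => //; apply: (Rle_trans _ (dl / 12 * (332 * (12 / dl)))).
      by right; field; lra.
    by apply: Rmult_le_compat_l; lra.
  have hR : RM_rate v n <= (1 - eta') * (1 - p2) by rewrite er; rewrite -/dl in hrate; lra.
  have p12 : p1 < p2 by rewrite /p1 /p2; lra.
  have := @exit_gap n a v p1 p2 eta eta' (proj1 hp1) p12 ltac:(lra) ltac:(lra) ltac:(lra)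
    hR (Rlt_le _ _ hbig).
  have d4 := rate_drop a v n0.
  have d5 : INR a / sqrt (INR n) <= INR a * (2 / y).
    apply: Rmult_le_compat_l; first exact: pos_INR.
    apply: Rle_trans isn _; apply: Rmult_le_compat_l; first lra.
    by apply: Rinv_le_contravar; lra.
  have d6 : INR a * (2 / y) < g.
    have -> : INR a * (2 / y) = INR a * 2 / y by field; lra.
    apply/Rlt_div_l => //.
    have : g * (3 * INR a / g) = 3 * INR a by field; lra.
    have : g * (3 * INR a / g) < g * y by apply: Rmult_lt_compat_l; lra.
    by have := pos_INR a; lra.
  have e12 : p2 - p1 = dl / 3 by rewrite /p1 /p2; field.
  rewrite e12 => d7.
  have : g <= (eta * eta' - / 2 ^ a) * (dl / 3).
    by rewrite /g; apply: Rmult_le_compat_r; lra.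
  lra.
have [B [hB hH]] := @exit_tiny y y1' v.+1 n p1 K hp1 K1 HK ltac:(lra) start.
rewrite -/sq -/X2 in hB hH.
have Bt : (B <= t)%N by apply/ssrnat.leP; apply: INR_le; lra.
have hHm : exit_fn m v.+1 p1 <= exp (- X2).
  have := exit_fn_anti (n + B) (t - B) v.+1 hp1.
  rewrite -addnA subnKC // nm; lra.
have l2 := ln_lt_2.
have := @block_bound m v c (y ^ 3) p p1 m0 vm c0 ltac:(lra) ltac:(lra) ltac:(rewrite hsq; lra)
  ltac:(rewrite hsq; lra) (proj1 hp) ltac:(rewrite /p1; lra) ltac:(lra).
rewrite hsq => /Rle_trans; apply.
have z1 : exp (y ^ 3 * sq * ln 2) * exit_fn m v.+1 p1 <= 2 / y.
  apply: (Rle_trans _ (exp (y ^ 3 * sq * ln 2) * exp (- X2))).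
    by apply: Rmult_le_compat_l => //; left; exact: exp_pos.
  rewrite -exp_plus (_ : _ + - X2 = - (y ^ 3 * sq * ln 2)); last by rewrite /X2; ring.
  have zz : y / 2 <= y ^ 3 * sq * ln 2.
    have : y <= y ^ 3 * sq by nra.
    by move=> zz; have : 0 < y ^ 3 * sq by [lra]; nra.
  apply: Rle_trans (exp_neg_le _) _; first lra.
  have -> : 2 / y = / (y / 2) by field; lra.
  by apply: Rinv_le_contravar; lra.
(* Here [L^2 / 4 = y^6 / 4] outweighs [ln m = y^4]. *)
have z2 : (INR m + 1) * exp (- ((y ^ 3) ^ 2 / 4)) <= 2 / y.
  have m1 : 1 <= INR m by have := INR_leq m0; rewrite /=; lra.
  apply: (Rle_trans _ (2 * INR m * exp (- ((y ^ 3) ^ 2 / 4)))).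
    by apply: Rmult_le_compat_r; [left; exact: exp_pos | lra].
  rewrite hm Rmult_assoc -exp_plus; apply: Rmult_le_compat_l; first lra.
  apply: (Rle_trans _ (exp (- y))); last exact: exp_neg_le.
  apply: exp_monotone.
  have : 8 * y ^ 4 <= (y ^ 3) ^ 2.
    have -> : (y ^ 3) ^ 2 = y ^ 2 * y ^ 4 by ring.
    by apply: Rmult_le_compat_r; nra.
  lra.
have e1 : p1 - p = dl / 3 by rewrite /p1; field.
rewrite e1.
have -> : (2 + 6 / dl) / y = 2 / y + 2 / y / (dl / 3) by field; lra.
apply: Rplus_le_compat => //; apply: Rmult_le_compat_r => //.
by left; apply: Rinv_0_lt_compat; lra.
Qed.

Lemma exists_y (m : nat) (Y : R) : 1 <= Y -> exp (Y ^ 4) <= INR m ->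
  exists2 y, Y <= y & INR m = exp (y ^ 4).
Proof.
move=> Y1 hY; have e0 := exp_pos (Y ^ 4).
have hl : Y ^ 4 <= ln (INR m) by rewrite -(ln_exp (Y ^ 4)); apply: ln_le.
have Y4 : 0 <= Y ^ 4 by apply: pow_le; lra.
pose s := sqrt (ln (INR m)); have s0 : 0 <= s by exact: sqrt_pos.
have s2 : s * s = ln (INR m) by apply: sqrt_sqrt; lra.
have t2 : sqrt s * sqrt s = s by apply: sqrt_sqrt.
have t0 := sqrt_pos s.
exists (sqrt s).
  have : (Y * Y) * (Y * Y) <= s * s by rewrite s2; move: hl; rewrite /=; lra.
  by move=> h; have : Y * Y <= s by [nra]; nra.
have -> : sqrt s ^ 4 = ln (INR m) 
  by rewrite (_ : sqrt s ^ 4 = (sqrt s * sqrt s) * (sqrt s * sqrt s)); [rewrite t2 s2 | ring].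
by rewrite exp_ln; lra.
Qed.

Theorem theorem7 (r : R) (hr : 0 < r < 1) :
  Un_cv (fun m => RM_rate (v_seq r m) m) r /\
  (forall p, 0 <= p < 1 - r -> Un_cv (fun m => PB (RM (v_seq r m) m) p) 0).
Proof.
split; first exact: RM_rate_cvg.
move=> p hp eps eps0; have [Y [A hA]] := capacity_bound hr hp.
have d0 : 0 < (1 - r - p) / 12 by lra.
have [N1 hN1] := RM_rate_cvg hr d0.
pose Y' := 1 + Rabs Y + (Rabs A + 1) / eps.
have a0 : 0 < (Rabs A + 1) / eps by apply: Rdiv_lt_0_compat => //; have := Rabs_pos A; lra.
have Y1 : 1 <= Y' by rewrite /Y'; have := Rabs_pos Y; lra.
have YY : Y <= Y' by rewrite /Y'; have := Rle_abs Y; lra.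
have [N2 [_ hN2]] := nfloor_ex (exp (Y' ^ 4)) (Rlt_le _ _ (exp_pos _)).
exists (Nat.add N1 (Nat.add N2 1)) => m hm.
have [y hy1 hy2] : exists2 y, Y' <= y & INR m = exp (y ^ 4).
  apply: exists_y => //; have : (Nat.add N2 1 <= m)%coq_nat by lia.
  by move/le_INR; rewrite plus_INR -[INR 1]/1; lra.
have hrate : RM_rate (v_seq r m) m <= r + (1 - r - p) / 12.
  by have := hN1 m ltac:(lia); rewrite /Rdist => /Rabs_lt_between; lra.
have hb := hA m y ltac:(lra) ltac:(lra) hy2 hrate.
have pb0 : 0 <= PB (RM (v_seq r m) m) p by rewrite PB_dimc_tail; apply: (proj1 (dimc_tail_bounds _ _ _ _)); lra.
rewrite /Rdist Rminus_0_r Rabs_pos_eq //; apply: Rle_lt_trans hb _.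
apply/Rlt_div_l; first lra.
have : (Rabs A + 1) / eps * eps = Rabs A + 1 by field; lra.
have := Rle_abs A; have : (Rabs A + 1) / eps <= y by move: hy1; rewrite /Y'; have := Rabs_pos Y; lra.
nra.
Qed.
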